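(* Let $(G,\gamma)$ be a connected group-labeled graph with $m$ edges and total word length $\ell$, labeled over a finitely generated group $\Gamma$ equipped with an oracle solving the word problem in time $\phi(n)$ on words of length $n$, and let $a,b$ be vertices of $G$. Then one can decide in time $\mathcal{O}(\ell m)\cdot\phi(12\ell)$ whether every Eulerian trail of $G$ from $a$ to $b$ has the same label. Moreover, in the affirmative case (when $G$ has an Eulerian trail $C$ from $a$ to $b$, which the algorithm computes), the algorithm finds a shifting $\gamma'$ of $\gamma$ of difference at most $\ell$ from $\gamma$ such that for each core $X$ of $G$, the labeling $\gamma_H$ of the graph $H$ obtained from $X$ (with respect to $(G,a,b,C)$ and $\gamma'$) satisfies $\langle H,\gamma_H\rangle\cong\mathbb{Z}_2^k$ for some $k\in\mathbb{N}$.
   Context: Graphs are finite, undirected, loops and parallel edges allowed. A group-labeled graph $(G,\gamma)$ has $\gamma$ from arcs (orientations $\vec e,\vec e^{-1}$ of edges) to $\Gamma$ with $\gamma(\vec e^{-1})=\gamma(\vec e)^{-1}$; $\langle G,\gamma\rangle$ is the subgroup generated by all $\gamma(\vec e)$. A trail is a sequence of arcs with distinct underlying edges, head of each equal to tail of the next; its label is the product of arc labels in order; it is Eulerian if it uses exactly one orientation of every edge. The oracle decides whether a word over the generators of $\Gamma$ and their inverses equals the identity. Labels are stored as such words, the graph as an adjacency list, with the label of $\vec e^{-1}$ the formal inverse word of that of $\vec e$. Total word length: the sum over edges $e$ of the length of $\gamma(\vec e)$. Shifting by $\alpha$ at $v$ multiplies labels of arcs with tail $v$ on the left by $\alpha$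 and labels of arcs with head $v$ on the right by $\alpha^{-1}$; a shifting is specified by a word $\alpha_v$ per vertex, and its difference is the maximum length of these words. A core of $G$ is a maximal vertex set with pairwise edge-connectivity at least $3$. For a core $X$ and an Eulerian trail $C$ from $a$ to $b$, with $\delta(X)$ the edges having exactly one end in $X$: $H$ has vertex set $X$, contains each edge $e$ of $G$ with both ends in $X$ with $\gamma_H(\vec e)=\gamma'(\vec e)$, and for each subtrail $T$ of $C$ whose first and last arcs have underlying edges in $\delta(X)$, which begins and ends in $X$ and has no internal vertex in $X$, $H$ has a new edge $e$ with $\vec e$ from the tail of $T$ to the head of $T$ and $\gamma_H(\vec e)=\gamma'(T)$.
   Formalization: The time bound is read as O(max(1,ℓ)·max(1,m))·φ(12ℓ), since the literal bound is 0 when ℓ=0 or m=0, and the oracle time φ is assumed nondecreasing with φ(n) ≥ max(1,n). *)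

(* Defs.v *)
From HB Require Import structures.
From mathcomp Require Import all_boot all_order all_algebra.

Set Implicit Arguments.
Unset Strict Implicit.
Unset Printing Implicit Defensive.

Import GRing.Theory.

(* A graph stores one reference orientation [ends e] and the label of that
   orientation for each edge e; the two arcs of e are (e, false), the reference
   orientation, and (e, true), its inverse.  In particular a loop has two
   distinct arcs, with mutually inverse labels. *)
Record lgraph (gT : groupType) := LGraph {
  vert : finType;
  edge : finType;
  ends : edge -> vert * vert;
  elab : edge -> gT
}.

Notation arc_of E := (E * bool)%type (only parsing).

Definition arc_rev (E : Type) (x : arc_of E) : arc_of E := (x.1, ~~ x.2).

Definition arc_tail (V E : Type) (ends : E -> V * V) (x : arc_of E) : V :=
  if x.2 then (ends x.1).2 else (ends x.1).1.
Definition arc_head (V E : Type) (ends : E -> V * V) (x : arc_of E) : V :=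
  if x.2 then (ends x.1).1 else (ends x.1).2.

Section Graphs.
Variables (gT : groupType) (G : lgraph gT).
Local Open Scope group_scope.

Definition garc := arc_of (edge G).
Definition atail (x : garc) : vert G := arc_tail (@ends _ G) x.
Definition ahead (x : garc) : vert G := arc_head (@ends _ G) x.
Definition alab (x : garc) : gT := if x.2 then (elab x.1)^-1 else elab x.1.

Lemma alab_rev (x : garc) : alab (arc_rev x) = (alab x)^-1.
Proof. by case: x => e [] //; rewrite /alab /= invgK. Qed.

Fixpoint walk (u : vert G) (C : seq garc) (v : vert G) : bool :=
  if C is x :: C' then (atail x == u) && walk (ahead x) C' v else u == v.

Definition trail u C v := walk u C v && uniq [seq x.1 | x <- C].

Definition eulerian_trail u C v :=
  trail u C v && [forall e : edge G, e \in [seq x.1 | x <- C]].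

Definition tlab (C : seq garc) : gT := \prod_(x <- C) alab x.

Definition all_eulerian_same_label (u v : vert G) : Prop :=
  forall C D, eulerian_trail u C v -> eulerian_trail u D v -> tlab C = tlab D.

Definition adjacent_avoiding (F : {set edge G}) : rel (vert G) :=
  fun u v => [exists x : garc, [&& x.1 \notin F, atail x == u & ahead x == v]].

Definition connected_graph : Prop :=
  forall u v : vert G, connect (adjacent_avoiding set0) u v.

Definition edge_connectivity_ge (r : nat) (u v : vert G) : bool :=
  [forall F : {set edge G}, (#|F| < r) ==> connect (adjacent_avoiding F) u v].

Definition core (X : {set vert G}) : bool :=
  maxset (fun Y : {set vert G} =>
    [forall u in Y, forall v in Y, (u != v) ==> edge_connectivity_ge 3 u v]) X.

Definition boundary (X : {set vert G}) : {set edge G} :=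
  [set e | ((ends e).1 \in X) != ((ends e).2 \in X)].

Definition inner_edge (X : {set vert G}) (e : edge G) : bool :=
  ((ends e).1 \in X) && ((ends e).2 \in X).

Definition subtrails (C : seq garc) : seq (seq garc) :=
  [seq take j (drop i C) | i <- iota 0 (size C), j <- iota 1 (size C)].

(* The internal vertices of x :: s are the heads of all its arcs but the last. *)
Definition excursion (X : {set vert G}) (T : seq garc) : bool :=
  if T is x :: s then
    [&& atail x \in X, ahead (last x s) \in X,
        x.1 \in boundary X, (last x s).1 \in boundary X
      & all (fun y => ahead y \notin X) (belast x s)]
  else false.

Definition excursions (X : {set vert G}) (C : seq garc) : seq (seq garc) :=
  [seq T <- subtrails C | excursion X T].

Section CoreGraph.
Variables (X : {set vert G}) (C : seq garc).

Definition core_vert : finType := {v : vert G | v \in X}.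

Definition core_edge : finType :=
  ({e : edge G | inner_edge X e} + seq_sub (excursions X C))%type.

Definition inner_ends (e : {e : edge G | inner_edge X e}) :
    core_vert * core_vert :=
  (exist _ (ends (val e)).1 (proj1 (andP (valP e))),
   exist _ (ends (val e)).2 (proj2 (andP (valP e)))).

Lemma excursion_tail x s : excursion X (x :: s) -> atail x \in X.
Proof. by case/and5P. Qed.

Lemma excursion_head x s : excursion X (x :: s) -> ahead (last x s) \in X.
Proof. by case/and5P. Qed.

Definition excursion_ends (T : seq garc) :
    excursion X T -> core_vert * core_vert :=
  match T return excursion X T -> core_vert * core_vert with
  | [::] => fun h => False_rect _ (notF h)
  | x :: s => fun h => (exist _ (atail x) (excursion_tail h),
                        exist _ (ahead (last x s)) (excursion_head h))
  end.

Lemma excursionsP (T : seq_sub (excursions X C)) : excursion X (ssval T).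
Proof. by case: T => T /=; rewrite mem_filter => /andP[]. Qed.

(* The graph H obtained from X with respect to C; the labels are those of G, so
   it is to be applied to the shifted graph. *)
Definition core_graph : lgraph gT :=
  @LGraph gT core_vert core_edge
    (fun e => match e with
              | inl e => inner_ends e
              | inr T => excursion_ends (excursionsP T)
              end)
    (fun e => match e with
              | inl e => elab (val e)
              | inr T => tlab (ssval T)
              end).
End CoreGraph.

Definition shift (alpha : vert G -> gT) : lgraph gT :=
  @LGraph gT (vert G) (edge G) (@ends _ G)
    (fun e => alpha (ends e).1 * elab e * (alpha (ends e).2)^-1).

End Graphs.

Lemma alab_shift (gT : groupType) (G : lgraph gT) (alpha : vert G -> gT)
    (x : garc G) :
  @alab gT (shift alpha) x = (alpha (atail x) * alab x * (alpha (ahead x))^-1)%g.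
Proof. by case: x => e []; rewrite /alab //= !invgM invgK mulgA. Qed.

Inductive generated (gT : groupType) (S : gT -> Prop) : gT -> Prop :=
| generated_one : generated S 1%g
| generated_mem x : S x -> generated S x
| generated_mul x y : generated S x -> generated S y -> generated S (x * y)%g
| generated_inv x : generated S x -> generated S (x^-1)%g.

Definition label_group (gT : groupType) (G : lgraph gT) : gT -> Prop :=
  generated (fun z => exists x : garc G, z = alab x).

Definition isomorphic_Z2_pow (gT : groupType) (A : gT -> Prop) (k : nat) : Prop :=
  exists f : 'rV['Z_2]_k -> gT,
    [/\ injective f,
        forall x y, f (x + y)%R = (f x * f y)%g
      & forall z, A z <-> exists x, z = f x].

(* (i, false) stands for the i-th generator, (i, true) for its inverse. *)
Definition word (k : nat) : Type := seq ('I_k * bool).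

Definition letter_val (gT : groupType) (k : nat) (g : 'I_k -> gT)
    (x : 'I_k * bool) : gT :=
  if x.2 then ((g x.1)^-1)%g else g x.1.

Definition word_val (gT : groupType) (k : nat) (g : 'I_k -> gT) (w : word k) : gT :=
  (\prod_(x <- w) letter_val g x)%g.

Definition word_inv (k : nat) (w : word k) : word k :=
  rev [seq (x.1, ~~ x.2) | x <- w].

Lemma word_val_inv (gT : groupType) (k : nat) (g : 'I_k -> gT) (w : word k) :
  word_val g (word_inv w) = ((word_val g w)^-1)%g.
Proof.
rewrite /word_val /word_inv; elim: w => [|[i b] w IH] /=.
  by rewrite !big_nil invg1.
rewrite rev_cons -cats1 big_cat /= big_seq1 IH big_cons invgM; congr (_ * _)%g.
by case: b; rewrite /letter_val //= invgK.
Qed.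

Definition generates (gT : groupType) (k : nat) (g : 'I_k -> gT) : Prop :=
  forall x : gT, exists w : word k, word_val g w = x.

Definition word_graph (gT : groupType) (k : nat) (g : 'I_k -> gT) (n m : nat)
    (en : 'I_m -> 'I_n * 'I_n) (lab : 'I_m -> word k) : lgraph gT :=
  @LGraph gT 'I_n 'I_m en (fun e => word_val g (lab e)).

Definition total_length (k m : nat) (lab : 'I_m -> word k) : nat :=
  \sum_(e < m) size (lab e).

Definition difference (k n : nat) (alpha : 'I_n -> word k) : nat :=
  \max_(v < n) size (alpha v).

Definition adjacency_list (n m : nat) (en : 'I_m -> 'I_n * 'I_n)
    (adj : 'I_n -> seq (arc_of 'I_m)) : Prop :=
  forall v, perm_eq (adj v) [seq x <- enum {: arc_of 'I_m} | arc_tail en x == v].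

(* The i-th generator is coded by i + 1 and its inverse by -(i + 1). *)
Definition letter_code (k : nat) (x : 'I_k * bool) : int :=
  if x.2 then (- Posz x.1.+1)%R else Posz x.1.+1.

Definition word_code (k : nat) (w : word k) : seq int :=
  [seq letter_code x | x <- w].

Definition sized_word_code (k : nat) (w : word k) : seq int :=
  Posz (size w) :: word_code w.

Definition arc_code (m : nat) (x : arc_of 'I_m) : seq int :=
  [:: Posz x.1; Posz x.2].

Definition input_code (k n m : nat) (en : 'I_m -> 'I_n * 'I_n)
    (lab : 'I_m -> word k) (adj : 'I_n -> seq (arc_of 'I_m)) (a b : 'I_n) :
    seq int :=
  [:: Posz n; Posz m; Posz a; Posz b] ++
  flatten [seq Posz (size (adj v)) ::
     flatten [seq arc_code x ++ Posz (arc_head en x) ::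
                  sized_word_code (if x.2 then word_inv (lab x.1) else lab x.1)
             | x <- adj v]
  | v <- enum 'I_n].

Definition certificate_code (k n m : nat) (C : seq (arc_of 'I_m))
    (alpha : 'I_n -> word k) : seq int :=
  flatten [seq arc_code x | x <- C] ++
  flatten [seq sized_word_code (alpha v) | v <- enum 'I_n].

(* Random access machine with integer cells, addition and subtraction (no
   multiplication) at unit cost, structured control flow, a write-only output
   stream and an oracle instruction.  A program mentions finitely many
   registers, named by natural numbers; the tests are for positivity. *)
Inductive prog :=
| Const of nat & int               (* x := c *)
| Add of nat & nat & nat           (* x := y + z *)
| Sub of nat & nat & nat           (* x := y - z *)
| Read of nat & nat                (* x := mem[y] *)
| Write of nat & nat               (* mem[x] := y *)
| Print of nat
| Query of nat & nat & nat         (* x := oracle (mem[y], ..., mem[y+z-1]) *)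
| Seq of prog & prog
| If of nat & prog & prog
| While of nat & prog.

Record state := State { reg : nat -> int; mem : int -> int; out : seq int }.

Definition upd (A : eqType) (B : Type) (f : A -> B) (x : A) (v : B) : A -> B :=
  fun y => if y == x then v else f y.

Definition set_reg (s : state) (x : nat) (v : int) : state :=
  State (upd (reg s) x v) (mem s) (out s).

Definition init_state (input : seq int) : state :=
  State (fun=> 0%R)
    (fun i => match i with Posz j => nth 0%R input j | Negz _ => 0%R end) [::].

(* [exec orc phi P s t s']: started in s, P halts in s' after time t.  The
   oracle answers r on the query q when [orc q r], in time [phi (size q)]; the
   machine is stuck if there is no such answer. *)
Inductive exec (orc : seq int -> bool -> Prop) (phi : nat -> nat) :
    prog -> state -> nat -> state -> Prop :=
| exec_const s x c : exec orc phi (Const x c) s 1 (set_reg s x c)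
| exec_add s x y z :
    exec orc phi (Add x y z) s 1 (set_reg s x (reg s y + reg s z)%R)
| exec_sub s x y z :
    exec orc phi (Sub x y z) s 1 (set_reg s x (reg s y - reg s z)%R)
| exec_read s x y :
    exec orc phi (Read x y) s 1 (set_reg s x (mem s (reg s y)))
| exec_write s x y :
    exec orc phi (Write x y) s 1
      (State (reg s) (upd (mem s) (reg s x) (reg s y)) (out s))
| exec_print s x :
    exec orc phi (Print x) s 1 (State (reg s) (mem s) (rcons (out s) (reg s x)))
| exec_query s x y z n r :
    reg s z = Posz n ->
    orc [seq mem s (reg s y + Posz j)%R | j <- iota 0 n] r ->
    exec orc phi (Query x y z) s (phi n).+1 (set_reg s x (Posz r))
| exec_seq P Q s1 s2 s3 t u :
    exec orc phi P s1 t s2 -> exec orc phi Q s2 u s3 ->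
    exec orc phi (Seq P Q) s1 (t + u) s3
| exec_if_true x P Q s t s' :
    (0 < reg s x)%R -> exec orc phi P s t s' -> exec orc phi (If x P Q) s t.+1 s'
| exec_if_false x P Q s t s' :
    (reg s x <= 0)%R -> exec orc phi Q s t s' -> exec orc phi (If x P Q) s t.+1 s'
| exec_while_true x P s1 s2 s3 t u :
    (0 < reg s1 x)%R -> exec orc phi P s1 t s2 ->
    exec orc phi (While x P) s2 u s3 ->
    exec orc phi (While x P) s1 (t + u).+1 s3
| exec_while_false x P s :
    (reg s x <= 0)%R -> exec orc phi (While x P) s 1 s.

Definition word_oracle (gT : groupType) (k : nat) (g : 'I_k -> gT)
    (q : seq int) (r : bool) : Prop :=
  exists2 w : word k, q = word_code w & r = (word_val g w == 1%g).

(* Main.v *)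
Require Import Defs.
From HB Require Import structures.
From Stdlib Require Import FunctionalExtensionality.
From mathcomp Require Import all_boot all_order all_algebra zify.

Set Implicit Arguments.
Unset Strict Implicit.
Unset Printing Implicit Defensive.

(* Fix an Eulerian trail C and let L p be the label of its initial segment of
   length p.  Any other Eulerian trail with the same ends arises from C by
   reversing closed segments.  If two positions p < q show the same vertex, then
   reversing the segment between them preserves the label only if L q / L p is an
   involution; reversing along a path of interlacing segments shows that the
   involutions of interlacing vertices commute.  Hence all Eulerian trails have
   the same label iff, for each block of the finest noncrossing partition of the
   positions in which every vertex lies in one block, the quotients L q / L p
   over pairs of positions of one vertex in this block are commuting involutions.
   A core is contained in one block, and after shifting by alpha_v := L (first
   visit of v) the labels of its graph H lie in the group of that block.

   The blocks are found by one scan with a stack.  The group of a block is tested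
   through a union-find structure on the l + 1 prefixes of the word of C: a new
   quotient merges the classes of two prefixes s and t after l + 1 queries, which
   check that (Lam (cls t) / Lam (cls s)) (Lam j / Lam (cls j)) is an involution
   for all j.  Each query has length at most 8 l, and O(l m) queries suffice. *)

(** * Sets of commuting involutions *)

(** What shapes the test is the length of the words. Elements of a group generated by many quotients
    have no short words in general, and comparing all pairs of quotients would take about m^2
    queries. Representatives chosen among the prefixes of the single word of C cure both: a
    generator is always a quotient of two prefixes, hence has at most 2 l letters, and a block has
    at most l + 1 of them. A union of two classes brings in one new element, which is compared with
    l + 1 generators; the square of a product of two such quotients has at most 8 l letters.

    The commutation argument cannot stay with one trail: chords that interlace only through others
    are compared after a reversal, which changes labels and interlacement alike. It is therefore
    carried out for a family of position sequences closed under reversals. In the other direction a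
    reversal preserves noncrossing partitions, and it acts on the quotients of a block by
    conjugation or by factors from the same group, so commuting involutions are an invariant of all
    trails. *)

Section ElementaryAbelian.
Variable gT : groupType.
Local Open Scope group_scope.
Implicit Types (x y z : gT) (S : gT -> Prop).

Definition elementary S :=
  forall x y, S x -> S y -> x * x = 1 /\ commute x y.

Lemma involution_inv x : x * x = 1 -> x^-1 = x.
Proof. exact: mulg1_eq. Qed.

Lemma commute_involutions x y :
  x * x = 1 -> y * y = 1 -> (x * y) * (x * y) = 1 -> commute x y.
Proof.
move=> x2 y2 /mulg1_eq; rewrite invgM (involution_inv x2) (involution_inv y2).
by rewrite /commute => ->.
Qed.

Lemma mulg_involutions x y :
  x * x = 1 -> y * y = 1 -> commute x y -> (x * y) * (x * y) = 1.
Proof.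
by move=> x2 y2 cxy; rewrite {1}cxy mulgA -(mulgA y) x2 mulg1 y2.
Qed.

(** Commutation with a fixed element is closed under products and inverses, so it extends to the
    generated set one argument at a time; squares are then trivial because commuting factors can be
    separated. *)
Lemma elementary_generated S : elementary S -> elementary (generated S).
Proof.
move=> eS; have c1 x y : S x -> generated S y -> commute x y.
  move=> Sx; elim=> [|{}y Sy|{}y z _ + _|{}y _]; first exact: commute1.
  - by case: (eS _ _ Sx Sy).
  - exact: commuteM.
  - exact: commuteV.
have c2 x y : generated S x -> generated S y -> commute x y.
  move=> Sx Sy; apply: commute_sym; elim: Sx => [|{}x Sx|{}x z _ + _|{}x _].
  - exact: commute1.
  - exact/commute_sym/c1.
  - exact: commuteM.
  - exact: commuteV.
move=> x y Sx Sy; split; last exact: c2.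
elim: Sx => [|{}x Sx|{}x z Sx x2 Sz z2|{}x _ x2]; first by rewrite mulg1.
- by case: (eS _ _ Sx Sx).
- by apply: mulg_involutions => //; apply: c2.
- by rewrite -invgM x2 invg1.
Qed.

Lemma sub_elementary S S' :
  (forall x, S' x -> S x) -> elementary S -> elementary S'.
Proof. by move=> sSS' eS x y S'x S'y; apply: eS; apply: sSS'. Qed.

Lemma generated_mono S S' x :
  (forall y, S y -> generated S' y) -> generated S x -> generated S' x.
Proof.
move=> sSS'; elim=> [|y /sSS'//|y z _ + _|y _].
- exact: generated_one.
- exact: generated_mul.
- exact: generated_inv.
Qed.

Lemma Z2_cases (c : 'Z_2) : c = 0%R \/ c = 1%R.
Proof. by case: c => [[|[|//]]] i; [left|right]; apply: val_inj. Qed.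

(** Induction on the generators: a new [x] either lies in the group spanned so far or adds one
    coordinate in [Z_2]. *)
Lemma elementary_isomorphic_Z2_pow (s : seq gT) :
  elementary (fun x => x \in s) ->
  exists r, isomorphic_Z2_pow (generated (fun x => x \in s)) r.
Proof.
elim: s => [|x s IH] es.
  exists 0; exists (fun=> 1); split=> [u w _||z].
  - by rewrite [u]thinmx0 [w]thinmx0.
  - by move=> _ _; rewrite mulg1.
  - split; last by case=> _ ->; exact: generated_one.
    by elim=> [|//|y w _ [_ ->] _ [_ ->]|y _ [_ ->]]; exists 0%R;
       rewrite ?mulg1 ?invg1.
have es' : elementary (fun y => y \in s).
  by apply: sub_elementary es => y ys; rewrite inE ys orbT.
have {IH} [r [f [f_inj fD fP]]] := IH es'.
have es1 := elementary_generated es.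
have x_in : generated (fun y => y \in x :: s) x.
  by apply: generated_mem; rewrite mem_head.
have x2 : x * x = 1 by case: (es1 _ _ x_in x_in).
have gs y : generated (fun y => y \in s) y -> generated (fun y => y \in x :: s) y.
  by apply: generated_mono => z zs; apply: generated_mem; rewrite inE zs orbT.
have cfx u : commute (f u) x.
  have fu : generated (fun y => y \in x :: s) (f u) by apply/gs/fP; exists u.
  by case: (es1 _ _ fu x_in).
have f0 : f 0%R = 1.
  by apply: (@mulgI _ (f 0%R)); rewrite -fD GRing.addr0 mulg1.
(* The domain of [f] is finite, so membership of [x] in its image is decided by enumeration. *)
have [/existsP[u /eqP fu]|/existsPn xNf] := boolP [exists u, f u == x].
  exists r, f; split=> // z; rewrite -fP; split=> [|/gs //].
  apply: generated_mono => y; rewrite inE => /orP[/eqP->|ys].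
    by apply/fP; exists u.
  exact: generated_mem.
pose X (c : 'Z_2) := if c == 0%R then 1 else x.
have XD c d : X (c + d)%R = X c * X d.
  by case: (Z2_cases c) => ->; case: (Z2_cases d) => ->;
     rewrite /X /= ?mulg1 ?mul1g.
have cfX u c : commute (f u) (X c).
  by rewrite /X; case: ifP => _; [exact: commute1 | exact: cfx].
pose F (u : 'rV_(1 + r)) := f (rsubmx u) * X (lsubmx u 0%R 0%R).
have FD u w : F (u + w)%R = F u * F w.
  rewrite /F !GRing.raddfD /= mxE XD fD -!mulgA; congr (_ * _).
  by rewrite !mulgA; congr (_ * _); rewrite cfX.
exists (1 + r)%N, F; split=> //.
- move=> u w; rewrite /F; set cu := lsubmx u _ _; set cw := lsubmx w _ _ => E.
  have ff (q : 'rV_r) : f q * f q = 1.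
    by rewrite -fD -f0; congr f; apply/rowP => i; rewrite !mxE;
       case: (Z2_cases (q 0%R i)) => ->; apply: val_inj.
  (* If the coordinates at [x] differed, [x] would be a product of two values of [f], hence a value
     of [f] itself. *)
  have cE : cu = cw.
    case: (Z2_cases cu) (Z2_cases cw) E => -> [] -> //; rewrite /X /= mulg1 => E.
      case/eqP: (xNf (rsubmx w + rsubmx u)%R).
      by rewrite fD E mulgA ff mul1g.
    case/eqP: (xNf (rsubmx u + rsubmx w)%R).
    by rewrite fD -E mulgA ff mul1g.
  rewrite -[u]hsubmxK -[w]hsubmxK; congr row_mx.
    by apply/rowP => i; rewrite (ord1 i).
  by apply: f_inj; move: E; rewrite cE; apply: mulIg.
- move=> z; split=> [|[u ->]].
    elim=> [|y||y].
    + by exists 0%R; rewrite /F !GRing.raddf0 mxE f0 /X /= mulg1.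
    + rewrite inE => /orP[/eqP->|ys].
        exists (row_mx 1%:M 0%R).
        by rewrite /F row_mxKr row_mxKl mxE f0 mul1g /X.
      have /fP[u ->] : generated (fun y => y \in s) y by apply: generated_mem.
      by exists (row_mx 0%R u); rewrite /F row_mxKr row_mxKl mxE /X mulg1.
    + by move=> y w _ [u ->] _ [u' ->]; exists (u + u')%R; rewrite FD.
    + move=> yg [u uE]; exists u; rewrite -uE; apply: involution_inv.
      by case: (es1 _ _ yg yg).
  apply: generated_mul; first by apply/gs/fP; exists (rsubmx u).
  by rewrite /X; case: ifP => _; [exact: generated_one |].
Qed.

End ElementaryAbelian.

(** * Reversals of a word with labelled positions *)

Section Chords.
Variables (V : eqType) (gT : groupType) (M : nat).
Local Open Scope group_scope.
Implicit Types (v : nat -> V) (L : nat -> gT) (c d : nat * nat).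

(* For pairs with four distinct entries, [cross c d] says that c and d
   interlace; as a sum mod 2 it is bilinear in c and d. *)
Definition cross c d : bool :=
  (c.1 < d.1) (+) (c.1 < d.2) (+) (c.2 < d.1) (+) (c.2 < d.2).

Definition inside (i k p : nat) : bool := i < p < k.

Definition flip (i k p : nat) : nat := if inside i k p then i + k - p else p.

(** These are the prefix labels after reversal of the segment between [i] and [k], provided that
    [L k / L i] is an involution: inside the segment the reversal contributes the factor
    [L i / L k], behind it the square of this factor. *)
Definition flip_label L i k q : gT :=
  (if inside i k q then L k / L i else 1) * L (flip i k q).

Lemma flip_inside i k p : inside i k (flip i k p) = inside i k p.
Proof. rewrite /flip; case: ifP => // h; rewrite /inside in h *; lia. Qed.

Lemma flipK i k : involutive (flip i k).
Proof.
move=> p; rewrite {1}/flip flip_inside /flip.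
by case: (boolP (inside i k p)) => //; rewrite /inside => h; lia.
Qed.

Lemma flip_ltM i k p : i < k < M -> p < M -> flip i k p < M.
Proof. by rewrite /flip /inside; case: ifP => //; lia. Qed.

Lemma flip_lt i k p q : p != q ->
  (flip i k p < flip i k q) = (p < q) (+) (inside i k p && inside i k q).
Proof.
rewrite /flip /inside => pq.
case: (boolP (i < p < k)) => hp; case: (boolP (i < q < k)) => hq;
  rewrite /= ?addbF ?addbT; lia.
Qed.

(** Reversal changes the order of exactly those pairs of positions that both lie inside, and summing
    four comparisons mod 2 gives a product of parities. In terms of the interlacement graph this is
    local complementation at the chord [(i, k)]. *)
Lemma cross_flip i k c d : 
  c.1 != d.1 -> c.1 != d.2 -> c.2 != d.1 -> c.2 != d.2 ->
  cross (flip i k c.1, flip i k c.2) (flip i k d.1, flip i k d.2)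
  = cross c d (+) (inside i k c.1 (+) inside i k c.2) &&
                  (inside i k d.1 (+) inside i k d.2).
Proof.
move=> h1 h2 h3 h4; rewrite /cross /= !flip_lt //.
by do 4!case: (inside i k _); do 4!case: (_ < _).
Qed.

Lemma cross_inside i k p : i < k -> p != i -> p != k ->
  inside i k p = (i < p) (+) (k < p).
Proof. rewrite /inside; case: (ltngtP i p); case: (ltngtP k p) => //=; lia. Qed.

Lemma crossE i k c : i < k ->
  c.1 != i -> c.1 != k -> c.2 != i -> c.2 != k ->
  cross (i, k) c = inside i k c.1 (+) inside i k c.2.
Proof.
move=> ik h1 h2 h3 h4; rewrite !cross_inside // /cross /=.
by do 4!case: (_ < _).
Qed.

Lemma cross_sym c d : 
  c.1 != d.1 -> c.1 != d.2 -> c.2 != d.1 -> c.2 != d.2 -> cross c d = cross d c.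
Proof.
rewrite /cross; case: c d => [p q] [x y] /=.
have neg a b : a != b -> (b < a)%N = ~~ (a < b)%N by lia.
by move=> /neg-> /neg-> /neg-> /neg->; do 4!case: (_ < _).
Qed.

(** Chords add up like 1-chains mod 2: the comparisons with [r] occur twice and cancel. *)
Lemma cross_split p q r d : cross (p, q) d = cross (p, r) d (+) cross (r, q) d.
Proof. by rewrite /cross /=; do 6!case: (_ < _). Qed.

Lemma cross_splitr p q r d : cross d (p, q) = cross d (p, r) (+) cross d (r, q).
Proof. by rewrite /cross /=; do 6!case: (_ < _). Qed.

Lemma crossC p q d : cross (p, q) d = cross (q, p) d.
Proof. by rewrite /cross /=; do 4!case: (_ < _). Qed.

Lemma cross_revr p q d : cross d (p, q) = cross d (q, p).
Proof. by rewrite /cross /=; do 4!case: (_ < _). Qed.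

End Chords.

(** * Commutation of labels along paths of interlacing chords *)

Section InterlacedChords.
Variables (V : eqType) (gT : groupType) (M : nat).
Variable S : (nat -> V) -> (nat -> gT) -> Prop.
Local Open Scope group_scope.
Implicit Types (v : nat -> V) (L : nat -> gT) (c d e : nat * nat).

(** [S] will consist of the position data of all Eulerian trails when these have equal labels.
    Closure under reversals is what the induction on paths of chords relies on, since it passes from
    a trail to a reversed one. *)
Hypothesis S_flip : forall v L i k, S v L -> i < k < M -> v i = v k ->
  (L k / L i) * (L k / L i) = 1 /\ S (v \o flip i k) (flip_label L i k).

Definition chord v c := [&& c.1 < M, c.2 < M & v c.1 == v c.2].

Definition chord_label L c : gT := L c.2 / L c.1.

Definition linked v c d := (v c.1 == v d.1) || cross c d.

Definition flip_chord i k c := (flip i k c.1, flip i k c.2).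

Lemma neq_vertex v p q : v p != v q -> p != q.
Proof. by apply: contraNneq => ->. Qed.

Lemma chord_neq v c d : chord v c -> chord v d -> v c.1 != v d.1 ->
  [/\ c.1 != d.1, c.1 != d.2, c.2 != d.1 & c.2 != d.2].
Proof.
case/and3P=> _ _ /eqP c12 /and3P[_ _ /eqP d12] cd.
by split; apply: (@neq_vertex v); rewrite -?c12 -?d12.
Qed.

Lemma chord_label_swap L p q : chord_label L (p, q) = (chord_label L (q, p))^-1.
Proof. by rewrite /chord_label invgF. Qed.

Lemma chord_label_split L p q r :
  chord_label L (p, q) = chord_label L (r, q) * (chord_label L (r, p))^-1.
Proof. by rewrite /chord_label invgF divgKA. Qed.

Lemma chord_label_sq v L c : S v L -> chord v c ->
  chord_label L c * chord_label L c = 1.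
Proof.
case: c => i k SvL /and3P[/= iM kM /eqP vik].
case: (ltngtP i k) => [ik|ki|<-]; last by rewrite /chord_label /= mulgV mulg1.
  by have [||] := @S_flip v L i k SvL; rewrite ?ik.
have [||+ _] := @S_flip v L k i SvL; rewrite ?ki //.
by rewrite chord_label_swap -invgM /chord_label /= => ->; rewrite invg1.
Qed.

Lemma chord_label_flip L i k c :
  let t p := if inside i k p then chord_label L (i, k) else 1 in
  chord_label (flip_label L i k) (flip_chord i k c)
  = t c.2 * chord_label L c * (t c.1)^-1.
Proof.
by rewrite /chord_label /flip_label /flip_chord /= !flip_inside !flipK invgM !mulgA.
Qed.

Lemma chord_flip v i k c : i < k < M ->
  chord v c -> chord (v \o flip i k) (flip_chord i k c).
Proof.
by move=> ik /and3P[h1 h2 h3]; rewrite /chord /= !flipK h3 !flip_ltM.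
Qed.

(** For two chords from a common position [p], the quotient of the labels is the label of the chord
    between the other ends, hence again an involution. General chords at the vertex are quotients of
    chords from [p]. *)
Lemma same_vertex_commute v L c d : S v L -> chord v c -> chord v d ->
  v c.1 = v d.1 -> commute (chord_label L c) (chord_label L d).
Proof.
case: c d => [p q] [x y] SvL cc cd /= vE.
have/and3P[/= pM qM /eqP pq] := cc; have/and3P[/= xM yM /eqP xy] := cd.
have base a b : a < M -> b < M -> v a = v p -> v b = v p ->
    commute (chord_label L (p, a)) (chord_label L (p, b)).
  move=> aM bM ap bp; have sq z : z < M -> v z = v p ->
      chord_label L (p, z) * chord_label L (p, z) = 1.
    by move=> zM zp; apply: chord_label_sq SvL _; rewrite /chord /= pM zM zp eqxx.
  apply: commute_sym; apply: commute_involutions; try exact: sq.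
  rewrite -{1 2}(involution_inv (sq a aM ap)) -chord_label_split.
  by apply: chord_label_sq SvL _; rewrite /chord /= aM bM ap bp eqxx.
rewrite (chord_label_split L x y p); apply: commuteM; last apply: commuteV.
  by apply: base; rewrite // -?pq // -xy.
by apply: base; rewrite // -pq.
Qed.

Lemma cross_chord_oriented v L d : S v L -> chord v d -> d.1 != d.2 ->
  exists i k, [/\ i < k < M, v i = v k, v i = v d.1,
    (forall x, cross d x = cross (i, k) x) & chord_label L d = chord_label L (i, k)].
Proof.
case: d => p q SvL cd /= pq; have/and3P[/= pM qM /eqP vE] := cd.
case: (ltngtP p q) pq => // [pq|qp] _; first by exists p, q; rewrite pq.
exists q, p; rewrite qp pM -vE; split=> // [x|]; first exact: crossC.
by rewrite -[LHS](involution_inv (chord_label_sq SvL cd)) -chord_label_swap.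
Qed.

Lemma cross_loop p d : cross (p, p) d = false.
Proof. by rewrite /cross /=; do 2!case: (_ < _). Qed.

Lemma cross_neq c d : cross c d -> c.1 != c.2.
Proof. by case: c => p q /= h; apply: contraTneq h => ->; rewrite cross_loop. Qed.

(** Exactly one end of [d] lies inside [c], so reversing at [c] multiplies the label of [d] on one
    side by that of [c], and the product must again be an involution. *)
Lemma cross_commute v L c d : S v L -> chord v c -> chord v d ->
  v c.1 != v d.1 -> cross c d -> commute (chord_label L c) (chord_label L d).
Proof.
move=> SvL cc cd vN cr.
have [i [k [ik vik vi crE ->]]] := cross_chord_oriented SvL cc (cross_neq cr).
have [t2 S'] := S_flip SvL ik vik.
have/and3P[_ _ /eqP d12] := cd.
have cik : chord v (i, k) by rewrite /chord /= vik eqxx andbT; lia.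
have vid : v i != v d.1 by rewrite vi.
have [/= h1 h2 h3 h4] := chord_neq cik cd vid.
have := chord_label_sq S' (chord_flip ik cd).
rewrite crE crossE 1?eq_sym // in cr; last by case/andP: ik.
have d2 := chord_label_sq SvL cd; have c2 := chord_label_sq SvL cik.
rewrite chord_label_flip; case: (inside i k d.1) cr; case: (inside i k d.2) => //= _.
  rewrite mul1g (involution_inv t2) => h; apply: commute_sym.
  exact: commute_involutions.
by rewrite invg1 mulg1 => h; apply: commute_involutions.
Qed.

Lemma linked_flip v L i k y z : S v L -> i < k < M -> v i = v k ->
  chord v y -> chord v z -> v i != v z.1 -> ~~ cross (i, k) z ->
  linked v y z ->
  linked (v \o flip i k) (flip_chord i k y) (flip_chord i k z).
Proof.
move=> SvL ik vik cy cz vz crz; rewrite /linked /= !flipK.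
case: (boolP (v y.1 == v z.1)) => //= yz.
have [h1 h2 h3 h4] := chord_neq cy cz yz.
have cik : chord v (i, k) by rewrite /chord /= vik eqxx andbT; lia.
have [/= k1 k2 k3 k4] := chord_neq cik cz vz.
rewrite /flip_chord cross_flip //.
by move: crz; rewrite crossE 1?eq_sym //; [move/negPf->; rewrite andbF addbF | lia].
Qed.

Lemma linked_commute v L c d : S v L -> chord v c -> chord v d ->
  linked v c d -> commute (chord_label L c) (chord_label L d).
Proof.
move=> SvL cc cd; rewrite /linked; case: eqP => [vE _|/eqP vN /=].
  exact: same_vertex_commute SvL _ _ _.
exact: cross_commute SvL _ _ _.
Qed.

(* The reversal at the second chord d of a shortest path c, d, e, ... makes c
   and e interlace, which shortens the path and multiplies labels by powers of
   the label of d only. *)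
Lemma linked_path_commute v L c p : S v L ->
  all (chord v) (c :: p) -> path (linked v) c p ->
  commute (chord_label L c) (chord_label L (last c p)).
Proof.
have [n] := ubnP (size p); elim: n v L c p => // n IH v L c [|d [|e p]] /=.
- by move=> *; exact: commute_refl.
- by move=> _ SvL /and3P[cc cd _] /andP[lcd _]; exact: linked_commute SvL _ _ _.
move=> szp SvL /and4P[cc cd ce cp] /and3P[lcd lde lep].
have [/orP[lce|/hasP[x xp lcx]]|] := boolP (linked v c e || has (linked v c) p).
- by apply: (IH v L c (e :: p)) => //=; rewrite ?cc ?ce ?lce.
- case/splitPr: xp szp cp lep => p1 p2; rewrite size_cat /= all_cat cat_path last_cat /=.
  move=> szp /and3P[_ cx cp2] /and3P[_ _ lp2].
  have szp2 : (size p2).+1 < n.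
    by rewrite -ltnS; apply: leq_trans szp; rewrite !ltnS addnS leqW // leq_addl.
  by apply: (IH v L c (x :: p2)) => //=; rewrite ?cc ?cx ?lcx.
rewrite negb_or => /andP[lce /hasPn lcp].
have [/hasP[x xp ldx]|/hasPn ldp] := boolP (has (linked v d) p).
  case/splitPr: xp szp cp lep {lcp} => p1 p2; rewrite size_cat /= all_cat cat_path last_cat /=.
  move=> szp /and3P[_ cx cp2] /and3P[_ _ lp2].
  have szp2 : (size p2).+2 < n.
    by rewrite -ltnS; apply: leq_trans szp; rewrite !ltnS leq_addl.
  by apply: (IH v L c (d :: x :: p2)) => //=; rewrite ?cc ?cd ?cx ?lcd ?ldx.
(* The path from [d] is shorter. This commutation is what removes the powers of the label of [d] at
   the end. *)
have cdl : commute (chord_label L d) (chord_label L (last e p)).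
  by apply: (IH v L d (e :: p)) => //=; rewrite ?cd ?ce ?lde.
have/and3P[c1M c2M /eqP c12] := cc; have/and3P[d1M d2M /eqP d12] := cd.
have/and3P[e1M e2M /eqP e12] := ce.
move: lce; rewrite /linked negb_or => /andP[vce crce].
have [vcd|vcd] := eqVneq (v c.1) (v d.1).
  (* c and d share their vertex: a chord from an end of d to each end of c
     interlaces with e, so d can be dropped from the path. *)
  have crde : cross d e by move: lde; rewrite /linked -vcd (negPf vce).
  have [z [zM vz cz]] : exists z, [/\ z < M, v z = v c.1 & cross (z, c.1) e].
    move: crde; rewrite [d]surjective_pairing (cross_split _ _ c.1) /=.
    case: (boolP (cross (d.1, c.1) e)) => [cr _|_ /= cr]; first by exists d.1.
    by exists d.2; rewrite crossC -d12.
  have cz2 : cross (z, c.2) e.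
    rewrite (cross_split _ _ c.1) cz -[(c.1, c.2)]surjective_pairing.
    by rewrite (negPf crce).
  rewrite [c]surjective_pairing (chord_label_split L c.1 c.2 z).
  have step u : u < M -> v u = v c.1 -> cross (z, u) e ->
      commute (chord_label L (z, u)) (chord_label L (last e p)).
    move=> uM vu cu; apply: (IH v L (z, u) (e :: p)) => //=.
      by rewrite ce cp !andbT /chord /= zM uM vz vu eqxx.
    by rewrite /linked /= cu orbT.
  apply: commute_sym; apply: commuteM; last apply: commuteV.
    by apply: commute_sym; apply: step.
  by apply: commute_sym; apply: step.
have crcd : cross c d by move: lcd; rewrite /linked (negPf vcd).
(* When [d] and [e] share their vertex, chords from a suitable end [z] of [d] to both ends of [e]
   interlace with [c], because [c] crosses [d] but not [e]. One of them also crosses the chord after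
   [e], if there is one, and then replaces both [d] and [e] on the path. *)
have [vde|vde] := eqVneq (v d.1) (v e.1).
  have [z [zM vz cz]] : exists z, [/\ z < M, v z = v e.1 & cross c (z, e.1)].
    move: crcd; rewrite [d]surjective_pairing (cross_splitr _ _ e.1) /=.
    case: (boolP (cross c (d.1, e.1))) => [cr _|_ /= cr]; first by exists d.1.
    by exists d.2; rewrite cross_revr -d12.
  have cz2 : cross c (z, e.2).
    rewrite (cross_splitr _ _ e.1) cz -[(e.1, e.2)]surjective_pairing.
    by rewrite (negPf crce).
  have cze u : u < M -> v u = v e.1 -> chord v (z, u).
    by move=> uM vu; rewrite /chord /= zM uM vz vu eqxx.
  have vcz : v c.1 != v z by rewrite vz.
  case: p szp cp lep lcp ldp cdl => [|f p] /= szp.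
    move=> _ _ _ _ _; rewrite [e]surjective_pairing (chord_label_split L e.1 e.2 z).
    by apply: commuteM; last apply: commuteV; apply: (cross_commute SvL) => //;
       apply: cze.
  move=> /andP[cf cp] /andP[lef lfp] lcp ldp cdl.
  have ldf := ldp f (mem_head _ _); rewrite /linked negb_or in ldf.
  have cref : cross e f.
    by move: lef ldf; rewrite /linked -vde => /orP[->|].
  have [u [uM vu cu cuf]] : exists u, [/\ u < M, v u = v e.1, cross c (z, u)
      & cross (z, u) f].
    move: cref; rewrite [e]surjective_pairing (cross_split _ _ z) /=.
    case: (boolP (cross (z, e.2) f)) => [cr _|_]; first by exists e.2.
    by rewrite addbF crossC => cr; exists e.1.
  apply: (IH v L c ((z, u) :: f :: p)) => //=.
    by rewrite cc cze // cf.
  by rewrite /linked /= cu cuf !orbT.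
have crde : cross d e by move: lde; rewrite /linked (negPf vde).
have [i [k [ik vik vi crE tE]]] := cross_chord_oriented SvL cd (cross_neq crde).
have [t2 S'] := S_flip SvL ik vik.
have cik : chord v (i, k) by rewrite /chord /= vik eqxx andbT; clear -ik; lia.
have insE x : chord v x -> v i != v x.1 ->
    cross d x = inside i k x.1 (+) inside i k x.2.
  move=> cx vx; have [/= h1 h2 h3 h4] := chord_neq cik cx vx.
  by rewrite crE crossE 1?eq_sym //; case/andP: ik.
have vie : v i != v e.1 by rewrite vi.
have vic : v i != v c.1 by rewrite vi eq_sym.
have crdc : cross d c by have [h1 h2 h3 h4] := chord_neq cc cd vcd; rewrite -cross_sym.
(* After the reversal [c] and [e] interlace, since both cross [d]. The later chords neither cross
   [d] nor share its vertex, so their links survive. *)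
have lpath : path (linked (v \o flip i k)) (flip_chord i k c)
    (map (flip_chord i k) (e :: p)).
  rewrite /=; apply/andP; split.
    have [h1 h2 h3 h4] := chord_neq cc ce vce.
    rewrite /linked /= !flipK (negPf vce) /= /flip_chord cross_flip //.
    by rewrite -!insE // crdc crde (negPf crce).
  have np x : x \in p -> v i != v x.1 /\ ~~ cross (i, k) x.
    by move/ldp; rewrite /linked negb_or crE vi => /andP.
  case: (p) np cp lep => //= f q np /andP[cf cq] /andP[lef lfq].
  have [vif crf] := np f (mem_head _ _).
  rewrite (linked_flip SvL ik vik ce cf) //= path_map.
  apply: (sub_in_path (P := [pred x | [&& chord v x, v i != v x.1 & ~~ cross (i, k) x]])) lfq.
    by move=> x y /and3P[hx _ _] /and3P[hy vy cy]; apply: (linked_flip SvL).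
  apply/allP => x xfq; have [vx cx] := np x xfq; apply/and3P; split=> //.
  by move: xfq; rewrite inE => /predU1P[->//|]; apply: (allP cq).
have cpath : all (chord (v \o flip i k)) (flip_chord i k c :: map (flip_chord i k) (e :: p)).
  rewrite -map_cons all_map; apply/allP => x xcp /=; apply: chord_flip => //.
  by move: xcp; rewrite !inE => /or3P[/eqP->|/eqP->|/(allP cp)].
have := IH _ _ _ (map (flip_chord i k) (e :: p)) _ S' cpath lpath.
rewrite size_map => /(_ szp).
rewrite -[map _ (e :: p)]/(flip_chord i k e :: map _ p) /= last_map !chord_label_flip -tE.
set t := chord_label L d in cdl t2 tE *.
have ctc : commute t (chord_label L c).
  by apply: commute_sym; apply: linked_commute SvL _ _ _.
have ctt (b : bool) x : commute t x -> commute (if b then t else 1) x.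
  by case: b => // _; apply/commute_sym/commute1.
set t1 := if inside i k c.2 then _ else _; set t2' := if inside i k c.1 then _ else _.
set t3 := if inside i k (last e p).2 then _ else _.
set t4 := if inside i k (last e p).1 then _ else _.
have comm_tt (b b' : bool) : commute (if b then t else 1) (if b' then t else 1).
  by apply: ctt; case: b'; [exact: commute_refl | exact: commute1].
set x := chord_label L c in ctc *; set y := chord_label L (last e p) in cdl *.
have c1 : commute t1 x by apply: ctt.
have c2 : commute t2' x by apply: ctt.
have c3 : commute t3 y by apply: ctt.
have c4 : commute t4 y by apply: ctt.
have d1 : commute t1 y by apply: ctt.
have d2 : commute t2' y by apply: ctt.
have d3 : commute t3 x by apply: ctt.
have d4 : commute t4 x by apply: ctt.
(* [X] and [Y] are the labels of the reversed chords, which commute by induction. The powers of [t]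
   around [x] and [y] can be removed because [t] commutes with both. *)
set X := _ * _ * _; set Y := _ * _ * _ => cXY.
have xE : x = t1^-1 * X * t2' by rewrite /X !mulgA mulVg mul1g mulgVK.
have yE : y = t3^-1 * Y * t4 by rewrite /Y !mulgA mulVg mul1g mulgVK.
have ct3X : commute t3 X.
  apply: commuteM; first apply: commuteM => //; last exact/commuteV/comm_tt.
  exact: comm_tt.
have ct4X : commute t4 X.
  apply: commuteM; first apply: commuteM => //; last exact/commuteV/comm_tt.
  exact: comm_tt.
have cXy : commute X y.
  rewrite yE; apply: commuteM; last exact: commute_sym.
  by apply: commuteM => //; apply/commuteV/commute_sym.
rewrite xE; apply: commute_sym; apply: commuteM; last exact: commute_sym.
by apply: commuteM; [apply/commuteV/commute_sym | exact: commute_sym].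
Qed.
End InterlacedChords.

(* Smallest such relations: the blocks of the finest noncrossing partition of
   the positions 0, ..., M - 1 in which each vertex lies in one block. *)
Definition interlacement (V : eqType) (M : nat) (v : nat -> V)
    (E : nat -> nat -> Prop) : Prop :=
  [/\ forall p q, p < M -> q < M -> v p = v q -> E p q,
      forall p q, p < M -> q < M -> E p q -> E q p,
      forall p q r, p < M -> q < M -> r < M -> E p q -> E q r -> E p r
    & forall p q r u, p < q -> q < r -> r < u -> u < M ->
        v p = v r -> v q = v u -> E p q].

Section InterlacedCommute.
Variables (V : eqType) (gT : groupType) (M : nat).
Variable S : (nat -> V) -> (nat -> gT) -> Prop.
Local Open Scope group_scope.
Implicit Types (v : nat -> V) (L : nat -> gT) (c d e : nat * nat).

Hypothesis S_flip : forall v L i k, S v L -> i < k < M -> v i = v k ->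
  (L k / L i) * (L k / L i) = 1 /\ S (v \o flip i k) (flip_label L i k).

Definition chord_connected v c d : Prop :=
  exists s, [/\ all (chord M v) (c :: s), path (linked v) c s & last c s = d].

Lemma linked_sym v c d : chord M v c -> chord M v d -> linked v c d = linked v d c.
Proof.
move=> cc cd; rewrite /linked eq_sym; case: eqVneq => //= vN.
rewrite eq_sym in vN.
by have [h1 h2 h3 h4] := chord_neq cc cd vN; rewrite cross_sym.
Qed.

Lemma chord_connected_refl v c : chord M v c -> chord_connected v c c.
Proof. by move=> cc; exists [::]; rewrite /= cc. Qed.

Lemma chord_connected_link v c d : chord M v c -> chord M v d -> linked v c d ->
  chord_connected v c d.
Proof. by move=> cc cd l; exists [:: d]; rewrite /= cc cd l. Qed.

Lemma chord_connected_trans v c d e :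
  chord_connected v c d -> chord_connected v d e -> chord_connected v c e.
Proof.
case=> s [/= /andP[cc cs] ps ls] [s' [/= /andP[_ cs'] ps' ls']].
by exists (s ++ s'); rewrite /= all_cat cc cs cs' cat_path ls ps ps' last_cat ls.
Qed.

Lemma chord_connected_sym v c d :
  chord_connected v c d -> chord_connected v d c.
Proof.
case=> s []; elim: s c => [|e s IH] c /=.
  by move=> /andP[cc _] _ <-; apply: chord_connected_refl.
case/and3P=> cc ce cs /andP[lce ps] ls.
apply: chord_connected_trans (chord_connected_link ce cc _); last by rewrite linked_sym.
by apply: IH; rewrite //= ce.
Qed.

(** A position [p] is represented by the degenerate chord [(p, p)]. Connectedness of such chords by
    links is a relation as in [interlacement], so positions with equal [kap] are joined by a path of
    linked chords. *)
Lemma interlacement_commute v L (kap : nat -> nat) : S v L ->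
  (forall E, interlacement M v E ->
     forall p q, p < M -> q < M -> kap p = kap q -> E p q) ->
  forall c d, chord M v c -> chord M v d -> kap c.1 = kap d.1 ->
  commute (chord_label L c) (chord_label L d).
Proof.
move=> SvL kapE c d cc cd kcd.
have loop p : p < M -> chord M v (p, p) by move=> pM; rewrite /chord /= pM eqxx.
have conn := kapE (fun p q => chord_connected v (p, p) (q, q)).
have/and3P[c1 _ _] := cc; have/and3P[d1 _ _] := cd.
suff [s [cs ps ls]] : chord_connected v c d.
  by rewrite -ls; exact: (linked_path_commute S_flip SvL cs ps).
apply: (chord_connected_trans (d := (c.1, c.1))).
  by apply: chord_connected_link; rewrite ?loop /linked ?eqxx.
apply: (chord_connected_trans (d := (d.1, d.1))); last first.
  by apply: chord_connected_link; rewrite ?loop /linked ?eqxx.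
apply: conn => //; split=> [p q pM qM vE|p q _ _|p q r _ _ _|p q r u pq qr ru uM vpr vqu].
- by apply: chord_connected_link; rewrite ?loop /linked /= ?vE ?eqxx.
- exact: chord_connected_sym.
- exact: chord_connected_trans.
- have h1 : chord M v (p, r) by rewrite /chord /= vpr eqxx; lia.
  have h2 : chord M v (q, u) by rewrite /chord /= vqu eqxx; lia.
  apply: (chord_connected_trans (d := (p, r))).
    by apply: chord_connected_link; rewrite ?loop /linked ?eqxx //; lia.
  apply: (chord_connected_trans (d := (q, u))).
    by apply: chord_connected_link; rewrite // /linked /cross /=; lia.
  by apply: chord_connected_link; rewrite ?loop /linked ?eqxx //; lia.
Qed.

End InterlacedCommute.

(** * Noncrossing partitions and their groups under reversal *)

Section NoncrossingClasses.
Variables (V : eqType) (gT : groupType) (M : nat) (kap : V -> nat).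
Local Open Scope group_scope.
Implicit Types (v : nat -> V) (L : nat -> gT).

Definition noncrossing v := forall p q x y, p < M -> q < M -> x < M -> y < M ->
  kap (v p) = kap (v q) -> kap (v x) = kap (v y) -> kap (v p) <> kap (v x) ->
  ~~ cross (p, q) (x, y).

Definition class_label v L (r : nat) (z : gT) : Prop :=
  exists p q, [/\ p < M, q < M, v p = v q, kap (v p) = r & z = L q / L p].

Lemma noncrossing_inside v i k x y : noncrossing v -> i < k < M -> v i = v k ->
  x < M -> y < M -> kap (v x) = kap (v y) -> kap (v i) <> kap (v x) ->
  inside i k x = inside i k y.
Proof.
move=> nc ik vik xM yM kxy kix.
have iM : i < M by lia. have kM : k < M by lia.
have/negbTE := nc i k x y iM kM xM yM (congr1 kap vik) kxy kix.
have neq u w : kap (v u) <> kap (v w) -> w != u by move=> h; apply/eqP=> E; rewrite E in h.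
have kk : kap (v k) <> kap (v x) by rewrite -vik.
rewrite crossE /=; [|lia|exact: neq|exact: neq|by apply: neq; rewrite -kxy
  |by apply: neq; rewrite -kxy].
by case: (inside i k x); case: (inside i k y).
Qed.

(** By [cross_flip] crossing changes by a product of two parities. A chord within a block other than
    that of [(i, k)] has parity zero, and of two different blocks at least one is of this kind. *)
Lemma noncrossing_flip v i k : noncrossing v -> i < k < M -> v i = v k ->
  noncrossing (v \o flip i k).
Proof.
move=> nc ik vik p q x y pM qM xM yM /= kpq kxy kpx.
have fM z : z < M -> flip i k z < M by apply: flip_ltM.
have neq u w : kap (v (flip i k u)) <> kap (v (flip i k w)) -> 
    flip i k u != flip i k w by move=> h; apply/eqP=> E; rewrite E in h.
have := @cross_flip i k (flip i k p, flip i k q) (flip i k x, flip i k y).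
rewrite /= !flipK => ->; try by apply: neq; congruence.
rewrite (negPf (nc _ _ _ _ (fM _ pM) (fM _ qM) (fM _ xM) (fM _ yM) kpq kxy kpx)) /=.
have [E|E] := eqVneq (kap (v i)) (kap (v (flip i k x))).
  have <- := noncrossing_inside nc ik vik (fM _ pM) (fM _ qM) kpq; first by rewrite addbb.
  by rewrite E => h; apply: kpx.
rewrite (noncrossing_inside nc ik vik (fM _ xM) (fM _ yM) kxy (elimN eqP E)).
by rewrite addbb andbF.
Qed.

(** In the block of [(i, k)] the new quotients are old ones multiplied by [t] or 1, which belong to
    the same group. Any other block lies entirely inside or entirely outside the chord, so its
    quotients are all conjugated by one element. *)
Lemma class_label_flip v L i k : noncrossing v -> i < k < M -> v i = v k ->
  (forall r, elementary (class_label v L r)) ->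
  forall r, elementary (class_label (v \o flip i k) (flip_label L i k) r).
Proof.
move=> nc ik vik eL r.
have fM z : z < M -> flip i k z < M by apply: flip_ltM.
set t := L k / L i; have iM : i < M by lia. have kM : k < M by lia.
have [rE|rN] := eqVneq (kap (v i)) r.
  apply: sub_elementary (elementary_generated (eL r)) => _ [p [q [pM qM /= vpq vr ->]]].
  have tin (b : bool) : generated (class_label v L r) (if b then t else 1).
    by case: b; [apply: generated_mem; exists i, k | exact: generated_one].
  rewrite /flip_label invgM mulgA -/t; apply: generated_mul; last exact/generated_inv/tin.
  rewrite -mulgA; apply: generated_mul; first exact: tin.
  by apply: generated_mem; exists (flip i k p), (flip i k q); split=> //; apply: fM.
have same x y : x < M -> y < M -> kap (v (flip i k x)) = r -> 
    kap (v (flip i k y)) = r -> inside i k x = inside i k y.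
  move=> xM yM kx ky; rewrite -(flip_inside i k x) -(flip_inside i k y).
  apply: (noncrossing_inside nc ik vik (fM _ xM) (fM _ yM)); first by rewrite kx.
  by rewrite kx; apply/eqP.
move=> _ _ [p [q [pM qM /= vpq vr ->]]] [x [y [xM yM /= vxy wr ->]]].
have kq : kap (v (flip i k q)) = r by rewrite -vpq.
have ky : kap (v (flip i k y)) = r by rewrite -vxy.
have [sq cm] := eL r (L (flip i k q) / L (flip i k p)) (L (flip i k y) / L (flip i k x))
  (ex_intro _ _ (ex_intro _ _ (And5 (fM _ pM) (fM _ qM) vpq vr erefl)))
  (ex_intro _ _ (ex_intro _ _ (And5 (fM _ xM) (fM _ yM) vxy wr erefl))).
rewrite /flip_label (same q p) // (same x p) // (same y p) //.
set u := if inside i k p then _ else _.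
move: sq cm; set X := L (flip i k q); set X' := L (flip i k p).
set Y := L (flip i k y); set Y' := L (flip i k x).
have E (a b : gT) : (u * a) / (u * b) = (a / b) ^ u^-1.
  by rewrite invgM conjgE invgK !mulgA.
rewrite !E /commute -!conjMg => -> ->; split=> //.
exact: conj1g.
Qed.

End NoncrossingClasses.

(** * Eulerian trails and reversals of closed segments *)

Section Trails.
Variables (gT : groupType) (G : lgraph gT).
Local Open Scope group_scope.
Implicit Types (u v w : vert G) (A B C D T : seq (garc G)) (x y : garc G).

Definition walk_end u C := last u (map (@ahead _ G) C).

Definition rev_walk C : seq (garc G) := rev (map (@arc_rev _) C).

Lemma arc_revK x : arc_rev (arc_rev x) = x.
Proof. by case: x => e []. Qed.

Lemma atail_rev x : atail (arc_rev x) = ahead x.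
Proof. by case: x => e []. Qed.

Lemma ahead_rev x : ahead (arc_rev x) = atail x.
Proof. by case: x => e []. Qed.

Lemma arc_edge_eq x y : x.1 = y.1 -> x = y \/ x = arc_rev y.
Proof.
case: x y => [e b] [f c] /= ->; rewrite /arc_rev /=.
by case: b c => [] []; auto.
Qed.

Lemma rev_walk_cat C D : rev_walk (C ++ D) = rev_walk D ++ rev_walk C.
Proof. by rewrite /rev_walk map_cat rev_cat. Qed.

Lemma rev_walkK : involutive rev_walk.
Proof.
by move=> C; rewrite /rev_walk map_rev revK -map_comp map_id_in // => x _; apply: arc_revK.
Qed.

Lemma size_rev_walk C : size (rev_walk C) = size C.
Proof. by rewrite /rev_walk size_rev size_map. Qed.

Lemma edges_rev_walk C : [seq x.1 | x <- rev_walk C] = rev [seq x.1 | x <- C].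
Proof. by rewrite /rev_walk map_rev -map_comp. Qed.

Lemma walk_end_cat u C D : walk_end u (C ++ D) = walk_end (walk_end u C) D.
Proof. by rewrite /walk_end map_cat last_cat. Qed.

Lemma walk_endE u C v : walk u C v -> walk_end u C = v.
Proof.
by elim: C u => [|x C IH] u /= => [/eqP|/andP[_ /IH]].
Qed.

Lemma walk_cat u C D v :
  walk u (C ++ D) v = walk u C (walk_end u C) && walk (walk_end u C) D v.
Proof.
elim: C u => [|x C IH] u /=; first by rewrite /walk_end /= eqxx.
by rewrite IH andbA.
Qed.

Lemma walk_rcons u C x v : 
  walk u (rcons C x) v = [&& walk u C (atail x) & ahead x == v].
Proof.
elim: C u => [|y C IH] u /=; first by rewrite eq_sym.
by rewrite IH andbA.
Qed.

Lemma walk_rev u C v : walk u C v -> walk v (rev_walk C) u.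
Proof.
elim: C u => [|x C IH] u /=; first by rewrite eq_sym.
case/andP=> /eqP<- /IH; rewrite /rev_walk /= rev_cons walk_rcons.
by rewrite atail_rev ahead_rev eqxx andbT.
Qed.

Lemma tlab_cat C D : tlab (C ++ D) = tlab C * tlab D.
Proof. by rewrite /tlab big_cat. Qed.

Lemma tlab_rev C : tlab (rev_walk C) = (tlab C)^-1.
Proof.
elim: C => [|x C IH]; first by rewrite /tlab /rev_walk /= !big_nil invg1.
by rewrite -cat1s rev_walk_cat !tlab_cat invgM IH /tlab /= !big_seq1 alab_rev.
Qed.

Variables a b : vert G.

Lemma eulerian_perm C C' : perm_eq [seq x.1 | x <- C] [seq x.1 | x <- C'] ->
  walk a C' b -> eulerian_trail a C b -> eulerian_trail a C' b.
Proof.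
move=> pCC' wC' /andP[/andP[_ uC] /forallP eC].
rewrite /eulerian_trail /trail wC' -(perm_uniq pCC') uC /=.
by apply/forallP => e; rewrite -(perm_mem pCC').
Qed.

Lemma eulerian_rev A T B :
  eulerian_trail a (A ++ T ++ B) b -> walk (walk_end a A) T (walk_end a A) ->
  eulerian_trail a (A ++ rev_walk T ++ B) b.
Proof.
move=> eC wT; apply: eulerian_perm (eC).
  by rewrite !map_cat edges_rev_walk perm_cat2l perm_cat2r perm_sym perm_rev.
case/andP: eC => /andP[+ _] _; rewrite !walk_cat => /and3P[-> _].
by rewrite (walk_endE wT) (walk_endE (walk_rev wT)) (walk_rev wT).
Qed.

Lemma size_eulerian C : eulerian_trail a C b -> size C = #|edge G|.
Proof.
case/andP=> /andP[_ uC] /forallP eC; rewrite -(size_map fst) -(card_uniqP uC).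
by apply: eq_card => e; rewrite eC.
Qed.

Definition pvert C i := nth a (a :: map (@ahead _ G) C) i.
Definition plab C i := tlab (take i C).

Lemma pvertE C i : i <= size C -> pvert C i = walk_end a (take i C).
Proof.
move=> iC; rewrite /pvert /walk_end map_take.
case: i iC => [|i] iC; first by rewrite take0.
by rewrite (take_nth a) ?size_map // last_rcons.
Qed.

Lemma walk_segment C v i k : walk a C v -> i <= k <= size C ->
  walk (pvert C i) (drop i (take k C)) (pvert C k).
Proof.
move=> wC /andP[ik kC]; rewrite !pvertE ?(leq_trans ik) //.
have := wC; rewrite -{1}(cat_take_drop k C) walk_cat => /andP[+ _].
rewrite -{1}(cat_take_drop i (take k C)) walk_cat => /andP[_].
by rewrite take_takel.
Qed.

Lemma tlab_segment C i k : i <= k -> tlab (drop i (take k C)) = (plab C i)^-1 * plab C k.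
Proof.
move=> ik; rewrite /plab -{2}(cat_take_drop i (take k C)) tlab_cat take_takel //.
by rewrite mulKg.
Qed.

Definition rev_segment i k C :=
  take i C ++ rev_walk (drop i (take k C)) ++ drop k C.

Lemma segmentE C i k : i <= k -> C = take i C ++ drop i (take k C) ++ drop k C.
Proof.
by move=> ik; rewrite catA -{1}(take_takel C ik) cat_take_drop cat_take_drop.
Qed.

Lemma eulerian_rev_segment C i k : eulerian_trail a C b -> i <= k <= size C ->
  pvert C i = pvert C k -> eulerian_trail a (rev_segment i k C) b.
Proof.
move=> eC ikC vik; case/andP: (ikC) => ik kC.
apply: eulerian_rev; first by rewrite -segmentE.
rewrite -pvertE ?(leq_trans ik) // {2}vik.
by case/andP: eC => /andP[wC _] _; apply: walk_segment wC ikC.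
Qed.

Lemma tlab_rev_segment C i k : i <= k -> 
  tlab (rev_segment i k C) = plab C i * ((plab C k)^-1 * plab C i) * ((plab C k)^-1 * tlab C).
Proof.
move=> ik; have -> : tlab C = plab C k * tlab (drop k C).
  by rewrite -tlab_cat cat_take_drop.
rewrite mulKg /rev_segment !tlab_cat tlab_rev tlab_segment // invgM invgK.
by rewrite -/(plab C i) !mulgA.
Qed.

Lemma take_rev_walk T j : j <= size T ->
  take j (rev_walk T) = rev_walk (drop (size T - j) T).
Proof. by move=> jT; rewrite /rev_walk map_drop take_rev size_map. Qed.

Lemma size_segment C i k : i <= k <= size C -> size (drop i (take k C)) = k - i.
Proof. by case/andP=> ik kC; rewrite size_drop size_takel. Qed.

Lemma take_rev_segment C i k q : i <= k <= size C -> 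
  take q (rev_segment i k C) =
  if q <= i then take q C else
  if q < k then take i C ++ rev_walk (drop (i + k - q) (take k C))
  else take i C ++ rev_walk (drop i (take k C)) ++ drop k (take q C).
Proof.
move=> ikC; have/andP[ik kC] := ikC; have iC := leq_trans ik kC.
rewrite /rev_segment take_cat size_takel //.
case: (ltngtP q i) => qi; rewrite ?take_takel ?(ltnW qi) //; last first.
  by rewrite qi subnn take0 cats0.
rewrite take_cat size_rev_walk size_segment // ltn_sub2rE ?(ltnW qi) //.
case: ltnP => qk; last first.
  congr (_ ++ _); congr (_ ++ _).
  by rewrite subnBA ?subnK ?(ltnW qi) // take_drop subnK.
rewrite take_rev_walk size_segment // ?drop_drop; last by rewrite leq_sub2r // ltnW.
congr (_ ++ rev_walk (drop _ _)).
by clear -qi qk; lia.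
Qed.

Section Position.
Variables (C : seq (garc G)) (i k : nat).
Hypotheses (eC : eulerian_trail a C b) (ikC : i < k <= size C).
Hypothesis vik : pvert C i = pvert C k.

Let iksC : i <= k <= size C. Proof. by clear -ikC; lia. Qed.
Let wC : walk a C b. Proof. by case/andP: eC => /andP[]. Qed.

Lemma size_rev_segment : size (rev_segment i k C) = size C.
Proof.
rewrite (size_eulerian eC).
by apply: size_eulerian; apply: eulerian_rev_segment.
Qed.

Lemma pvert_rev_segment q : q <= size C ->
  pvert (rev_segment i k C) q = pvert C (flip i k q).
Proof.
move=> qC; rewrite pvertE ?size_rev_segment // take_rev_segment //.
rewrite /flip /inside ltnNge; case: (leqP q i) => qi /=; first by rewrite pvertE.
have iC : i <= size C by clear -ikC; lia.
case: (ltnP q k) => qk.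
  have jk : i + k - q <= k <= size C by clear -ikC qi; lia.
  rewrite walk_end_cat -pvertE // vik.
  exact: walk_endE (walk_rev (walk_segment wC jk)).
rewrite !walk_end_cat -pvertE // {1}vik.
rewrite (walk_endE (walk_rev (walk_segment wC iksC))) vik.
by apply: (walk_endE (v := pvert C q)); apply: walk_segment wC _; rewrite qk.
Qed.

Lemma plab_rev_segment q : q <= size C ->
  (plab C k / plab C i) * (plab C k / plab C i) = 1 ->
  plab (rev_segment i k C) q = flip_label (plab C) i k q.
Proof.
move=> qC t2; rewrite /plab take_rev_segment // /flip_label /flip /inside ltnNge.
case: (leqP q i) => qi /=; first by rewrite mul1g.
have ik : i <= k by clear -ikC; lia.
have tV : plab C i / plab C k = plab C k / plab C i by rewrite -[RHS](involution_inv t2) invgF.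
case: (ltnP q k) => qk.
  rewrite tlab_cat tlab_rev tlab_segment ?invgM ?invgK; last by clear -ikC qi; lia.
  by rewrite mulgA tV.
rewrite mul1g !tlab_cat tlab_rev !tlab_segment // invgM invgK !mulgA tV.
by rewrite mulgVK mulgV mul1g.
Qed.

End Position.

(** Agreement is asked only up to the last position: behind it, a composition with [flip] need not
    match the default values of [pvert] and [plab]. *)
Definition trail_positions (v : nat -> vert G) (L : nat -> gT) : Prop :=
  exists C, eulerian_trail a C b /\
    forall q, q < #|edge G|.+1 -> v q = pvert C q /\ L q = plab C q.

Lemma trail_positions_flip (v : nat -> vert G) L i k :
  trail_positions v L -> i < k < #|edge G|.+1 -> v i = v k ->
  (L k / L i) * (L k / L i) = 1 ->
  trail_positions (v \o flip i k) (flip_label L i k).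
Proof.
case=> C [eC vL] ik vik t2; have szC := size_eulerian eC.
have ikC : i < k <= size C by rewrite szC.
have iM : i < #|edge G|.+1 by clear -ik; lia.
have kM : k < #|edge G|.+1 by clear -ik; lia.
have [vi Li] := vL i iM; have [vk Lk] := vL k kM.
rewrite vi vk in vik; rewrite Li Lk in t2.
exists (rev_segment i k C); split.
  by apply: eulerian_rev_segment; rewrite // ltnW //; case/andP: ikC.
move=> q qM; have fM := flip_ltM ik qM; have [vq Lq] := vL _ fM.
have qC : q <= size C by rewrite szC.
rewrite (pvert_rev_segment eC) // (plab_rev_segment ikC) //=.
by split=> //; rewrite /flip_label Li Lk Lq.
Qed.

(** Reversing the segment multiplies the total label on the left by the square of [L i / L k]. *)
Lemma same_label_involution (v : nat -> vert G) L i k : all_eulerian_same_label a b ->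
  trail_positions v L -> i < k < #|edge G|.+1 -> v i = v k ->
  (L k / L i) * (L k / L i) = 1.
Proof.
move=> same [C [eC vL]] ik vik; have szC := size_eulerian eC.
have iM : i < #|edge G|.+1 by clear -ik; lia.
have kM : k < #|edge G|.+1 by clear -ik; lia.
have [vi Li] := vL i iM; have [vk Lk] := vL k kM.
rewrite vi vk in vik; rewrite Li Lk.
have ikC : i <= k <= size C by rewrite szC ltnW //; case/andP: ik.
have/andP[ik' _] := ikC.
have := same _ _ eC (eulerian_rev_segment eC ikC vik).
rewrite tlab_rev_segment // !mulgA => /(congr1 (fun z => z / tlab C)).
rewrite mulgV mulgK => h.
by rewrite -[RHS]invg1 h !invgM !invgK !mulgA.
Qed.

End Trails.

(** * Kotzig's theorem: Eulerian trails with the same ends differ by reversals *)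

Section Kotzig.
Variables (gT : groupType) (G : lgraph gT) (a b : vert G).
Local Open Scope group_scope.
Implicit Types (u w : vert G) (A B C D T : seq (garc G)) (x y : garc G).

Lemma walk_vertices u C w x : walk u C w -> x \in C ->
  atail x \in u :: map (@ahead _ G) C /\ ahead x \in map (@ahead _ G) C.
Proof.
elim: C u => // y C IH u /= /andP[/eqP<- wC]; rewrite inE.
case/predU1P=> [->|/(IH _ wC)[h1 h2]]; first by rewrite !inE !eqxx.
by rewrite inE in h1; rewrite !inE h2 !orbT; case/orP: h1 => ->; rewrite ?orbT.
Qed.

Lemma walk_split u w C : w \in u :: map (@ahead _ G) C ->
  exists A B, C = A ++ B /\ walk_end u A = w.
Proof.
elim: C u => [|x C IH] u.
  by rewrite inE => /eqP->; exists [::], [::].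
rewrite inE => /predU1P[->|]; first by exists [::], (x :: C).
by move/IH=> [A [B [-> <-]]]; exists (x :: A), B.
Qed.

Section Induction.
Variable P : seq (garc G) -> Prop.
Hypothesis P_rev : forall C i k, eulerian_trail a C b -> i < k <= size C ->
  pvert a C i = pvert a C k -> P C -> P (rev_segment i k C).

Lemma eulerian_reverse A T B : eulerian_trail a (A ++ T ++ B) b ->
  walk (walk_end a A) T (walk_end a A) -> P (A ++ T ++ B) ->
  eulerian_trail a (A ++ rev_walk T ++ B) b /\ P (A ++ rev_walk T ++ B).
Proof.
move=> eC wT PC; split; first exact: eulerian_rev.
case: T => [//|x T] in eC wT PC *; set T' := x :: T in eC wT PC *.
set C := A ++ T' ++ B in eC PC *.
have h1 : take (size A) C = A by rewrite take_size_cat.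
have h2 : take (size A + size T') C = A ++ T'.
  by rewrite /C catA take_size_cat ?size_cat.
have h3 : drop (size A + size T') C = B by rewrite /C catA drop_size_cat ?size_cat.
have szC : size A + size T' <= size C by rewrite /C !size_cat leq_add2l leq_addr.
have := P_rev (i := size A) (k := size A + size T') eC.
rewrite /rev_segment h1 h2 h3 drop_size_cat //.
apply=> //; first by rewrite szC /= addnS ltnS leq_addr.
rewrite !pvertE ?(leq_trans _ szC) ?leq_addr // h1 h2.
by rewrite walk_end_cat (walk_endE wT).
Qed.

(** At most two reversals behind the common prefix [Q] bring the next arc [y] of the target trail
    into place. *)
Lemma Kotzig_step Q C1 y D1 : eulerian_trail a (Q ++ C1) b ->
  eulerian_trail a (Q ++ y :: D1) b -> P (Q ++ C1) ->
  exists C2, eulerian_trail a (Q ++ y :: C2) b /\ P (Q ++ y :: C2).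
Proof.
move=> eC eD PC; case/andP: (eC) => /andP[wC uC] /forallP aC.
case/andP: (eD) => /andP[wD uD] /forallP aD.
have ty : atail y = walk_end a Q by move: wD; rewrite walk_cat /= => /and3P[_ /eqP].
have yC1 : y.1 \in [seq x.1 | x <- C1].
  have := aC y.1; rewrite map_cat mem_cat => /orP[yQ|//].
  move: uD; rewrite map_cat cat_uniq /= => /and3P[_ /norP[+ _] _].
  by rewrite /= yQ.
case/mapP: yC1 => z zC1 yz; have zy := esym yz; case/splitPr: zC1 eC PC wC uC aC => S R.
move=> eC PC wC uC aC.
case: (arc_edge_eq zy) => zE; last first.
  (* Here the edge of [y] is traversed backwards, towards the end of [Q], so the part up to and
     including [z] is closed, and reversing it puts [y] first. *)
  exists (rev_walk S ++ R); rewrite -cat_cons.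
  have <- : rev_walk (rcons S z) = y :: rev_walk S.
    by rewrite /rev_walk map_rcons rev_rcons zE arc_revK.
  have := @eulerian_reverse Q (rcons S z) R.
  rewrite !cat_rcons => h.
  have [] // := h.
  move: wC; rewrite walk_cat => /andP[_]; rewrite -cat_rcons walk_cat => /andP[+ _].
  by rewrite /walk_end map_rcons last_rcons zE ahead_rev ty.
subst z; case: S => [|s S] in eC PC wC uC aC *; first by exists R.
set S0 := s :: S in eC PC wC uC aC *.
move: (wC); rewrite walk_cat -/(walk_end a Q) => /andP[wQ].
rewrite walk_cat => /andP[wS]; rewrite [walk _ (y :: R) _]/= => /andP[/eqP tyS wR].
set v := walk_end a Q in ty wQ wS tyS *.
have endS : walk_end v S0 = v by rewrite -tyS ty.
rewrite endS in wS.
pose V1 := v :: map (@ahead _ G) S0; pose V2 := map (@ahead _ G) (y :: R).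
(* Now [y] is preceded by a closed segment [S0] at [v]. It can be moved behind [y] if it meets the
   rest of the trail in a vertex [u]. *)
have [/hasP[u uV2 uV1]|disj] := boolP (has (mem V1) V2).
  have [S1 [S2 [SE endS1]]] := @walk_split v u S0 uV1.
  case/mapP: uV2 => w wyR uE.
  have [R1 [R2 [RE endR1]]] : exists R1 R2, R = R1 ++ R2 /\ walk_end v (y :: R1) = u.
    have : u \in (ahead y) :: map (@ahead _ G) R by rewrite uE -map_cons map_f.
    by move/walk_split=> [R1 [R2 [-> <-]]]; exists R1, R2.
  have wyR1 : walk v (y :: R1) u.
    have : walk v (y :: R) b by rewrite /= ty eqxx.
    by rewrite RE -cat_cons walk_cat endR1 => /andP[].
  have [wS1 wS2] : walk v S1 u /\ walk u S2 v.
    by move: wS; rewrite SE walk_cat endS1 => /andP[].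
  (* With [S0] and [R] cut at [u], first [S2 y R1] is reversed at [u], then [S1] followed by the
     reversed [y R1] is reversed at [v]; this restores [y R1] and puts it first. *)
  have [e1 P1] : eulerian_trail a ((Q ++ S1) ++ rev_walk (S2 ++ (y :: R1)) ++ R2) b /\
      P ((Q ++ S1) ++ rev_walk (S2 ++ (y :: R1)) ++ R2).
    have E : (Q ++ S1) ++ (S2 ++ (y :: R1)) ++ R2 = Q ++ S0 ++ y :: R.
      by rewrite SE RE -!catA.
    apply: eulerian_reverse; rewrite ?E // walk_end_cat -/v endS1 walk_cat.
    by rewrite (walk_endE wS2) wS2.
  have [e2 P2] : eulerian_trail a (Q ++ rev_walk (S1 ++ rev_walk (y :: R1)) ++
      (rev_walk S2 ++ R2)) b /\ P (Q ++ rev_walk (S1 ++ rev_walk (y :: R1)) ++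
      (rev_walk S2 ++ R2)).
    have E : Q ++ (S1 ++ rev_walk (y :: R1)) ++ (rev_walk S2 ++ R2) =
      (Q ++ S1) ++ rev_walk (S2 ++ (y :: R1)) ++ R2.
      by rewrite rev_walk_cat -!catA.
    apply: eulerian_reverse; rewrite ?E // -/v walk_cat (walk_endE wS1) wS1.
    exact: walk_rev wyR1.
  by rewrite rev_walk_cat rev_walkK -!catA /= in e2 P2; eexists; split; eassumption.
(* Without a common vertex, [D1] starts outside [S0] and has only the edges of [S0] and [R] at its
   disposal, so it can never enter [S0]; yet it must use the edge of [s]. *)
have sD : s.1 \in [seq x.1 | x <- D1].
  have := aD s.1; rewrite map_cat mem_cat /= inE => /or3P[sQ|/eqP sy|//].
    move: uC; rewrite map_cat cat_uniq => /and3P[_ /hasPn/(_ s.1)].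
    by rewrite /= inE eqxx sQ => /(_ isT).
  move: uC; rewrite map_cat cat_uniq => /and3P[_ _].
  by rewrite /= map_cat mem_cat /= inE sy eqxx orbT.
suff : s.1 \notin [seq x.1 | x <- D1] by rewrite sD.
have wD1 : walk (ahead y) D1 b by move: wD; rewrite walk_cat /= => /and3P[].
have yV2 : ahead y \in V2 by rewrite inE eqxx.
have sub e : e \in [seq x.1 | x <- D1] ->
    (e \in [seq x.1 | x <- S0]) || (e \in [seq x.1 | x <- R]).
  move=> eD1; have := aC e; rewrite map_cat mem_cat => /orP[eQ|].
    move: uD; rewrite map_cat cat_uniq => /and3P[_ /hasPn/(_ e)].
    by rewrite /= inE eD1 orbT eQ => /(_ isT).
  rewrite map_cat mem_cat /= !inE => /orP[->//|/predU1P[ey|->]]; last by rewrite !orbT.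
  move: uD; rewrite map_cat cat_uniq => /and3P[_ _]; rewrite /= -ey => /andP[].
  by rewrite eD1.
elim: (D1) (ahead y) wD1 yV2 sub => //= x D IH w /andP[/eqP tx wD'] wV2 sub.
have wNV1 : w \notin V1 by apply: contra disj => wV1; apply/hasP; exists w.
have xNS : x.1 \notin [seq x.1 | x <- S0].
  apply: contra wNV1 => /mapP[t tS xt]; have [h1 h2] := walk_vertices wS tS.
  case: (arc_edge_eq xt) => xE; rewrite -tx xE // atail_rev.
  by rewrite inE h2 orbT.
have := sub x.1; rewrite inE eqxx (negPf xNS) /= => /(_ isT) /mapP[t tR xt].
have xV2 : ahead x \in V2.
  have [h1 h2] := walk_vertices wR tR.
  by case: (arc_edge_eq xt) => ->; rewrite ?ahead_rev // inE h2 orbT.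
rewrite inE negb_or (IH (ahead x)) // ?andbT; last first.
  by move=> e eD0; apply: sub; rewrite inE eD0 orbT.
by apply: contra xNS => /eqP<-; rewrite inE eqxx.
Qed.

Lemma Kotzig_ind C D : eulerian_trail a C b -> eulerian_trail a D b -> P C -> P D.
Proof.
suff gen Q D1 C1 : eulerian_trail a (Q ++ C1) b -> eulerian_trail a (Q ++ D1) b ->
    P (Q ++ C1) -> P (Q ++ D1) by apply: (gen [::]).
elim: D1 Q C1 => [|y D1 IH] Q C1 eC eD.
  have := size_eulerian eC; rewrite -(size_eulerian eD) !size_cat /= addn0.
  by case: C1 {eC} => //= x C1; rewrite addnS => /eqP; rewrite eqn_leq ltnNge leq_addr.
move=> PC; have [C2 [eC2 PC2]] := Kotzig_step eC eD PC.
by rewrite -cat_rcons; apply: (IH _ C2); rewrite cat_rcons.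
Qed.
End Induction.
End Kotzig.

Lemma noncrossing_ext (V : eqType) M (kap : V -> nat) v v' :
  (forall q, q < M -> v q = v' q) -> noncrossing M kap v -> noncrossing M kap v'.
Proof.
move=> vv' nc p q x y pM qM xM yM.
by rewrite -!vv' //; apply: nc.
Qed.

Lemma class_label_ext (V : eqType) (gT : groupType) M (kap : V -> nat)
    (v v' : nat -> V) (L L' : nat -> gT) r :
  (forall q, q < M -> v q = v' q /\ L q = L' q) ->
  elementary (class_label M kap v L r) -> elementary (class_label M kap v' L' r).
Proof.
move=> vL; apply: sub_elementary => z [p [q [pM qM]]].
have [vp Lp] := vL p pM; have [vq Lq] := vL q qM.
by rewrite -vp -vq -Lp -Lq => h1 h2 h3; exists p, q.
Qed.

(** * Equality of labels and commuting involutions in the blocks *)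

Section SameLabel.
Variables (gT : groupType) (G : lgraph gT) (a b : vert G).
Local Open Scope group_scope.
Local Notation M := (#|edge G|.+1).
Implicit Types (C D : seq (garc G)).

(** A reversal keeps the total label because its quotient belongs to a block and is an involution.
    The noncrossing condition and the commuting involutions are carried along, so that the next
    reversal can be treated in the same way. *)
Lemma elementary_same_label C (kap : vert G -> nat) : eulerian_trail a C b ->
  noncrossing M kap (pvert a C) ->
  (forall r, elementary (class_label M kap (pvert a C) (plab C) r)) ->
  all_eulerian_same_label a b.
Proof.
move=> eC ncC elC.
pose P D := [/\ tlab D = tlab C, noncrossing M kap (pvert a D)
  & forall r, elementary (class_label M kap (pvert a D) (plab D) r)].
suff PD D : eulerian_trail a D b -> P D.
  by move=> D D' /PD[-> _ _] /PD[-> _ _].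
move=> eD; apply: (Kotzig_ind _ eC eD) => // {eD} {}D i k eD ik vik [tD nc el].
have szD := size_eulerian eD.
have ikM : i < k < M by rewrite -szD.
have t2 : (plab D k / plab D i) * (plab D k / plab D i) = 1.
  have h : class_label M kap (pvert a D) (plab D) (kap (pvert a D i)) (plab D k / plab D i).
    by exists i, k; split=> //; clear -ikM; lia.
  by case: (el _ _ _ h h).
split.
- rewrite tlab_rev_segment ?tD; last by clear -ik; lia.
  have tV : plab D i / plab D k = plab D k / plab D i.
    by rewrite -[RHS](involution_inv t2) invgF.
  by rewrite !mulgA tV mulgVK mulgV mul1g.
- apply: (noncrossing_ext (v := pvert a D \o flip i k)).
    by move=> q qM; rewrite /= (pvert_rev_segment eD) // szD.
  exact: noncrossing_flip.
- move=> r; apply: (class_label_ext (v := pvert a D \o flip i k)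
      (L := flip_label (plab D) i k)); last exact: class_label_flip.
  move=> q qM; rewrite /= (pvert_rev_segment eD) ?szD //.
  by rewrite (plab_rev_segment ik) ?szD.
Qed.

Lemma same_label_elementary C (kap : vert G -> nat) : eulerian_trail a C b ->
  (forall E, interlacement M (pvert a C) E -> forall p q, p < M -> q < M ->
     kap (pvert a C p) = kap (pvert a C q) -> E p q) ->
  all_eulerian_same_label a b ->
  forall r, elementary (class_label M kap (pvert a C) (plab C) r).
Proof.
move=> eC kapE same r _ _ [p [q [pM qM vpq kp ->]]] [x [y [xM yM vxy kx ->]]].
have S_flip v L i k : trail_positions a b v L -> i < k < M -> v i = v k ->
  (L k / L i) * (L k / L i) = 1 /\ trail_positions a b (v \o flip i k) (flip_label L i k).
  move=> S ik vik; have t2 := same_label_involution same S ik vik.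
  by split=> //; apply: trail_positions_flip.
have SC : trail_positions a b (pvert a C) (plab C) by exists C.
have cpq : chord M (pvert a C) (p, q) by rewrite /chord /= pM qM vpq eqxx.
have cxy : chord M (pvert a C) (x, y) by rewrite /chord /= xM yM vxy eqxx.
split; first exact: (chord_label_sq S_flip SC cpq).
by apply: (interlacement_commute S_flip SC kapE cpq cxy) => /=; rewrite kp.
Qed.

End SameLabel.

(** * Cores *)

Section Cores.
Variables (gT : groupType) (G : lgraph gT) (a b : vert G).
Local Open Scope group_scope.
Local Notation M := (#|edge G|.+1).
Variable C : seq (garc G).
Hypothesis eC : eulerian_trail a C b.
Let wC : walk a C b. Proof. by case/andP: eC => /andP[]. Qed.
Let szC := size_eulerian eC.

Lemma pvert_tail x0 j : j < size C -> pvert a C j = atail (nth x0 C j).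
Proof.
move=> jC; have jj : j <= j.+1 <= size C by rewrite leqnSn.
have := walk_segment wC jj; rewrite (take_nth x0) // -cats1 drop_size_cat ?size_takel 1?ltnW //.
by case/andP=> /eqP ->.
Qed.

Lemma pvert_head x0 j : j < size C -> pvert a C j.+1 = ahead (nth x0 C j).
Proof. by move=> jC; rewrite /pvert /= (nth_map x0). Qed.

Lemma edge_position (e : edge G) x0 : exists2 j, j < size C & (nth x0 C j).1 = e.
Proof.
have/andP[_ /forallP/(_ e)/mapP[x xC ->]] := eC.
by exists (index x C); rewrite ?index_mem ?nth_index.
Qed.

(* An Eulerian trail leaves a vertex set that it visits during one interval of
   time only through the two arcs at the ends of the interval. *)
Lemma interval_cut lo hi p q : p < M -> q < M ->
  lo <= p < hi -> ~~ (lo <= q < hi) ->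
  (forall x y, x < M -> y < M -> lo <= x < hi -> ~~ (lo <= y < hi) ->
     pvert a C x <> pvert a C y) ->
  ~~ edge_connectivity_ge 3 (pvert a C p) (pvert a C q).
Proof.
move=> pM qM pI qI clI; have [x0 CE] : exists x0, x0 \in C.
  case: (C) szC => [s0|x0 ? _]; last by exists x0; rewrite mem_head.
  by rewrite -s0 !ltnS !leqn0 in pM qM; rewrite (eqP pM) (eqP qM) in pI qI; rewrite pI in qI.
(* Arc [j] leads from position [j] to [j.+1], so these are the arcs that enter the interval at [lo]
   and leave it at [hi.-1]. At the ends of the trail the predecessor of 0 or the default of [nth]
   gives an extra edge, which is harmless. *)
apply/forallPn; exists [set (nth x0 C lo.-1).1; (nth x0 C hi.-1).1].
rewrite negb_imply cards2; apply/andP; split; first by case: (_ != _).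
set F := [set _; _].
pose S := fun u : vert G => exists2 x, x < M & (lo <= x < hi) && (pvert a C x == u).
have step u w : adjacent_avoiding F u w -> S u -> S w.
  case/existsP=> x /and3P[xF /eqP<- /eqP<-] [y yM /andP[yI /eqP vy]].
  have [j jC jE] := edge_position x.1 x0.
  have jM : j < M by rewrite -szC ltnS ltnW.
  have j1M : j.+1 < M by rewrite -szC ltnS.
  have [jlo jhi] : j != lo.-1 /\ j != hi.-1.
    by split; apply: contraNneq xF => jlh; rewrite -jE jlh !inE eqxx ?orbT.
  have inI z : z < M -> pvert a C z = atail x -> lo <= z < hi.
    move=> zM vz; apply: contraT => zI; case: (clI y z yM zM yI zI).
    by rewrite vy.
  case: (arc_edge_eq (esym jE)) => xE; rewrite {}xE in vy inI *.
    have jI : lo <= j < hi by apply: inI => //; apply: pvert_tail.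
    exists j.+1; rewrite // (pvert_head x0) // eqxx andbT.
    by clear -jI jhi; lia.
  have jI : lo <= j.+1 < hi by apply: inI => //; rewrite atail_rev; apply: pvert_head.
  exists j; rewrite // ahead_rev (pvert_tail x0) // eqxx andbT.
  by clear -jI jlo; lia.
apply/negP => /connectP[s ps ls].
have : S (pvert a C q).
  rewrite ls; have : S (pvert a C p) by exists p; rewrite ?pI /=.
  elim: s (pvert a C p) ps {ls} => //= u s IH w /andP[wu ps] Sw.
  by apply: IH ps _; apply: step wu Sw.
by case=> x xM /andP[xI /eqP vx]; case: (clI x q xM qM xI qI).
Qed.

Lemma vertex_position u : connected_graph G -> exists2 p, p < M & pvert a C p = u.
Proof.
move=> /(_ a u) /connectP[s ps ->].
have reach0 : exists2 p, p < M & pvert a C p = a by exists 0.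
suff gen u0 : (exists2 p, p < M & pvert a C p = u0) ->
    path (adjacent_avoiding set0) u0 s -> exists2 p, p < M & pvert a C p = last u0 s.
  exact: gen.
elim: s u0 {ps} => //= w s IH u0 hu /andP[/existsP[x /and3P[_ /eqP tx /eqP hx]] ps].
apply: IH ps; have [j jC jE] := edge_position x.1 x.
case: (arc_edge_eq (esym jE)) => xE; rewrite -hx xE.
  by exists j.+1; rewrite ?ltnS -?szC // (pvert_head x).
by exists j; rewrite ?ltnS -?szC 1?ltnW // ahead_rev (pvert_tail x).
Qed.

(** If [q] lies outside the span of the block of [p], this span separates the two. Otherwise [q]
    lies in a gap between consecutive positions of that block, and the gap does. Noncrossing ensures
    that no vertex is shown both inside and outside the interval. The vertex inside comes first in
    [interval_cut], whence the two orders. *)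
Lemma noncrossing_cut (kap : vert G -> nat) p q : p < M -> q < M ->
  noncrossing M kap (pvert a C) -> kap (pvert a C p) != kap (pvert a C q) ->
  ~~ edge_connectivity_ge 3 (pvert a C p) (pvert a C q) \/
  ~~ edge_connectivity_ge 3 (pvert a C q) (pvert a C p).
Proof.
move=> pM qM nc kpq; set k := fun i => kap (pvert a C i).
pose U i := (i < M) && (k i == k p).
have [lo [loM kl lomin]] : exists lo, [/\ lo < M, k lo = k p & forall i, i < M -> k i = k p -> lo <= i].
  have exU : exists i, U i by exists p; rewrite /U pM /=.
  case: (ex_minnP exU) => lo /andP[loM /eqP kl] lm; exists lo; split=> // i iM ki.
  by apply: lm; rewrite /U iM ki /=.
have [hi [hiM kh himax]] : exists hi, [/\ hi < M, k hi = k p & forall i, i < M -> k i = k p -> i <= hi].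
  have exU : exists i, U i by exists p; rewrite /U pM /=.
  have ub i : U i -> i <= M by case/andP=> /ltnW.
  case: (ex_maxnP exU ub) => hi /andP[hiM /eqP kh] lm; exists hi; split=> // i iM ki.
  by apply: lm; rewrite /U iM ki /=.
have neq i j : k i <> k j -> i != j by move=> h; apply/eqP=> E; rewrite E in h.
have crossN i j x y : i < M -> j < M -> x < M -> y < M ->
    k i = k p -> k j = k p -> k x = k y -> i < x < j -> ~~ (i <= y <= j) -> k x = k p.
  move=> iM jM xM yM ki kj kxy xI yI; apply/eqP; apply: contraT => /eqP kxp.
  have := nc i j x y iM jM xM yM; rewrite -/(k i) -/(k j) -/(k x) -/(k y) ki kj.
  move=> /(_ erefl kxy (not_eq_sym kxp)) /negP[].
  by rewrite /cross /=; clear -xI yI; lia.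
have [qI|qI] := boolP (lo < q < hi); last first.
  left; apply: (interval_cut (lo := lo) (hi := hi.+1)) => //.
  - by rewrite ltnS lomin ?himax.
  - apply: contra qI => /andP[lq qh]; rewrite ltnS in qh.
    have q1 : q != lo by apply: neq; rewrite kl => E; case/eqP: kpq.
    have q2 : q != hi by apply: neq; rewrite kh => E; case/eqP: kpq.
    by clear -lq qh q1 q2; lia.
  move=> x y xM yM xI yI vE; have kxy : k x = k y by rewrite /k vE.
  have kyp : k y <> k p by move=> E; rewrite ltnS lomin ?himax in yI.
  have x1 : x != lo by apply: neq; rewrite kl kxy.
  have x2 : x != hi by apply: neq; rewrite kh kxy.
  apply: kyp; rewrite -kxy; apply: (crossN lo hi x y) => //.
  by clear -x1 x2 xI; lia.
right.
have [p1 [p1M k1 p1q p1max]] : exists p1, [/\ p1 < M, k p1 = k p, p1 < q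
    & forall i, i < q -> k i = k p -> i <= p1].
  have exU : exists i, U i && (i < q) by exists lo; rewrite /U loM kl eqxx; case/andP: qI.
  have ub i : U i && (i < q) -> i <= M by case/andP=> /andP[/ltnW].
  case: (ex_maxnP exU ub) => i /andP[/andP[iM /eqP ki] iq] im; exists i; split=> // j jq kj.
  by apply: im; rewrite /U kj eqxx jq (ltn_trans jq).
have [p2 [p2M k2 p2q p2min]] : exists p2, [/\ p2 < M, k p2 = k p, q < p2
    & forall i, i < M -> q < i -> k i = k p -> p2 <= i].
  have exU : exists i, U i && (q < i) by exists hi; rewrite /U hiM kh eqxx; case/andP: qI.
  case: (ex_minnP exU) => i /andP[/andP[iM /eqP ki] iq] im; exists i; split=> // j jM jq kj.
  by apply: im; rewrite /U kj eqxx jq jM.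
have UN i : i < M -> p1 < i < p2 -> k i <> k p.
  move=> iM iI ki; have iq : i != q by apply: neq; rewrite ki; apply/eqP.
  have := p1max i; have := p2min i; rewrite iM ki => h1 h2; clear -h1 h2 iI iq.
  case: (ltngtP i q) iq => // iq _; first by have := h2 iq erefl; lia.
  by have := h1 isT iq erefl; lia.
apply: (interval_cut (lo := p1.+1) (hi := p2)) => //.
- by rewrite p1q.
- by apply/negP=> /(UN _ pM).
move=> x y xM yM xI yI vE; have kxy : k x = k y by rewrite /k vE.
have kxp := UN x xM xI; apply: (kxp); apply: (crossN p1 p2 x y) => //.
have y1 : y != p1 by apply: neq; rewrite k1 -kxy.
have y2 : y != p2 by apply: neq; rewrite k2 -kxy.
by clear -y1 y2 yI; lia.
Qed.

Lemma edge_connectivity_sym r (u w : vert G) :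
  edge_connectivity_ge r u w -> edge_connectivity_ge r w u.
Proof.
move=> /forallP h; apply/forallP => F; apply/implyP => Fr.
have := h F; rewrite Fr /= => c.
have sym u1 w1 : adjacent_avoiding F u1 w1 -> adjacent_avoiding F w1 u1.
  case/existsP=> x /and3P[xF tx hx]; apply/existsP; exists (arc_rev x).
  by rewrite atail_rev ahead_rev tx hx xF.
rewrite (@sym_connect_sym _ (adjacent_avoiding F)) // => u1 w1.
by apply/idP/idP; apply: sym.
Qed.

Lemma core_class (kap : vert G -> nat) (X : {set vert G}) u w :
  connected_graph G -> noncrossing M kap (pvert a C) -> core X ->
  u \in X -> w \in X -> kap u = kap w.
Proof.
move=> cG nc /maxsetP[/forall_inP X3 _] uX wX.
have [p pM pu] := vertex_position u cG; have [q qM qw] := vertex_position w cG.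
have [-> //|uw] := eqVneq u w.
have conn : edge_connectivity_ge 3 u w.
  by have /forall_inP/(_ w wX) := X3 u uX; rewrite uw.
apply/eqP; apply: contraT; rewrite -pu -qw => kN.
have [] := noncrossing_cut pM qM nc kN; rewrite pu qw => /negP[] //.
exact: edge_connectivity_sym.
Qed.

Definition first_visit u := index u (a :: map (@ahead _ G) C).

Definition potential u := plab C (first_visit u).

Lemma first_visitP p : p < M -> 
  [/\ first_visit (pvert a C p) <= p, first_visit (pvert a C p) < M
    & pvert a C (first_visit (pvert a C p)) = pvert a C p].
Proof.
move=> pM; have pC : p < size (a :: map (@ahead _ G) C) by rewrite /= size_map szC.
have vin := mem_nth a pC.
have le : first_visit (pvert a C p) <= p by exact: index_nth.
split=> //; first exact: leq_ltn_trans le pM.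
exact: nth_index.
Qed.

Lemma tlab_shift u (T : seq (garc G)) w : walk u T w ->
  @tlab _ (shift potential) T = potential u * tlab T * (potential w)^-1.
Proof.
elim: T u => [|x T IH] u /=; first by move/eqP->; rewrite /tlab !big_nil mulg1 mulgV.
case/andP=> /eqP<- wT.
transitivity (potential (atail x) * alab x * (potential (ahead x))^-1 *
    (potential (ahead x) * tlab T * (potential w)^-1)).
  by rewrite {1}/tlab big_cons; exact: (congr2 *%g (alab_shift potential x) (IH _ wT)).
by rewrite /tlab big_cons !mulgA mulgVK.
Qed.

(** With [f] and [f'] the first visits of the end vertices, the shifted label is
    [(L i / L f)^-1 * (L k / L f')]. The vertices passed in between do not enter, so excursions from
    a core are covered as well as single arcs. *)
Lemma segment_shift_generated (kap : vert G -> nat) r i k : i <= k <= size C ->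
  kap (pvert a C i) = r -> kap (pvert a C k) = r ->
  generated (class_label M kap (pvert a C) (plab C) r)
    (@tlab _ (shift potential) (drop i (take k C))).
Proof.
move=> ikC ki kk; rewrite (tlab_shift (walk_segment wC ikC)).
have iM : i < M by rewrite -szC; clear -ikC; lia.
have kM : k < M by rewrite -szC; clear -ikC; lia.
rewrite tlab_segment; last by case/andP: ikC.
have [_ fiM fi] := first_visitP iM; have [_ fkM fk] := first_visitP kM.
rewrite [_ * (_ * _)]mulgA -[_ * _ * _ * _]mulgA; apply: generated_mul.
  rewrite -invgF; apply: generated_inv; apply: generated_mem.
  by exists (first_visit (pvert a C i)), i; split; rewrite ?fi.
by apply: generated_mem; exists (first_visit (pvert a C k)), k; split; rewrite ?fk.
Qed.

Lemma core_label_group (kap : vert G -> nat) (X : {set vert G}) :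
  connected_graph G -> noncrossing M kap (pvert a C) ->
  (forall r, elementary (class_label M kap (pvert a C) (plab C) r)) ->
  core X ->
  exists r, isomorphic_Z2_pow
    (label_group (core_graph (G := @shift gT G potential) X C)) r.
Proof.
move=> cG nc el cX.
have [k kX] : exists k, forall u, u \in X -> kap u = k.
  have [->|[u uX]] := set_0Vmem X; first by exists 0 => u; rewrite inE.
  by exists (kap u) => w wX; apply: core_class cX wX uX.
set H := core_graph _ _.
have gen (x : garc H) : generated (class_label M kap (pvert a C) (plab C) k) (alab x).
  suff gen0 : generated (class_label M kap (pvert a C) (plab C) k) (elab x.1).
    by rewrite /alab; case: x.2 => //; apply: generated_inv.
  case: x => [[[e eX]|[T TC]] _] /=.
    have [j jC jE] := edge_position e (e, false).
    have jj : j <= j.+1 <= size C by rewrite leqnSn.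
    have [tX hX] : atail (nth (e, false) C j) \in X /\ ahead (nth (e, false) C j) \in X.
      have /andP[h1 h2] := eX.
      by case: (nth (e, false) C j) jE => [f []] /= ->.
    have := @segment_shift_generated kap k j j.+1 jj.
    rewrite (pvert_tail (e, false)) // (pvert_head (e, false)) // !kX //.
    move=> /(_ erefl erefl).
    rewrite (take_nth (e, false)) // -cats1 drop_size_cat ?size_takel 1?ltnW //.
    rewrite /tlab big_seq1 /alab jE.
    by case: (nth _ _ _).2 => // /generated_inv; rewrite invgK.
  have := TC; rewrite mem_filter => /andP[exT /allpairsP[[i j] /= [+ + TE]]].
  rewrite !mem_iota !add0n => /andP[_ iC] /andP[j0 _].
  (* In [subtrails] the length [j] may run past the end of [C], hence the minimum. *)
  pose k' := minn (i + j) (size C).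
  have {}TE : T = drop i (take k' C).
    rewrite TE take_drop /k'; case: (leqP (i + j) (size C)) => ij; rewrite addnC //.
    by rewrite !take_oversize // ltnW // addnC.
  have ik' : i <= k' <= size C by rewrite /k' leq_min leq_addr (ltnW iC) geq_minr.
  have wT := walk_segment wC ik'; rewrite -TE in wT.
  case: T TE exT wT {TC} => [//|x s] TE /and5P[xX lX _ _ _] wT.
  rewrite TE; apply: segment_shift_generated => //; apply: kX.
    by case/andP: wT => /eqP<-.
  by rewrite -(walk_endE wT) /walk_end /= last_map.
have [r] : exists r, isomorphic_Z2_pow (generated (fun z => z \in [seq alab x | x : garc H])) r.
  apply: elementary_isomorphic_Z2_pow.
  apply: (sub_elementary _ (elementary_generated (el k))) => _ /imageP[x _ ->].
  exact: gen.
case=> f [f1 f2 f3]; exists r, f; split=> // z; rewrite -f3.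
split; apply: generated_mono => y; [case=> x ->|case/imageP=> x _ ->];
  apply: generated_mem; [exact: image_f | by exists x].
Qed.

End Cores.

(** * Computing the finest noncrossing partition *)

Section Closure.
(** [F q] and [La q] stand for the first and the last position that show the vertex of [q]. *)
Variables (V : eqType) (M : nat) (c : nat -> V) (F La : nat -> nat).
Hypothesis F_le : forall q, q < M -> F q <= q.
Hypothesis F_vert : forall q, q < M -> c (F q) = c q.
Hypothesis F_eq : forall q q', q < M -> q' < M -> c q = c q' -> F q = F q'.
Hypothesis La_ge : forall q, q < M -> q <= La q.
Hypothesis La_lt : forall q, q < M -> La q < M.
Hypothesis La_vert : forall q, q < M -> c (La q) = c q.
Hypothesis La_eq : forall q q', q < M -> q' < M -> c q = c q' -> La q = La q'.

Definition set_at (f : nat -> nat) i v := fun j => if j == i then v else f j.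

(* The positions before i have been scanned. ST 1 < ... < ST sp are the first
   positions of the blocks that extend to position b or beyond, ML their
   last positions, PAR links a merged block to the block that absorbed it, and
   kap maps a scanned position to the first position of its block. *)
Record scanned b i sp (ST ML PAR kap : nat -> nat) : Prop := Scanned {
  kap_F : forall q, q < i -> kap q = kap (F q);
  kap_le : forall q, q < i -> kap q <= q;
  kap_par : forall x, x < i -> F x = x ->
    [/\ PAR x <= x, F (PAR x) = PAR x, kap (PAR x) = kap x
      & PAR x = x -> kap x = x];
  st_lt : forall j, 0 < j < sp -> ST j < ST j.+1;
  st_root : forall j, 0 < j <= sp ->
    [/\ ST j < i, F (ST j) = ST j & PAR (ST j) = ST j];
  st_live : forall q, q < i -> b <= La q -> exists2 j, 0 < j <= sp & kap q = ST j;
  st_max : forall j, 0 < j <= sp -> [/\ b <= ML j,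
     exists2 q, q < i & kap q = ST j /\ La q = ML j
   & forall q, q < i -> kap q = ST j -> La q <= ML j];
  st_pos : forall q j, q < i -> 0 < j <= sp -> kap q = ST j ->
     ST j <= q /\ (j < sp -> q < ST j.+1);
  nc3 : forall p q r j, p < q -> q < r -> r < i -> kap p = kap r ->
     0 < j <= sp -> kap q = ST j -> kap q = kap p;
  nc4 : forall p q r u, p < q -> q < r -> r < u -> u < i ->
     kap p = kap r -> kap q = kap u -> kap p = kap q;
  kap_sound : forall E, interlacement M c E -> forall q, q < i -> E q (kap q)
}.

Lemma scanned0 ST ML PAR : scanned 0 0 0 ST ML PAR id.
Proof.
split=> //; try by move=> ? [].
all: by case=> [|j].
Qed.

Lemma st_mono b i sp ST ML PAR kap j j' : scanned b i sp ST ML PAR kap ->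
  0 < j -> j <= j' -> j' <= sp -> ST j <= ST j'.
Proof.
move=> I j0; elim: j' => [|j' IH]; first by rewrite leqn0 => /eqP->.
rewrite leq_eqVlt => /predU1P[-> //|jj'] j's.
apply: leq_trans (IH jj' (ltnW j's)) _; apply: ltnW; apply: (st_lt I).
by clear -j0 jj' j's; lia.
Qed.

Lemma st_inj b i sp ST ML PAR kap j j' : scanned b i sp ST ML PAR kap ->
  0 < j <= sp -> 0 < j' <= sp -> ST j = ST j' -> j = j'.
Proof.
move=> I; wlog jj' : j j' / j < j' => [W js j's E|].
  by case: (ltngtP j j') => // h; [exact: W | apply/esym/W].
move=> js j's E; have h1 : ST j < ST j.+1 by apply: (st_lt I); clear -js j's jj'; lia.
have h2 : ST j.+1 <= ST j' by apply: (st_mono I); clear -js j's jj'; lia.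
by exfalso; clear -h1 h2 E; lia.
Qed.

Lemma kap_root b i sp ST ML PAR kap j : scanned b i sp ST ML PAR kap ->
  0 < j <= sp -> kap (ST j) = ST j.
Proof.
by move=> I js; have [h1 h2 h3] := st_root I js; have [_ _ _] := kap_par I h1 h2; apply.
Qed.

Section Push.
Variables (i sp : nat) (ST ML PAR kap : nat -> nat).
Hypotheses (iM : i < M) (I : scanned i i sp ST ML PAR kap) (Fi : F i = i).

Lemma scanned_push :
  scanned i i.+1 sp.+1 (set_at ST sp.+1 i) (set_at ML sp.+1 (La i))
    (set_at PAR i i) (set_at kap i i).
Proof.
have kapE q : q < i -> set_at kap i i q = kap q.
  by rewrite /set_at; case: eqP => // ->; rewrite ltnn.
have kapi : set_at kap i i i = i by rewrite /set_at eqxx.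
have stE j : j <= sp -> set_at ST sp.+1 i j = ST j.
  by rewrite /set_at; case: eqP => // ->; rewrite ltnn.
have sti : set_at ST sp.+1 i sp.+1 = i by rewrite /set_at eqxx.
have mlE j : j <= sp -> set_at ML sp.+1 (La i) j = ML j.
  by rewrite /set_at; case: eqP => // ->; rewrite ltnn.
have mli : set_at ML sp.+1 (La i) sp.+1 = La i by rewrite /set_at eqxx.
have FM q : q < i -> F q < i by move=> qi; apply: (leq_ltn_trans (F_le (ltn_trans qi iM)) qi).
have stlt j : 0 < j <= sp -> ST j < i by move=> /(st_root I)[].
have last j : 0 < j <= sp.+1 -> j = sp.+1 \/ 0 < j <= sp by clear; lia.
have lastq q : q < i.+1 -> q = i \/ q < i by clear; lia.
split.
- by move=> q /lastq[->|qi]; rewrite ?Fi // !kapE ?FM // (kap_F I).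
- by move=> q /lastq[->|qi]; rewrite ?kapi // kapE // (kap_le I).
- move=> x /lastq[->|xi] Fx; first by rewrite /set_at !eqxx.
  have [h1 h2 h3 h4] := kap_par I xi Fx.
  have -> : set_at PAR i i x = PAR x by rewrite /set_at; case: eqP xi => // ->; rewrite ltnn.
  by split=> //; rewrite !kapE // (leq_ltn_trans h1).
- move=> j /andP[j0]; rewrite ltnS => js; rewrite stE //.
  case: (ltngtP j sp) js => // [jsp _|E _].
    by rewrite stE //; apply: (st_lt I); rewrite j0.
  by rewrite E sti; apply: stlt; rewrite -{1}E j0 leqnn.
- move=> j /last[->|js]; first by rewrite sti /set_at eqxx.
  rewrite stE; last by case/andP: js.
  have [h1 h2 h3] := st_root I js; split=> //; first exact: ltnW.
  by rewrite /set_at; case: eqP h1 => // ->; rewrite ltnn.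
- move=> q /lastq[->|qi] b; first by exists sp.+1; rewrite ?sti // leqnn.
  have [j js kq] := st_live I qi b; exists j; first by clear -js; lia.
  by rewrite kapE // stE //; case/andP: js.
- move=> j /last[->|js].
    rewrite mli sti; split; first exact: La_ge.
      by exists i.
    move=> q /lastq[->//|qi]; rewrite kapE // => kq.
    by have := kap_le I qi; rewrite kq leqNgt qi.
  have jsp : j <= sp by case/andP: js.
  rewrite mlE // stE //; have [h1 [q qi [h2 h3]] h4] := st_max I js; split=> //.
    by exists q; [exact: ltnW | rewrite kapE].
  move=> q' /lastq[->|q'i]; last by rewrite kapE // => /h4; apply.
  by rewrite kapi => E; have := stlt j js; rewrite -E ltnn.
- move=> q j /lastq[->|qi] /last[->|js].
  + by rewrite sti ltnn.
  + rewrite kapi stE ?(andP js).2 // => E; have := stlt j js.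
    by rewrite -E ltnn.
  + by rewrite kapE // sti => kq; have := kap_le I qi; rewrite kq leqNgt qi.
  + have jsp : j <= sp by case/andP: js.
    rewrite kapE // stE // => kq; have [h1 h2] := st_pos I qi js kq; split=> // _.
    case: (ltngtP j sp) jsp => // [jsp _|E _]; first by rewrite stE // h2.
    by rewrite E sti.
- move=> p q r j pq qr /lastq[E|ri].
    rewrite E kapi kapE; last by clear -pq qr E; lia.
    move=> kp; have := @kap_le _ _ _ _ _ _ _ I p; rewrite kp; clear -pq qr E; lia.
  have qi := ltn_trans qr ri; have pi := ltn_trans pq qi.
  rewrite !kapE // => kpr /last[->|js]; last first.
    by rewrite stE ?(andP js).2 //; exact: (nc3 I pq qr ri kpr js).
  by rewrite sti => kq; have := kap_le I qi; rewrite kq leqNgt qi.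
- move=> p q r u pq qr ru /lastq[E|ui].
    rewrite E kapi (kapE q) => [_ kq|]; last by clear -pq qr ru E; lia.
    by have := @kap_le _ _ _ _ _ _ _ I q; rewrite kq; clear -qr ru E; lia.
  have ri := ltn_trans ru ui; have qi := ltn_trans qr ri; have pi := ltn_trans pq qi.
  by rewrite !kapE //; apply: (nc4 I).
- move=> E iE q /lastq[->|qi]; last by rewrite kapE //; apply: (kap_sound I).
  by rewrite kapi; have [h _ _ _] := iE; apply: h.
Qed.
End Push.

Section Join.
Variables (i sp : nat) (ST ML PAR kap : nat -> nat).
Hypotheses (iM : i < M) (I : scanned i i sp ST ML PAR kap) (Fi : F i < i).
Hypothesis sp0 : 0 < sp.

Let pM : F i < M. Proof. exact: ltn_trans Fi iM. Qed.

Lemma join_live : exists2 j, 0 < j <= sp & kap (F i) = ST j.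
Proof.
apply: (st_live I Fi); rewrite (La_eq pM iM (F_vert iM)).
exact: La_ge.
Qed.

(** An open block below the top has all its positions before the start of the next block on the
    stack, so it cannot contain [F i]. *)
Lemma join_top : ST sp <= F i -> kap (F i) = ST sp.
Proof.
move=> le; have [j js kp] := join_live; rewrite kp.
have [h1 h2] := st_pos I Fi js kp.
case: (ltngtP j sp) js => [jsp js||-> //]; last by rewrite andbF.
have := st_mono I (ltn0Sn j) jsp (leqnn sp); have := h2 jsp; clear -le; lia.
Qed.

(* A block above that of F i contains a vertex that interlaces with the vertex
   at position i. *)
Lemma join_sound E j j' : interlacement M c E -> 0 < j -> j <= j' -> j' <= sp ->
  kap (F i) = ST j -> E (F i) (ST j').
Proof.
move=> iE j0 jj' j's kp; have js : 0 < j <= sp by rewrite j0 (leq_trans jj').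
have j's' : 0 < j' <= sp by rewrite (leq_trans j0).
case: (ltngtP j j') jj' => // [jj' _|E0 _]; last first.
  by rewrite -E0 -kp; apply: (kap_sound I iE).
have [h1 [q qi [kq Lq]] _] := st_max I j's'.
have qM := ltn_trans qi iM.
have [h2 _] := st_pos I qi j's' kq; have [_ h3] := st_pos I Fi js kp.
have jsp := leq_trans jj' j's.
have h4 := st_mono I (ltn0Sn j) jj' j's; have h5 := h3 jsp.
have pq : F i < q by clear -h2 h4 h5; lia.
have LqN : La q != i.
  apply/eqP => Li; have cq : c q = c i by rewrite -(La_vert qM) Li.
  have : kap q = kap (F i) by rewrite (kap_F I qi) (F_eq qM iM cq).
  rewrite kq kp => E1; have := st_inj I j's' js E1; clear -jj'; lia.
have iLq : i < La q by rewrite -Lq in h1; clear -h1 LqN; lia.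
have [_ _ tr cr] := iE.
have Epq : E (F i) q by apply: (cr _ _ i (La q)); rewrite ?La_lt ?La_vert ?F_vert.
by have := tr _ _ _ pM qM _ Epq (kap_sound I iE qi); rewrite kq; apply; have [h _ _] := st_root I j's'; apply: ltn_trans h iM.
Qed.

Lemma scanned_add : ST sp <= F i ->
  scanned i i.+1 sp ST ML PAR (set_at kap i (ST sp)).
Proof.
move=> /join_top kp; have sps : 0 < sp <= sp by rewrite sp0 leqnn.
have kapE q : q < i -> set_at kap i (ST sp) q = kap q.
  by rewrite /set_at; case: eqP => // ->; rewrite ltnn.
have kapi : set_at kap i (ST sp) i = ST sp by rewrite /set_at eqxx.
have lastq q : q < i.+1 -> q = i \/ q < i by clear; lia.
have FM q : q < i -> F q < i.
  by move=> qi; apply: (leq_ltn_trans (F_le (ltn_trans qi iM)) qi).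
have top_max j : 0 < j <= sp -> ST sp = ST j -> j = sp.
  by move=> js E; apply/esym; apply: (st_inj I sps js E).
split.
- by move=> q /lastq[->|qi]; [rewrite kapi kapE | rewrite !kapE ?FM // (kap_F I)].
- move=> q /lastq[->|qi]; last by rewrite kapE // (kap_le I).
  by rewrite kapi; have [/ltnW] := st_root I sps.
- move=> x /lastq[->|xi] Fx; first by move: Fi; rewrite Fx ltnn.
  have [h1 h2 h3 h4] := kap_par I xi Fx.
  by split=> //; rewrite !kapE // (leq_ltn_trans h1).
- exact: (st_lt I).
- by move=> j /(st_root I)[h1 h2 h3]; split=> //; apply: ltnW.
- move=> q /lastq[->|qi] b; first by exists sp.
  by have [j js kq] := st_live I qi b; exists j; rewrite ?kapE.
- move=> j js; have [h1 [q qi [h2 h3]] h4] := st_max I js; split=> //.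
    by exists q; [exact: ltnW | rewrite kapE].
  move=> q' /lastq[->|q'i]; last by rewrite kapE // => /h4; apply.
  rewrite kapi => E; rewrite -(La_eq pM iM (F_vert iM)); apply: h4 => //.
  by rewrite kp.
- move=> q j /lastq[->|qi] js; last by rewrite kapE //; apply: (st_pos I).
  rewrite kapi => /(top_max j js) ->; rewrite ltnn; split=> //.
  by have [/ltnW] := st_root I sps.
- move=> p q r j pq qr /lastq[E|ri] kpr js.
    have qi : q < i by rewrite -E. have pi := ltn_trans pq qi.
    move: kpr; rewrite E kapi !kapE // => kpr kq; rewrite kpr kq.
    have [h1 _] := st_pos I pi sps kpr; have [_ h2] := st_pos I qi js kq.
    case: (ltngtP j sp) (js) => [jsp _|jsp|-> //]; last by rewrite andbF.
    have := st_mono I (ltn0Sn j) jsp (leqnn sp); have := h2 jsp; clear -h1 pq; lia.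
  have qi := ltn_trans qr ri; have pi := ltn_trans pq qi.
  by move: kpr; rewrite !kapE // => kpr; apply: (nc3 I pq qr ri kpr js).
(* For [u = i] this is [nc3] for the top block: the condition on three positions anticipates that an
   open block can still receive a fourth one. *)
- move=> p q r u pq qr ru /lastq[E|ui].
    have ri : r < i by rewrite -E. have qi := ltn_trans qr ri; have pi := ltn_trans pq qi.
    rewrite E kapi !kapE // => kpr kq; apply/esym.
    exact: (nc3 I pq qr ri kpr sps kq).
  have ri := ltn_trans ru ui; have qi := ltn_trans qr ri; have pi := ltn_trans pq qi.
  by rewrite !kapE //; apply: (nc4 I).
- move=> E iE q /lastq[->|qi]; last by rewrite kapE //; apply: (kap_sound I).
  rewrite kapi -kp; have [h _ tr _] := iE.
  have E1 : E i (F i) by apply: h; rewrite ?F_vert.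
  apply: tr E1 (kap_sound I iE Fi) => //.
  by rewrite kp; have [h1 _ _] := st_root I sps; apply: ltn_trans h1 iM.
Qed.

End Join.

Section Merge.
Variables (i s : nat) (ST ML PAR kap : nat -> nat).
Hypotheses (iM : i < M) (I : scanned i i s.+1 ST ML PAR kap) (Fi : F i < i).
Hypothesis top : F i < ST s.+1.

Let T := ST s.+1.
Let B := ST s.
Let kap' q := if kap q == T then B else kap q.

Lemma merge_pos : exists j, [/\ 0 < j, j <= s & kap (F i) = ST j].
Proof.
have [j /andP[j0 js] kp] := join_live iM I Fi; exists j; split=> //.
rewrite -ltnS ltn_neqAle js andbT; apply/eqP => E.
have jj : 0 < j <= s.+1 by rewrite j0.
by have [+ _] := st_pos I Fi jj kp; rewrite E leqNgt top.
Qed.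

(** The top block starts behind [F i], so the block of [F i] is below it on the stack and the top
    can be absorbed by its neighbour. Crossings of the merged block with a third one are excluded by
    [nc3], as both parts are still open. *)
Lemma scanned_merge : 0 < s /\
  scanned i i s ST (set_at ML s (maxn (ML s) (ML s.+1))) (set_at PAR T B) kap'.
Proof.
have [j1 [j10 j1s kp1]] := merge_pos.
have s0 : 0 < s := leq_trans j10 j1s; split=> //.
have topB : B < T by apply: (st_lt I); rewrite s0 leqnn.
have ss : 0 < s <= s.+1 by rewrite s0 leqnSn.
have s1s : 0 < s.+1 <= s.+1 by rewrite leqnn.
have wk j : 0 < j <= s -> 0 < j <= s.+1 by clear; lia.
have kB : kap B = B := kap_root I ss.
have kT : kap T = T := kap_root I s1s.
have BT : (B == T) = false by apply/eqP => E; move: topB; rewrite E ltnn.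
have stT j : 0 < j <= s -> (ST j == T) = false.
  move=> js; apply/eqP => E; have := st_inj I (wk j js) s1s E.
  by clear -js; lia.
have k'P q : kap' q = kap q /\ kap q <> T \/ kap' q = B /\ kap q = T.
  by rewrite /kap'; case: eqP; auto.
have live q j : 0 < j <= s -> kap' q = ST j ->
    kap q = ST j \/ (kap q = T /\ j = s).
  rewrite /kap' => js; case: eqP => [-> E|_]; auto; right; split=> //.
  exact: (st_inj I (wk j js) ss (esym E)).
have liveE q j : 0 < j <= s -> kap' q = ST j ->
    exists2 j0, 0 < j0 <= s.+1 & kap q = ST j0.
  by move=> js /(live q j js)[kq|[kq _]]; [exists j; rewrite ?wk | exists s.+1].
have posB q : q < i -> kap q = B -> B <= q /\ q < T.
  by move=> qi kq; have [h1 h2] := st_pos I qi ss kq; split=> //; apply: h2.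
have posT q : q < i -> kap q = T -> T <= q.
  by move=> qi kq; have [h1 _] := st_pos I qi s1s kq.
have kEq q r : kap' q = kap' r -> kap q = kap r \/
    [/\ kap q = B, kap r = T & kap' q = B] \/ [/\ kap q = T, kap r = B & kap' q = B].
  rewrite /kap'; case: eqP => [kq|_]; case: eqP => [kr|_] E.
  - by left; rewrite kq kr.
  - by right; right; rewrite kq -E.
  - by right; left; rewrite E.
  - by left.
split.
- by move=> q qi; rewrite /kap' (kap_F I qi).
- move=> q qi; rewrite /kap'; case: eqP => [kq|_]; last exact: (kap_le I).
  by apply: leq_trans (ltnW topB) _; rewrite -kq (kap_le I).
- move=> x xi Fx; rewrite /set_at; case: eqP => [->|xT].
    rewrite /kap' kB kT eqxx BT (ltnW topB); have [_ h _] := st_root I ss.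
    by split=> // E; move: topB; rewrite E ltnn.
  have [h1 h2 h3 h4] := kap_par I xi Fx; split=> //; first by rewrite /kap' h3.
  by move=> /h4 kx; rewrite /kap' kx; case: eqP.
- by move=> j js; apply: (st_lt I); clear -js; lia.
- move=> j js; have [h1 h2 h3] := st_root I (wk j js); split=> //.
  by rewrite /set_at stT.
- move=> q qi b; have [j js kq] := st_live I qi b.
  have [E|jN] := eqVneq j s.+1.
    by exists s; rewrite ?s0 ?leqnn // /kap' kq E eqxx.
  have js' : 0 < j <= s by clear -js jN; lia.
  by exists j; rewrite // /kap' kq stT.
- move=> j js; have [h1 [q qi [kq Lq]] h3] := st_max I (wk j js).
  rewrite /set_at; case: eqP => [E|jN].
    subst j; have [k1 [q' q'i [kq' Lq']] k3] := st_max I s1s; split.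
    + by rewrite leq_max h1.
    + case: (leqP (ML s) (ML s.+1)) => _; [exists q' | exists q] => //.
        by rewrite /kap' kq' eqxx.
      by rewrite /kap' kq BT.
    + move=> q2 q2i /(live q2 s js)[/(h3 _ q2i)|[/(k3 _ q2i) + _]]; rewrite leq_max => -> //.
      by rewrite orbT.
  split=> //; first by exists q; rewrite // /kap' kq stT.
  move=> q2 q2i /(live q2 j js)[/(h3 _ q2i) // |[_ E]]; by case: jN.
- move=> q j qi js /(live q j js)[kq|[kq ->]].
    by have [h1 h2] := st_pos I qi (wk j js) kq; split=> // jlt; apply: h2; apply: ltnW.
  by rewrite ltnn; split=> //; apply: leq_trans (ltnW topB) (posT q qi kq).
- move=> p q r j pq qr ri kpr js kq.
  have qi := ltn_trans qr ri; have pi := ltn_trans pq qi.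
  have [j0 j0s kq0] := liveE q j js kq.
  have [E|[[kp kr k'p]|[kp kr k'p]]] := kEq _ _ kpr.
  + by rewrite /kap' (nc3 I pq qr ri E j0s kq0).
  + rewrite k'p; have [h1 _] := posB p pi kp; have [_ h2] := st_pos I qi j0s kq0.
    have [j0E|j0N] := eqVneq j0 s.+1; first by rewrite /kap' kq0 j0E eqxx.
    have [j0E|j0N'] := eqVneq j0 s; first by rewrite /kap' kq0 j0E BT.
    have jlt : j0 < s by clear -j0s j0N j0N'; lia.
    have := st_mono I (ltn0Sn j0) jlt (leqnSn s); have := h2 (ltnW jlt).
    by rewrite -/B; clear -h1 pq; lia.
  + have := posT p pi kp; have [_] := posB r ri kr; clear -pq qr; lia.
- move=> p q r u pq qr ru ui kpr kqu.
  have ri := ltn_trans ru ui; have qi := ltn_trans qr ri; have pi := ltn_trans pq qi.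
  have [E|[[kp kr k'p]|[kp kr k'p]]] := kEq _ _ kpr.
  + have [E'|[[kq ku k'q]|[kq ku k'q]]] := kEq _ _ kqu.
    * by rewrite /kap' (nc4 I pq qr ru ui E E').
    * by rewrite /kap' (nc3 I pq qr ri E ss kq).
    * by rewrite /kap' (nc3 I pq qr ri E s1s kq).
  + rewrite k'p; have [E'|[[kq ku ->]|[kq ku ->]]] := kEq _ _ kqu => //.
    have := nc3 I qr ru ui E' s1s kr; rewrite kr => kq.
    by rewrite /kap' -kq eqxx.
  + have := posT p pi kp; have [_] := posB r ri kr; clear -pq qr; lia.
(* By [join_sound] both merged blocks are related to [F i], hence to each other. *)
- move=> E iE q qi; have [[-> _]|[-> kq]] := k'P q; first exact: (kap_sound I).
  have [_ sy tr _] := iE.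
  have qM := ltn_trans qi iM; have pM := ltn_trans Fi iM.
  have [Bi _ _] := st_root I ss; have [Ti _ _] := st_root I s1s.
  have BM := ltn_trans Bi iM; have TM := ltn_trans Ti iM.
  have EpB := join_sound iM I Fi iE j10 j1s (leqnSn s) kp1.
  have EpT := join_sound iM I Fi iE j10 (leqW j1s) (leqnn _) kp1.
  apply: (tr q T B) => //; first by rewrite -kq; apply: (kap_sound I).
  by apply: (tr T (F i) B) => //; apply: sy.
Qed.

End Merge.

Section Finish.
Variables (i sp : nat) (ST ML PAR kap : nat -> nat).
Hypotheses (iM : i < M) (I : scanned i i.+1 sp ST ML PAR kap).
Hypotheses (sp0 : 0 < sp) (kapi : kap i = ST sp).

Let sps : 0 < sp <= sp. Proof. by rewrite sp0 leqnn. Qed.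

(** A block that ends at [i] contains position [i], which belongs to the top block. Hence only the
    top can be closed at each position. *)
Lemma finish_live j : 0 < j < sp -> i < ML j.
Proof.
move=> js; have js' : 0 < j <= sp by clear -js; lia.
have [h1 [q qi [kq Lq]] _] := st_max I js'; rewrite ltn_neqAle h1 andbT eq_sym.
apply/eqP => E; have qM : q < M by apply: leq_trans qi iM.
have cq : c q = c i by rewrite -(La_vert qM) Lq E.
have : kap q = kap i by rewrite (kap_F I qi) (kap_F I (ltnSn i)) (F_eq qM iM cq).
by rewrite kq kapi => /(st_inj I js' sps); clear -js; lia.
Qed.

Lemma scanned_keep : i < ML sp -> scanned i.+1 i.+1 sp ST ML PAR kap.
Proof.
move=> lt; case: (I) => *; split=> //; first by move=> q qi /ltnW; apply: (st_live I).
move=> j js; have [h1 h2 h3] := st_max I js; split=> //.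
have [->//|jN] := eqVneq j sp; apply: finish_live; clear -js jN; lia.
Qed.

Lemma scanned_pop : ML sp <= i -> scanned i.+1 i.+1 sp.-1 ST ML PAR kap.
Proof.
move=> le; have wk j : 0 < j <= sp.-1 -> 0 < j <= sp by clear; lia.
case: (I) => *; split=> //.
- by move=> j js; apply: (st_lt I); clear -js; lia.
- by move=> j /wk; apply: (st_root I).
- move=> q qi b; have [j js kq] := st_live I qi (ltnW b); exists j => //.
  have jN : j != sp.
    apply/eqP => E; have [_ _ h] := st_max I sps; have := h q qi; rewrite -E => /(_ kq).
    by rewrite E; clear -le b; lia.
  clear -js jN; lia.
- move=> j js; have [h1 h2 h3] := st_max I (wk j js); split=> //.
  by apply: finish_live; clear -js; lia.
- move=> q j qi js kq; have [h1 h2] := st_pos I qi (wk j js) kq; split=> // jlt.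
  by apply: h2; clear -jlt; lia.
- move=> p q r j pq qr ri kpr /wk js; exact: (nc3 I pq qr ri kpr js).
Qed.

End Finish.

End Closure.

(** * Testing a group of potential differences *)

Section JoinClasses.
Variables (gT : groupType) (l : nat) (Lam : nat -> gT).
Local Open Scope group_scope.
Implicit Types (cls : nat -> nat) (D : gT -> Prop).

Definition offset cls j : gT := Lam j / Lam (cls j).

Definition join cls cs ct := fun j => if cls j == ct then cs else cls j.

(* The quotients Lam t / Lam s over the edges (s, t) of a graph on the numbers up
   to l generate the same group as the offsets, where cls maps each number to
   a representative of its component. *)
Record classes cls D : Prop := Classes {
  cls_le : forall j, j <= l -> cls j <= l;
  cls_idem : forall j, j <= l -> cls (cls j) = cls j;
  cls_gen : forall j, j <= l -> generated D (offset cls j)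
}.

Definition offsets cls z := exists2 j, j <= l & z = offset cls j.

Lemma classes_id D : classes id D.
Proof. by split=> // j _; rewrite /offset mulgV; exact: generated_one. Qed.

Lemma classes_sub cls D D' : (forall z, D z -> D' z) -> classes cls D -> classes cls D'.
Proof.
move=> DD' [h1 h2 h3]; split=> // j jl; apply: generated_mono (h3 j jl) => z /DD'.
exact: generated_mem.
Qed.

Section Join.
Variables (cls : nat -> nat) (D : gT -> Prop) (s t : nat).
Hypotheses (cl : classes cls D) (sl : s <= l) (tl : t <= l).
Hypothesis Dst : D (Lam t / Lam s).
Local Notation cs := (cls s).
Local Notation ct := (cls t).

Lemma join_gen : generated D (Lam ct / Lam cs).
Proof.
have -> : Lam ct / Lam cs = (offset cls t)^-1 * (Lam t / Lam s) * offset cls s.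
  by rewrite /offset invgF !mulgA !mulgVK.
apply: generated_mul (cls_gen cl sl); apply: generated_mul (generated_mem Dst).
exact/generated_inv/(cls_gen cl tl).
Qed.

Lemma offset_join j : offset (join cls cs ct) j =
  if cls j == ct then offset cls j * (Lam ct / Lam cs) else offset cls j.
Proof.
by rewrite /offset /join; case: eqP => // ->; rewrite mulgA mulgVK.
Qed.

Lemma classes_join : classes (join cls cs ct) D.
Proof.
case: (cl) => h1 h2 h3; split=> j jl.
- by rewrite /join; case: ifP => _; apply: h1.
- rewrite /join; case: (eqVneq (cls j) ct) => [_|jt].
    by rewrite h2 //; case: ifP.
  by rewrite h2 // (negPf jt).
- rewrite offset_join; case: ifP => _; last exact: h3.
  by apply: generated_mul (h3 j jl) join_gen.
Qed.

Lemma join_eq : join cls cs ct s = join cls cs ct t.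
Proof. by rewrite /join eqxx; case: ifP. Qed.

Lemma join_mono u w : cls u = cls w -> join cls cs ct u = join cls cs ct w.
Proof. by rewrite /join => ->. Qed.

Definition query_ok j := (Lam ct / Lam cs * offset cls j) * (Lam ct / Lam cs * offset cls j) == 1.

(** The query at [j = ct], where the offset is trivial, shows that the new element is an involution.
    The other queries say that its products with the offsets are involutions, which means
    commutation. A join multiplies some offsets by the new element. *)
Lemma elementary_join : elementary (offsets cls) -> (forall j, j <= l -> query_ok j) ->
  elementary (offsets (join cls cs ct)).
Proof.
move=> el q; set g := Lam ct / Lam cs.
have ctl : ct <= l by apply: (cls_le cl).
have g2 : g * g = 1.
  have := eqP (q ct ctl); rewrite /offset (cls_idem cl tl) mulgV mulg1.
  by [].
have cg z : offsets cls z -> commute g z.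
  case=> j jl ->; have o : offsets cls (offset cls j) by exists j.
  have [o2 _] := el _ _ o o.
  by apply: commute_involutions => //; apply/eqP/(q j jl).
have eg : elementary (fun z => z = g \/ offsets cls z).
  move=> x y [->|ox] [->|oy].
  - by split=> //; exact: commute_refl.
  - by split=> //; apply: cg.
  - by have [x2 _] := el _ _ ox ox; split=> //; apply/commute_sym/cg.
  - exact: el.
apply: sub_elementary (elementary_generated eg) => _ [j jl ->].
have oj : generated (fun z => z = g \/ offsets cls z) (offset cls j).
  by apply: generated_mem; right; exists j.
rewrite offset_join; case: ifP => _ //; apply: generated_mul oj _.
by apply: generated_mem; left.
Qed.

(** The new element and the offsets are generated by [D], so a failing query refutes every
    elementary set that contains [D]. *)
Lemma query_necessary (E : gT -> Prop) : elementary E -> (forall z, D z -> E z) ->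
  forall j, j <= l -> query_ok j.
Proof.
move=> eE DE j jl; apply/eqP.
have gE z : generated D z -> generated E z.
  by apply: generated_mono => y /DE; exact: generated_mem.
have h : generated E (Lam ct / Lam cs * offset cls j).
  by apply: generated_mul; apply: gE; [exact: join_gen | exact: (cls_gen cl)].
by have [] := elementary_generated eE h h.
Qed.

End Join.

Lemma offsets_generated cls s t : s <= l -> t <= l -> cls s = cls t ->
  generated (offsets cls) (Lam t / Lam s).
Proof.
move=> sl tl E; have -> : Lam t / Lam s = offset cls t * (offset cls s)^-1.
  by rewrite /offset invgF E divgKA.
by apply: generated_mul; [|apply: generated_inv]; apply: generated_mem; [exists t | exists s].
Qed.

End JoinClasses.

(** * Finding an Eulerian trail *)

Section Hierholzer.
Variables (gT : groupType) (G : lgraph gT) (a b : vert G).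
Implicit Types (u w : vert G) (x : garc G) (S O C : seq (garc G)).

Definition edges_of C := [seq x.1 | x <- C].

Definition incidences (e : edge G) w : nat := ((ends e).1 == w) + ((ends e).2 == w).

Definition degree_avoiding (U : seq (edge G)) w : nat :=
  \sum_(e | e \notin U) incidences e w.

Lemma incidences_arc x w : incidences x.1 w = (atail x == w) + (ahead x == w).
Proof. by case: x => e []; rewrite /incidences /atail /ahead //= addnC. Qed.

Lemma degree_avoiding_cons U e w : e \notin U ->
  degree_avoiding U w = incidences e w + degree_avoiding (e :: U) w.
Proof.
move=> eU; rewrite /degree_avoiding (bigD1 e) //=; congr (_ + _).
by apply: eq_bigl => f; rewrite inE negb_or andbC.
Qed.

Lemma degree_avoiding_perm U U' w : U =i U' -> degree_avoiding U w = degree_avoiding U' w.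
Proof. by move=> UU'; apply: eq_bigl => e; rewrite UU'. Qed.

Lemma degree_arcs w :
  degree_avoiding [::] w = size [seq x <- enum {: garc G} | atail x == w].
Proof.
rewrite size_filter -sum1_count big_enum_cond /=.
transitivity (\sum_(x : garc G) (atail x == w)).
  rewrite -(pair_bigA _ (fun e c => nat_of_bool (atail ((e, c) : garc G) == w))) /=.
  by apply: eq_bigr => e _; rewrite big_bool /incidences addnC.
by rewrite [RHS]big_mkcond; apply: eq_bigr => x _; case: eqP.
Qed.

Lemma walk_parity u C w z : walk u C w ->
  odd (\sum_(x <- C) incidences x.1 z) = (u == z) (+) (w == z).
Proof.
elim: C u => [|x C IH] u /=; first by move=> /eqP->; rewrite big_nil addbb.
case/andP=> /eqP<- /IH h; rewrite big_cons oddD h incidences_arc oddD !oddb.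
by do 3!case: (_ == _).
Qed.

Lemma eulerian_parity C w : eulerian_trail a C b ->
  odd (degree_avoiding [::] w) = (a == w) (+) (b == w).
Proof.
case/andP=> /andP[wC uC] /forallP aC; rewrite -(walk_parity w wC); congr odd.
rewrite -(big_map fst xpredT (fun e => incidences e w)) /=.
rewrite [RHS]big_uniq //=; by apply: eq_bigl => e; rewrite aC.
Qed.

Record hier (S O : seq (garc G)) (o : vert G) (rest : vert G -> seq (garc G)) : Prop := Hier {
  h_stack : walk a S (walk_end a S);
  h_out : walk o O b;
  h_uniq : uniq (edges_of (S ++ O));
  h_parity : forall w, odd (degree_avoiding (edges_of (S ++ O)) w) =
    (walk_end a S == w) (+) (o == w);
  h_scanned : forall x, x \notin rest (atail x) -> x.1 \in edges_of (S ++ O);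
  h_rest : forall w x, x \in rest w -> atail x = w;
  h_done : forall x, x \in O -> rest (ahead x) = [::]
}.

Definition set_rest (rest : vert G -> seq (garc G)) u r :=
  fun w => if w == u then r else rest w.

Lemma hier0 rest : (forall x, x \in rest (atail x)) ->
  (forall w x, x \in rest w -> atail x = w) ->
  (forall w, odd (degree_avoiding [::] w) = (a == w) (+) (b == w)) ->
  hier [::] [::] b rest.
Proof. by move=> h1 h2 h3; split=> //= x; rewrite h1. Qed.

Section Step.
Variables (S O : seq (garc G)) (o : vert G) (rest : vert G -> seq (garc G)).
Hypothesis I : hier S O o rest.
Local Notation top := (walk_end a S).

Lemma rest_scanned x r y : rest top = x :: r -> x.1 \in edges_of (S ++ O) ->
  y \notin set_rest rest top r (atail y) -> y.1 \in edges_of (S ++ O).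
Proof.
move=> rE xU; rewrite /set_rest; case: eqP => [yt|_]; last exact: (h_scanned I).
move=> yr; have [->//|yx] := eqVneq y x.
by apply: (h_scanned I); rewrite yt rE inE negb_or yx.
Qed.

Lemma hier_skip x r : rest top = x :: r -> x.1 \in edges_of (S ++ O) ->
  hier S O o (set_rest rest top r).
Proof.
move=> rE xU; case: (I) => h1 h2 h3 h4 h5 h6 h7; split=> //.
- by move=> y; apply: rest_scanned rE xU.
- move=> w y; rewrite /set_rest; case: eqP => [->|_]; last exact: h6.
  by move=> yr; apply: h6; rewrite rE inE yr orbT.
- move=> y yO; have := h7 y yO; rewrite /set_rest; case: eqP => // ->.
  by rewrite rE.
Qed.

Lemma hier_push x r : rest top = x :: r -> x.1 \notin edges_of (S ++ O) ->
  hier (rcons S x) O o (set_rest rest top r).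
Proof.
move=> rE xU; have xin : x \in rest top by rewrite rE mem_head.
have tx : atail x = top by apply: (h_rest I xin).
have E : edges_of (rcons S x ++ O) =i x.1 :: edges_of (S ++ O).
  by move=> e; rewrite /edges_of !map_cat map_rcons mem_cat mem_rcons !inE mem_cat -orbA.
have endS : walk_end a (rcons S x) = ahead x by rewrite /walk_end map_rcons last_rcons.
case: (I) => h1 h2 h3 h4 h5 h6 h7; split=> //.
- by rewrite endS walk_rcons tx h1 eqxx.
- rewrite -cats1 -catA cat1s /edges_of map_cat /= -cat1s uniq_catCA /=.
  by rewrite -map_cat xU h3.
- move=> w; rewrite endS (degree_avoiding_perm w E).
  have := h4 w; rewrite (degree_avoiding_cons w xU) oddD incidences_arc oddD !oddb tx.
  by case: (odd _); do 3!case: (_ == w).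
- move=> y; rewrite E inE; case: (eqVneq y x) => [-> _|yx]; first by rewrite eqxx.
  rewrite /set_rest; case: eqP => [yt|_] yr; rewrite h5 ?orbT //.
  by rewrite yt rE inE negb_or yx.
- move=> w y; rewrite /set_rest; case: eqP => [->|_]; last exact: h6.
  by move=> yr; apply: h6; rewrite rE inE yr orbT.
- move=> y yO; have := h7 y yO; rewrite /set_rest; case: eqP => // ->.
  by rewrite rE.
Qed.

(** All edges at the top vertex are used, so its remaining degree is 0, hence even, and parity
    forces [O] to start there. *)
Lemma hier_stuck : rest top = [::] -> o = top.
Proof.
move=> rE; have := h_parity I top; rewrite eqxx /degree_avoiding big1 /=.
  by case: eqP.
move=> e eU; apply/eqP; rewrite addn_eq0 !eqb0; apply/andP; split.
  apply: contra eU => /eqP te.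
  by have := @h_scanned _ _ _ _ I (e, false); rewrite /atail /= /arc_tail /= te rE; apply.
apply: contra eU => /eqP te.
by have := @h_scanned _ _ _ _ I (e, true); rewrite /atail /= /arc_tail /= te rE; apply.
Qed.

Lemma hier_pop S' x : S = rcons S' x -> rest top = [::] ->
  hier S' (x :: O) (walk_end a S') rest.
Proof.
move=> SE rE; have oE := hier_stuck rE.
have topE : top = ahead x by rewrite SE /walk_end map_rcons last_rcons.
have E : S' ++ x :: O = S ++ O by rewrite SE cat_rcons.
case: (I) => h1 h2 h3 h4 h5 h6 h7.
have [wS' tx] : walk a S' (walk_end a S') /\ atail x = walk_end a S'.
  have := h1; rewrite {1}SE walk_rcons => /andP[w _].
  by rewrite (walk_endE w).
split; rewrite ?E //.
- by rewrite /= tx eqxx -topE -oE.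
- by move=> w; rewrite h4 oE !addbb.
- by move=> y; rewrite inE => /predU1P[->|/h7//]; rewrite -topE.
Qed.

End Step.

(** Every vertex on [O] has an exhausted list, so its edges lie on [O]; by connectedness [O] reaches
    everything. *)
Lemma hier_end O o rest : connected_graph G ->
  hier [::] O o rest -> rest a = [::] -> eulerian_trail a O b.
Proof.
move=> cG I ra; have oE : o = a := hier_stuck I ra.
case: I => _ h2 h3 _ h5 _ h7; rewrite /= in h3 h5; rewrite oE in h2.
rewrite /eulerian_trail /trail h2 h3 /=.
have fin w : w \in a :: map (@ahead _ G) O -> rest w = [::].
  by rewrite inE => /predU1P[->//|/mapP[x /h7 rx ->]].
suff reach w : w \in a :: map (@ahead _ G) O.
  by apply/forallP => e; apply: (h5 (e, false)); rewrite fin.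
have /connectP[s ps ->] := cG a w.
have gen v : v \in a :: map (@ahead _ G) O -> path (adjacent_avoiding set0) v s ->
    last v s \in a :: map (@ahead _ G) O; last by apply: gen ps; rewrite mem_head.
elim: s v {ps} => //= u s IH v vin /andP[/existsP[x /and3P[_ /eqP tx /eqP hx]] ps].
apply: IH => //; have : x.1 \in edges_of O by apply: h5; rewrite tx fin.
case/mapP=> y yO xy; have [k1 k2] := walk_vertices h2 yO.
case: (arc_edge_eq xy) => xE; rewrite -hx xE ?ahead_rev //.
by rewrite inE k2 orbT.
Qed.

(** With more than one vertex, each vertex is the tail of one of the 2 m arcs. Loops over the
    vertices can thus be charged to the edges. *)
Lemma connected_card : connected_graph G -> #|vert G| <= (#|edge G|).*2.+1.
Proof.
move=> cG; have [|n1] := leqP #|vert G| 1; first by move/leq_trans; apply.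
have tailx w : exists x : garc G, atail x = w.
  have /card_gt0P[u] : 0 < #|[set~ w]| by rewrite cardsC1; case: #|vert G| n1 => [|[]].
  rewrite !inE => uw; have /connectP[[|v s] /= ps E] := cG w u; first by rewrite E eqxx in uw.
  by case/andP: ps => /existsP[x /and3P[_ /eqP tx _]] _; exists x.
have : #|vert G| <= #|{: garc G}|.
  rewrite -[#|vert G|]cardsT; have <- : (@atail _ G) @: [set: garc G] = [set: vert G].
    by apply/setP => w; rewrite inE; have [x <-] := tailx w; apply: imset_f; rewrite inE.
  by apply: leq_trans (leq_imset_card _ _) _; rewrite cardsT.
by rewrite card_prod card_bool muln2 => /leq_trans; apply.
Qed.

End Hierholzer.

Import GRing.Theory Num.Theory.

(** * A while language over natural numbers with arrays *)

(* Array 0 is the nonnegative part of the memory: it holds integers, and reading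
   it in an expression gives an absolute value.  Arrays 1 to 16 hold natural
   numbers. *)
Inductive expr :=
| Vr of nat
| Cn of nat
| Ad of expr & expr
| Sb of expr & expr
| Ar of nat & expr.

Inductive cmd :=
| Asg of nat & expr
| Sto of nat & expr & expr
| Cpy of bool & expr & expr     (* raw[e1] := raw[e2], negated if the flag is set *)
| Prt of expr
| PrtR of expr                  (* prints raw[e] *)
| Qry of nat & expr & expr      (* queries raw[e1], ..., raw[e1 + e2 - 1] *)
| Sq of cmd & cmd
| Ifc of expr & cmd & cmd
| Whl of expr & cmd.

Record astate := AState {
  vr : nat -> nat; ar : nat -> nat -> nat; rw : nat -> int; ou : seq int; tm : nat }.

(** [Nat.eqb] on numerals and the [Arguments] declarations let [/=] resolve lookups of concrete
    variables and arrays. *)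
Definition updv (f : nat -> nat) x v := fun y => if Nat.eqb y x then v else f y.
Definition upda (f : nat -> nat -> nat) c i v :=
  fun d => if Nat.eqb d c then fun j => if j == i then v else f c j else f d.
Arguments updv f x v y /.
Arguments upda f c i v d /.
Definition updr (f : nat -> int) i v := fun j => if j == i then v else f j.

Lemma updr_eq f i v : updr f i v i = v.
Proof. by rewrite /updr eqxx. Qed.

Lemma updr_neq f i v j : j != i -> updr f i v j = f j.
Proof. by rewrite /updr => /negPf->. Qed.

Definition tick k s := AState (vr s) (ar s) (rw s) (ou s) (tm s + k).
Definition setv s x v := AState (updv (vr s) x v) (ar s) (rw s) (ou s) (tm s + 1).
Definition seta s c i v := AState (vr s) (upda (ar s) c i v) (rw s) (ou s) (tm s + 1).
Definition setr s i v := AState (vr s) (ar s) (updr (rw s) i v) (ou s) (tm s + 1).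
Definition prt s z := AState (vr s) (ar s) (rw s) (rcons (ou s) z) (tm s + 1).

Fixpoint ev (s : astate) (e : expr) : nat :=
  match e with
  | Vr x => vr s x
  | Cn n => n
  | Ad a b => ev s a + ev s b
  | Sb a b => ev s a - ev s b
  | Ar 0 e => `|rw s (ev s e)|%N
  | Ar c.+1 e => ar s c.+1 (ev s e)
  end.

Section Semantics.
Variables (orc : seq int -> bool -> Prop) (phi : nat -> nat).

Inductive aexec : cmd -> astate -> astate -> Prop :=
| aexec_asg s x e : aexec (Asg x e) s (setv s x (ev s e))
| aexec_sto s c i e : aexec (Sto c i e) s (seta s c (ev s i) (ev s e))
| aexec_cpy s (b : bool) i j : aexec (Cpy b i j) s
    (setr s (ev s i) (if b then - rw s (ev s j) else rw s (ev s j))%R)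
| aexec_prt s e : aexec (Prt e) s (prt s (Posz (ev s e)))
| aexec_prtr s e : aexec (PrtR e) s (prt s (rw s (ev s e)))
| aexec_qry s x p l (r : bool) :
    orc [seq rw s (ev s p + j) | j <- iota 0 (ev s l)] r ->
    aexec (Qry x p l) s (tick (phi (ev s l)) (setv s x r))
| aexec_seq c1 c2 s1 s2 s3 : aexec c1 s1 s2 -> aexec c2 s2 s3 ->
    aexec (Sq c1 c2) s1 s3
| aexec_if_true e c1 c2 s s' : 0 < ev s e -> aexec c1 (tick 1 s) s' ->
    aexec (Ifc e c1 c2) s s'
| aexec_if_false e c1 c2 s s' : ev s e = 0 -> aexec c2 (tick 1 s) s' ->
    aexec (Ifc e c1 c2) s s'
| aexec_while_true e c s1 s2 s3 : 0 < ev s1 e -> aexec c (tick 1 s1) s2 ->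
    aexec (Whl e c) s2 s3 -> aexec (Whl e c) s1 s3
| aexec_while_false e c s : ev s e = 0 -> aexec (Whl e c) s (tick 1 s).

Lemma aexec_tm c s s' : aexec c s s' -> tm s <= tm s'.
Proof. by elim=> {c s s'} //= *; lia. Qed.

(** The existential demands a terminating run, so this expresses total correctness; the tick counter
    of the final state lets [Q] bound the running time. *)
Definition wp c (Q : astate -> Prop) s := exists s', aexec c s s' /\ Q s'.

Lemma wp_asg x e (Q : astate -> Prop) s : Q (setv s x (ev s e)) -> wp (Asg x e) Q s.
Proof. by move=> h; eexists; split; [exact: aexec_asg|]. Qed.

Lemma wp_sto c i e (Q : astate -> Prop) s : Q (seta s c (ev s i) (ev s e)) -> wp (Sto c i e) Q s.
Proof. by move=> h; eexists; split; [exact: aexec_sto|]. Qed.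

Lemma wp_cpy (b : bool) i j (Q : astate -> Prop) s :
  Q (setr s (ev s i) (if b then - rw s (ev s j) else rw s (ev s j))%R) -> wp (Cpy b i j) Q s.
Proof. by move=> h; eexists; split; [exact: aexec_cpy|]. Qed.

Lemma wp_prt e (Q : astate -> Prop) s : Q (prt s (Posz (ev s e))) -> wp (Prt e) Q s.
Proof. by move=> h; eexists; split; [exact: aexec_prt|]. Qed.

Lemma wp_prtr e (Q : astate -> Prop) s : Q (prt s (rw s (ev s e))) -> wp (PrtR e) Q s.
Proof. by move=> h; eexists; split; [exact: aexec_prtr|]. Qed.

Lemma wp_qry x p l (r : bool) (Q : astate -> Prop) s :
  orc [seq rw s (ev s p + j) | j <- iota 0 (ev s l)] r ->
  Q (tick (phi (ev s l)) (setv s x r)) -> wp (Qry x p l) Q s.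
Proof. by move=> o h; eexists; split; [exact: aexec_qry o|]. Qed.

Lemma wp_seq c1 c2 (Q : astate -> Prop) s : wp c1 (wp c2 Q) s -> wp (Sq c1 c2) Q s.
Proof.
case=> s2 [h1 [s3 [h2 Qs]]]; exists s3; split=> //; exact: aexec_seq h1 h2.
Qed.

Lemma wp_if e c1 c2 (Q : astate -> Prop) s :
  (0 < ev s e -> wp c1 Q (tick 1 s)) -> (ev s e = 0 -> wp c2 Q (tick 1 s)) ->
  wp (Ifc e c1 c2) Q s.
Proof.
move=> h1 h2; have [h|h] := posnP (ev s e).
  by have [s' [hs Qs]] := h2 h; exists s'; split=> //; apply: aexec_if_false.
by have [s' [hs Qs]] := h1 h; exists s'; split=> //; apply: aexec_if_true.
Qed.

Lemma wp_conseq c (Q Q' : astate -> Prop) s :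
  wp c Q s -> (forall s', Q s' -> Q' s') -> wp c Q' s.
Proof. by case=> s' [h Qs] QQ'; exists s'; split=> //; apply: QQ'. Qed.

(* Termination comes for free from the time bound in the invariant. *)
Lemma wp_while B (I : astate -> Prop) e c (Q : astate -> Prop) s :
  I s -> (forall s, I s -> tm s <= B) ->
  (forall s, I s -> 0 < ev s e -> wp c I (tick 1 s)) ->
  (forall s, I s -> ev s e = 0 -> Q (tick 1 s)) ->
  wp (Whl e c) Q s.
Proof.
move=> Is tB body exit; have [n] := ubnP (B - tm s); elim: n s Is => // n IH s Is sn.
case: (posnP (ev s e)) => he.
  by eexists; split; [exact: aexec_while_false | exact: exit].
have [s' [hs Is']] := body s Is he; have := aexec_tm hs; rewrite /= => tms.
have [|s3 [h3 Q3]] := IH s' Is'; first by have := tB _ Is; have := tB _ Is'; lia.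
by exists s3; split=> //; exact: aexec_while_true he hs h3.
Qed.

Fixpoint modv c : seq nat :=
  match c with
  | Asg x _ | Qry x _ _ => [:: x]
  | Sq c1 c2 | Ifc _ c1 c2 => modv c1 ++ modv c2
  | Whl _ c => modv c
  | _ => [::]
  end.

Fixpoint moda c : seq nat :=
  match c with
  | Sto x _ _ => [:: x]
  | Sq c1 c2 | Ifc _ c1 c2 => moda c1 ++ moda c2
  | Whl _ c => moda c
  | _ => [::]
  end.

Fixpoint modr c : bool :=
  match c with
  | Cpy _ _ _ => true
  | Sq c1 c2 | Ifc _ c1 c2 => modr c1 || modr c2
  | Whl _ c => modr c
  | _ => false
  end.

Fixpoint modo c : bool :=
  match c with
  | Prt _ | PrtR _ => true
  | Sq c1 c2 | Ifc _ c1 c2 => modo c1 || modo c2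
  | Whl _ c => modo c
  | _ => false
  end.

(** A frame condition read off from the syntax; it spares the specifications from listing data that
    a command leaves alone. *)
Definition keeps c s s' : Prop :=
  [/\ forall x, x \notin modv c -> vr s' x = vr s x,
      forall x, x \notin moda c -> ar s' x = ar s x,
      ~~ modr c -> rw s' = rw s
    & ~~ modo c -> ou s' = ou s].

Lemma Nat_eqbE x y : Nat.eqb x y = (x == y).
Proof. by apply/idP/eqP => [/PeanoNat.Nat.eqb_eq|->]; rewrite ?PeanoNat.Nat.eqb_refl. Qed.

Lemma aexec_keeps c s s' : aexec c s s' -> keeps c s s'.
Proof.
elim=> {c s s'} /=; rewrite /keeps /=.
- by move=> s x e; split=> // y; rewrite inE /updv Nat_eqbE => /negPf->.
- by move=> s c i e; split=> // y; rewrite inE /upda Nat_eqbE => /negPf->.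
- by move=> s b i j; split.
- by move=> s e; split.
- by move=> s e; split.
- by move=> s x p l r _; split=> // y; rewrite inE /updv Nat_eqbE => /negPf->.
- move=> c1 c2 s1 s2 s3 _ [v1 a1 r1 o1] _ [v2 a2 r2 o2]; split.
  + by move=> x; rewrite mem_cat negb_or => /andP[/v1<- /v2].
  + by move=> x; rewrite mem_cat negb_or => /andP[/a1<- /a2].
  + by rewrite negb_or => /andP[/r1<- /r2].
  + by rewrite negb_or => /andP[/o1<- /o2].
- move=> e c1 c2 s s' _ _ [v1 a1 r1 o1]; split.
  + by move=> x; rewrite mem_cat negb_or => /andP[/v1].
  + by move=> x; rewrite mem_cat negb_or => /andP[/a1].
  + by rewrite negb_or => /andP[/r1].
  + by rewrite negb_or => /andP[/o1].
- move=> e c1 c2 s s' _ _ [v1 a1 r1 o1]; split.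
  + by move=> x; rewrite mem_cat negb_or => /andP[_ /v1].
  + by move=> x; rewrite mem_cat negb_or => /andP[_ /a1].
  + by rewrite negb_or => /andP[_ /r1].
  + by rewrite negb_or => /andP[_ /o1].
- move=> e c s1 s2 s3 _ _ [v1 a1 r1 o1] _ [v2 a2 r2 o2]; split.
  + by move=> x h; rewrite v2 ?v1.
  + by move=> x h; rewrite a2 ?a1.
  + by move=> h; rewrite r2 ?r1.
  + by move=> h; rewrite o2 ?o1.
- by move=> e c s _; split.
Qed.

Lemma wp_keeps c Q s : wp c Q s -> wp c (fun s' => Q s' /\ keeps c s s') s.
Proof. by case=> s' [h Qs]; exists s'; do !split=> //; have [] := aexec_keeps h. Qed.

(** * Compilation *)

(* Variable x lives in register 2 x + 1, the even registers hold intermediate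
   values; entry j of array c > 0 lives at the address - (16 j + c). *)
Definition nop d := Const d 0.

(** Four doublings replace the multiplication by 16, which the machine does not offer. *)
Definition array_address d c : prog :=
  Seq (Add d.*2 d.*2 d.*2) (Seq (Add d.*2 d.*2 d.*2) (Seq (Add d.*2 d.*2 d.*2)
  (Seq (Add d.*2 d.*2 d.*2) (Seq (Const d.+1.*2 (- Posz c)%R)
  (Defs.Sub d.*2 d.+1.*2 d.*2))))).

(** The value is left in register [2 d]; even registers below it hold pending operands and are not
    touched, as recorded by [low_regs]. Truncation and absolute value are obtained from the test for
    positivity. *)
Fixpoint cexpr d e : prog :=
  match e with
  | Vr x => Seq (Const d.*2 0) (Add d.*2 d.*2 x.*2.+1)
  | Cn n => Const d.*2 (Posz n)
  | Ad a b => Seq (cexpr d a) (Seq (cexpr d.+1 b) (Add d.*2 d.*2 d.+1.*2))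
  | Sb a b => Seq (cexpr d a) (Seq (cexpr d.+1 b) (Seq (Defs.Sub d.*2 d.*2 d.+1.*2)
                (If d.*2 (nop d.+1.*2) (Const d.*2 0))))
  | Ar 0 e => Seq (cexpr d e) (Seq (Read d.*2 d.*2)
                (If d.*2 (nop d.+1.*2) (Seq (Const d.+1.*2 0) (Defs.Sub d.*2 d.+1.*2 d.*2))))
  | Ar c.+1 e => Seq (cexpr d e) (Seq (array_address d c.+1) (Read d.*2 d.*2))
  end.

Fixpoint cexpr_time e : nat :=
  match e with
  | Vr _ => 2
  | Cn _ => 1
  | Ad a b => cexpr_time a + cexpr_time b + 1
  | Sb a b => cexpr_time a + cexpr_time b + 3
  | Ar _ e => cexpr_time e + 7
  end.

Fixpoint expr_ok e : bool :=
  match e with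
  | Vr _ | Cn _ => true
  | Ad a b | Sb a b => expr_ok a && expr_ok b
  | Ar c e => (c <= 16) && expr_ok e
  end.

Definition represents (a : astate) (s : state) : Prop :=
  [/\ forall x, reg s x.*2.+1 = Posz (vr a x),
      forall j, Defs.mem s (Posz j) = rw a j,
      forall c j, 0 < c <= 16 -> Defs.mem s (- Posz (16 * j + c))%R = Posz (ar a c j)
    & out s = ou a].

Definition low_regs d (s s' : state) := forall x, x < d -> reg s' x.*2 = reg s x.*2.

Lemma upd_eq (A : eqType) (B : Type) (f : A -> B) x v : upd f x v x = v.
Proof. by rewrite /upd eqxx. Qed.

Lemma upd_neq (A : eqType) (B : Type) (f : A -> B) x v y : y != x -> upd f x v y = f y.
Proof. by rewrite /upd => /negPf->. Qed.

Lemma represents_set_even a s d v : represents a s -> represents a (set_reg s d.*2 v).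
Proof.
case=> h1 h2 h3 h4; split=> //= x; rewrite upd_neq //; apply/eqP => E.
by have := congr1 odd E; rewrite /= !odd_double.
Qed.

Lemma array_address_exec a s d c j : represents a s -> reg s d.*2 = Posz j ->
  exists s', [/\ exec orc phi (array_address d c) s 6 s', represents a s',
    reg s' d.*2 = (- Posz (16 * j + c))%R & low_regs d s s'].
Proof.
move=> Rs hd; eexists; split.
- by rewrite (_ : 6 = 1 + (1 + (1 + (1 + (1 + 1)))))%N //; do !(apply: exec_seq; first constructor); constructor.
- by do 6!apply: represents_set_even.
- have dd : d.+1.*2 != d.*2 by rewrite doubleS; lia.
  have dd' : d.*2 != d.+1.*2 by rewrite doubleS; lia.
  by rewrite /= !upd_eq !(upd_neq _ _ dd') !upd_eq hd; lia.
- move=> x xd /=; by rewrite !upd_neq; lia.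
Qed.

Lemma low_regs_trans d s1 s2 s3 : low_regs d s1 s2 -> low_regs d s2 s3 -> low_regs d s1 s3.
Proof. by move=> h1 h2 x xd; rewrite h2 ?h1. Qed.

Lemma low_regsW d d' s s' : d' <= d -> low_regs d s s' -> low_regs d' s s'.
Proof. by move=> dd h x xd; apply: h; apply: leq_trans xd dd. Qed.

Lemma low_regs_set d d' s v : d <= d' -> low_regs d s (set_reg s d'.*2 v).
Proof. by move=> dd x xd; rewrite /= upd_neq //; lia. Qed.

Lemma cexpr_exec a e : expr_ok e -> forall d s, represents a s ->
  exists t s', [/\ exec orc phi (cexpr d e) s t s', t <= cexpr_time e,
    represents a s', reg s' d.*2 = Posz (ev a e) & low_regs d s s'].
Proof.
elim: e => [x|n|e1 IH1 e2 IH2|e1 IH1 e2 IH2|c e IH] /=.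
- move=> _ d s Rs; do 2!eexists; split.
  + by apply: exec_seq; constructor.
  + by [].
  + by do 2!apply: represents_set_even.
  + have [h _ _ _] := Rs; rewrite /= !upd_eq upd_neq ?h ?add0r //.
    by apply/eqP => E; have := congr1 odd E; rewrite /= !odd_double.
  + apply: low_regs_trans (low_regs_set _ _ _) => //.
    exact: low_regs_set.
- move=> _ d s Rs; do 2!eexists; split; [by constructor|by []| | |].
  + exact: represents_set_even.
  + by rewrite /= upd_eq.
  + exact: low_regs_set.
- case/andP=> ok1 ok2 d s Rs.
  have [t1 [s1 [ex1 tt1 R1 v1 l1]]] := IH1 ok1 d s Rs.
  have [t2 [s2 [ex2 tt2 R2 v2 l2]]] := IH2 ok2 d.+1 s1 R1.
  do 2!eexists; split.
  + by apply: exec_seq ex1 _; apply: exec_seq ex2 _; constructor.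
  + by clear -tt1 tt2; lia.
  + exact: represents_set_even.
  + by rewrite /= upd_eq v2 l2 // v1.
  + apply: low_regs_trans (low_regs_set _ _ (leqnn d)).
    by apply: low_regs_trans l1 _; apply: low_regsW l2.
- case/andP=> ok1 ok2 d s Rs.
  have [t1 [s1 [ex1 tt1 R1 v1 l1]]] := IH1 ok1 d s Rs.
  have [t2 [s2 [ex2 tt2 R2 v2 l2]]] := IH2 ok2 d.+1 s1 R1.
  pose s3 := set_reg s2 d.*2 (Posz (ev a e1) - Posz (ev a e2))%R.
  have ex3 : exec orc phi (Defs.Sub d.*2 d.*2 d.+1.*2) s2 1 s3.
    by rewrite /s3 -v1 -v2 -l2 //; constructor.
  have R3 : represents a s3 by apply: represents_set_even.
  have l3 : low_regs d s s3.
    apply: low_regs_trans (low_regs_set _ _ (leqnn d)).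
    by apply: low_regs_trans l1 _; apply: low_regsW l2.
  have v3 : reg s3 d.*2 = (Posz (ev a e1) - Posz (ev a e2))%R by rewrite /= upd_eq.
  have [le|lt] := leqP (ev a e1) (ev a e2).
    do 2!eexists; split.
    + apply: exec_seq ex1 _; apply: exec_seq ex2 _; apply: exec_seq ex3 _.
      by apply: exec_if_false; last constructor; rewrite v3; clear -le; lia.
    + by clear -tt1 tt2; lia.
    + exact: represents_set_even.
    + by rewrite /= upd_eq (eqP (le : _ - _ == 0)).
    + by apply: low_regs_trans l3 _; apply: low_regs_set.
  do 2!eexists; split.
  + apply: exec_seq ex1 _; apply: exec_seq ex2 _; apply: exec_seq ex3 _.
    by apply: exec_if_true; last constructor; rewrite v3; clear -lt; lia.
  + by clear -tt1 tt2; lia.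
  + exact: represents_set_even.
  + rewrite /= upd_neq ?upd_eq; last by rewrite doubleS; lia.
    by clear -lt; lia.
  + by apply: low_regs_trans l3 _; apply: low_regs_set.
- case/andP=> c16 ok d s Rs; have [t1 [s1 [ex1 tt1 R1 v1 l1]]] := IH ok d s Rs.
  have dd : d.+1.*2 != d.*2 by rewrite doubleS; lia.
  have dd' : d.*2 != d.+1.*2 by rewrite doubleS; lia.
  case: c c16 => [_|c c16] /=; last first.
    have [s2 [ex2 R2 v2 l2]] := array_address_exec c.+1 R1 v1.
    do 2!eexists; split.
    + by apply: exec_seq ex1 _; apply: exec_seq ex2 _; constructor.
    + by clear -tt1; lia.
    + exact: represents_set_even.
    + by have [_ _ h _] := R2; rewrite /= upd_eq v2 h.
    + apply: low_regs_trans (low_regs_set _ _ (leqnn d)).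
      exact: low_regs_trans l1 _.
  pose s2 := set_reg s1 d.*2 (rw a (ev a e)).
  have ex2 : exec orc phi (Read d.*2 d.*2) s1 1 s2.
    by have [_ h _ _] := R1; rewrite /s2 -h -v1; constructor.
  have R2 : represents a s2 by apply: represents_set_even.
  have v2 : reg s2 d.*2 = rw a (ev a e) by rewrite /= upd_eq.
  have l2 : low_regs d s s2 by apply: low_regs_trans l1 _; apply: low_regs_set.
  have [le|lt] := lerP (rw a (ev a e)) 0.
    do 2!eexists; split.
    + apply: exec_seq ex1 _; apply: exec_seq ex2 _.
      apply: exec_if_false; first by rewrite v2.
      by apply: exec_seq; constructor.
    + by clear -tt1; lia.
    + by do 2!apply: represents_set_even.
    + rewrite /= !upd_eq !(upd_neq _ _ dd') !upd_eq.
      by clear -le; lia.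
    + apply: low_regs_trans l2 _; apply: low_regs_trans (low_regs_set _ _ (leqnn d)).
      exact: low_regs_set.
  do 2!eexists; split.
  + apply: exec_seq ex1 _; apply: exec_seq ex2 _.
    by apply: exec_if_true; [rewrite v2 | constructor].
  + by clear -tt1; lia.
  + exact: represents_set_even.
  + by rewrite /= !(upd_neq _ _ dd') !upd_eq; clear -lt; lia.
  + by apply: low_regs_trans l2 _; apply: low_regs_set.
Qed.

Fixpoint compile c : prog :=
  match c with
  | Asg x e => Seq (cexpr 0 e) (Seq (Const 2 0) (Add x.*2.+1 0 2))
  | Sto c i e => Seq (cexpr 0 i) (Seq (array_address 0 c)
                   (Seq (cexpr 1 e) (Write 0 2)))
  | Cpy b i j => Seq (cexpr 0 i) (Seq (cexpr 1 j) (Seq (Read 2 2)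
      (Seq (Const 4 0) (Seq (if b then Defs.Sub 2 4 2 else Add 2 4 2) (Write 0 2)))))
  | Prt e => Seq (cexpr 0 e) (Print 0)
  | PrtR e => Seq (cexpr 0 e) (Seq (Read 0 0) (Print 0))
  | Qry x p l => Seq (cexpr 0 p) (Seq (cexpr 1 l) (Query x.*2.+1 0 2))
  | Sq c1 c2 => Seq (compile c1) (compile c2)
  | Ifc e c1 c2 => Seq (cexpr 0 e) (If 0 (compile c1) (compile c2))
  | Whl e c => Seq (cexpr 0 e) (While 0 (Seq (compile c) (cexpr 0 e)))
  end.

(** A factor rather than a running time: a run of [c] that adds [k] ticks takes at most
    [compile_time c * k] machine steps. This works because elementary commands, tests and loop
    passes all tick, which pays for evaluating their expressions. *)
Fixpoint compile_time c : nat :=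
  match c with
  | Asg _ e => cexpr_time e + 2
  | Sto _ i e | Cpy _ i e => cexpr_time i + cexpr_time e + 7
  | Prt e => cexpr_time e + 1
  | PrtR e => cexpr_time e + 2
  | Qry _ p l => cexpr_time p + cexpr_time l + 1
  | Sq c1 c2 => compile_time c1 + compile_time c2
  | Ifc e c1 c2 => cexpr_time e + 1 + compile_time c1 + compile_time c2
  | Whl e c => (cexpr_time e + 1).*2 + compile_time c
  end.

Fixpoint cmd_ok c : bool :=
  match c with
  | Asg _ e | Prt e | PrtR e => expr_ok e
  | Sto c i e => [&& 0 < c, c <= 16, expr_ok i & expr_ok e]
  | Cpy _ p l | Qry _ p l => expr_ok p && expr_ok l
  | Sq c1 c2 => cmd_ok c1 && cmd_ok c2
  | Ifc e c1 c2 => [&& expr_ok e, cmd_ok c1 & cmd_ok c2]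
  | Whl e c => expr_ok e && cmd_ok c
  end.

Lemma represents_set_odd a s x (v : nat) : represents a s ->
  represents (setv a x v) (set_reg s x.*2.+1 (Posz v)).
Proof.
case=> h1 h2 h3 h4; split=> //= y; rewrite /upd /updv Nat_eqbE eqSS.
by rewrite -[y.*2 == x.*2]/(_ == _) (inj_eq double_inj); case: eqP.
Qed.

Lemma represents_tick a s k : represents a s -> represents (tick k a) s.
Proof. by []. Qed.

Lemma represents_seta a s c i v : 0 < c <= 16 -> represents a s ->
  represents (seta a c i v)
    (State (reg s) (upd (Defs.mem s) (- Posz (16 * i + c))%R (Posz v)) (out s)).
Proof.
move=> cc [h1 h2 h3 h4]; split=> //= [j|c' j cc'].
  by rewrite upd_neq ?h2 //; clear -cc; lia.
rewrite /upd /upda Nat_eqbE.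
have -> : ((- Posz (16 * j + c') == - Posz (16 * i + c))%R = (c' == c) && (j == i)).
  by clear -cc cc'; lia.
by case: eqP => [->|_] /=; [case: eqP => // _ | ]; rewrite h3.
Qed.

Lemma represents_setr a s i v : represents a s ->
  represents (setr a i v) (State (reg s) (upd (Defs.mem s) (Posz i) v) (out s)).
Proof.
case=> h1 h2 h3 h4; split=> //= [j|c j cc]; last first.
  by rewrite upd_neq ?h3 //; clear -cc; lia.
rewrite /upd /updr; have -> : ((Posz j == Posz i) = (j == i)) by [].
by case: eqP.
Qed.

Lemma represents_prt a s z : represents a s ->
  represents (prt a z) (State (reg s) (Defs.mem s) (rcons (out s) z)).
Proof. by case=> h1 h2 h3 h4; split=> //=; rewrite h4. Qed.

Lemma compile_exec c a a' : aexec c a a' -> cmd_ok c -> forall s, represents a s ->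
  exists t s', [/\ exec orc phi (compile c) s t s', represents a' s'
    & t + compile_time c * tm a <= compile_time c * tm a'].
Proof.
elim=> {c a a'} /=.
- move=> a x e ok s Rs; have [t [s1 [ex1 tt1 R1 v1 _]]] := cexpr_exec ok 0 Rs.
  do 2!eexists; split; [by apply: exec_seq ex1 _; apply: exec_seq; constructor| |by rewrite mulnDr muln1 addnC leq_add2l; exact: (leq_add tt1 (leqnn 2))].
  rewrite /= upd_neq // v1 upd_eq addr0; apply: represents_set_odd.
  exact: (represents_set_even 1).
- move=> a c i e /and4P[c0 c16 ok1 ok2] s Rs.
  have [t [s1 [ex1 tt1 R1 v1 _]]] := cexpr_exec ok1 0 Rs.
  have [s2 [ex2 R2 v2 l2]] := array_address_exec c R1 v1.
  have [t3 [s3 [ex3 tt3 R3 v3 l3]]] := cexpr_exec ok2 1 R2.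
  do 2!eexists; split.
  + by apply: exec_seq ex1 _; apply: exec_seq ex2 _; apply: exec_seq ex3 _; constructor.
  + have := l3 0 isT => /= ->; rewrite -[0]/(0.*2) v2 -[2]/(1.*2) v3.
    by apply: represents_seta; rewrite // c0.
  + by rewrite mulnDr muln1 addnC leq_add2l; clear -tt1 tt3; lia.
- move=> a b i j /andP[ok1 ok2] s Rs.
  have [t [s1 [ex1 tt1 R1 v1 _]]] := cexpr_exec ok1 0 Rs.
  have [t2 [s2 [ex2 tt2 R2 v2 l2]]] := cexpr_exec ok2 1 R1.
  have l20 := l2 0 isT; rewrite /= in l20 v1 v2.
  pose s3 := set_reg s2 2 (rw a (ev a j)).
  have ex3 : exec orc phi (Read 2 2) s2 1 s3.
    by have [_ h _ _] := R2; rewrite /s3 -h -v2; constructor.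
  pose s4 := set_reg s3 4 0%R.
  pose s5 := set_reg s4 2 (if b then - rw a (ev a j) else rw a (ev a j))%R.
  have ex5 : exec orc phi (if b then Defs.Sub 2 4 2 else Add 2 4 2) s4 1 s5.
    rewrite /s5; case: (b).
      have -> : (- rw a (ev a j) = reg s4 4 - reg s4 2)%R by rewrite /= /upd /= sub0r.
      by constructor.
    have -> : (rw a (ev a j) = reg s4 4 + reg s4 2)%R by rewrite /= /upd /= add0r.
    by constructor.
  have R5 : represents a s5.
    by apply: (represents_set_even 1); apply: (represents_set_even 2); apply: (represents_set_even 1).
  do 2!eexists; split.
  + apply: exec_seq ex1 _; apply: exec_seq ex2 _; apply: exec_seq ex3 _.
    by apply: exec_seq; [constructor|]; apply: exec_seq ex5 _; constructor.
  + have -> : reg s5 0 = Posz (ev a i) by rewrite /= /upd /= l20 v1.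
    have -> : reg s5 2 = (if b then - rw a (ev a j) else rw a (ev a j))%R by rewrite /= upd_eq.
    exact: represents_setr.
  + by rewrite mulnDr muln1 addnC leq_add2l; clear -tt1 tt2; lia.
- move=> a e ok s Rs; have [t [s1 [ex1 tt1 R1 v1 _]]] := cexpr_exec ok 0 Rs.
  do 2!eexists; split; [by apply: exec_seq ex1 _; constructor| |by rewrite mulnDr muln1 addnC leq_add2l; exact: (leq_add tt1 (leqnn 1))].
  by rewrite -[0]/(0.*2) v1; apply: represents_prt.
- move=> a e ok s Rs; have [t [s1 [ex1 tt1 R1 v1 _]]] := cexpr_exec ok 0 Rs.
  do 2!eexists; split; [by apply: exec_seq ex1 _; apply: exec_seq; constructor| |by rewrite mulnDr muln1 addnC leq_add2l; exact: (leq_add tt1 (leqnn 2))].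
  rewrite /= upd_eq -[reg s1 0]/(reg s1 0.*2) v1; have [_ -> _ _] := R1.
  exact: (@represents_prt a (set_reg s1 0 (rw a (ev a e))) _ (@represents_set_even a s1 0 _ R1)).
- move=> a x p l r orq /andP[ok1 ok2] s Rs.
  have [t [s1 [ex1 tt1 R1 v1 _]]] := cexpr_exec ok1 0 Rs.
  have [t2 [s2 [ex2 tt2 R2 v2 l2]]] := cexpr_exec ok2 1 R1.
  have l20 := l2 0 isT; rewrite /= in l20 v1 v2.
  do 2!eexists; split.
  + apply: exec_seq ex1 _; apply: exec_seq ex2 _; apply: (@exec_query orc phi _ _ _ _ (ev a l) r) => //.
    rewrite l20 v1; have [_ h _ _] := R2.
    by rewrite (eq_map (g := fun j => rw a (ev a p + j))) // => j; rewrite -h PoszD.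
  + by apply: represents_tick; apply: represents_set_odd.
  + rewrite -(addnA (tm a)) mulnDr addnC leq_add2l.
    by clear -tt1 tt2; nia.
- move=> c1 c2 a1 a2 a3 ae1 IH1 ae2 IH2 /andP[ok1 ok2] s Rs.
  have [t1 [s1 [ex1 R1 tt1]]] := IH1 ok1 s Rs.
  have [t2 [s2 [ex2 R2 tt2]]] := IH2 ok2 s1 R1.
  exists (t1 + t2), s2; split=> //; first exact: exec_seq ex1 ex2.
  have h1 := leq_mul (leqnn (compile_time c2)) (aexec_tm ae1).
  have h2 := leq_mul (leqnn (compile_time c1)) (aexec_tm ae2).
  by clear -tt1 tt2 h1 h2; lia.
- move=> e c1 c2 a1 a2 h ae1 IH1 /and3P[ok ok1 ok2] s Rs.
  have [t [s1 [ex1 tt1 R1 v1 _]]] := cexpr_exec ok 0 Rs; rewrite /= in v1.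
  have [t2 [s2 [ex2 R2 tt2]]] := IH1 ok1 s1 (represents_tick 1 R1).
  do 2!eexists; split; [|exact: R2|].
    by apply: exec_seq ex1 _; apply: exec_if_true ex2; rewrite v1.
  have := aexec_tm ae1; rewrite /= in tt2 * => tle.
  have h1 := leq_mul (leqnn (compile_time c2)) tle.
  have h2 := leq_mul (leqnn (cexpr_time e + 1)) tle.
  by clear -tt1 tt2 h1 h2; lia.
- move=> e c1 c2 a1 a2 h ae1 IH1 /and3P[ok ok1 ok2] s Rs.
  have [t [s1 [ex1 tt1 R1 v1 _]]] := cexpr_exec ok 0 Rs; rewrite /= in v1.
  have [t2 [s2 [ex2 R2 tt2]]] := IH1 ok2 s1 (represents_tick 1 R1).
  do 2!eexists; split; [|exact: R2|].
    by apply: exec_seq ex1 _; apply: exec_if_false ex2; rewrite v1 h.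
  have := aexec_tm ae1; rewrite /= in tt2 * => tle.
  have h1 := leq_mul (leqnn (compile_time c1)) tle.
  have h2 := leq_mul (leqnn (cexpr_time e + 1)) tle.
  by clear -tt1 tt2 h1 h2; lia.
- move=> e c a1 a2 a3 h ae1 IH1 ae2 IH2 /andP[ok ok1] s Rs.
  have [t [s1 [ex1 tt1 R1 v1 _]]] := cexpr_exec ok 0 Rs; rewrite /= in v1.
  have [t2 [s2 [ex2 R2 tt2]]] := IH1 ok1 s1 (represents_tick 1 R1).
  have okw : expr_ok e && cmd_ok c by rewrite ok.
  have [t3 [s3 [ex3 R3 tt3]]] := IH2 okw s2 R2.
  (* The run given by induction begins with the evaluation of the guard, which in the compiled loop
     is the tail of the body; it is split off and regrouped with the first pass. *)
  inversion ex3 as [| | | | | | |P Q' sa sb sc ta tb exa exb| | | |]; subst.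
  do 2!eexists; split; [|exact: R3|].
    apply: exec_seq ex1 _; apply: exec_while_true exb; first by rewrite v1.
    exact: exec_seq ex2 exa.
  have := aexec_tm ae1; rewrite /= in tt2 tt3 * => tle.
  have h2 := leq_mul (leqnn (cexpr_time e + 1)) tle.
  by clear -tt1 tt2 tt3 h2; lia.
- move=> e c a h /andP[ok ok1] s Rs.
  have [t [s1 [ex1 tt1 R1 v1 _]]] := cexpr_exec ok 0 Rs; rewrite /= in v1.
  do 2!eexists; split; [|exact: (represents_tick 1 R1)|].
    by apply: exec_seq ex1 _; apply: exec_while_false; rewrite v1 h.
  by rewrite /= mulnDr muln1 addnC leq_add2l; clear -tt1; lia.
Qed.

End Semantics.

(** * The program *)

Notation "c1 ;; c2" := (Sq c1 c2) (at level 90, right associativity).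
Notation "x <~ e" := (Asg x e) (at level 85).
Notation "$ x" := (Vr x) (at level 2, x at level 0).
Notation "e1 [+] e2" := (Ad e1 e2) (at level 50, left associativity).
Notation "e1 [-] e2" := (Sb e1 e2) (at level 50, left associativity).

Notation xn := 0. Notation xm := 1. Notation xa := 2. Notation xb := 3.
Notation xcur := 4. Notation xv := 5. Notation xdeg := 6. Notation xbad := 7.
Notation xq := 8. Notation xsp := 9. Notation xoc := 10. Notation xgo := 11.
Notation xp := 12. Notation xi := 13. Notation xlen := 14. Notation xl := 15.
Notation xwb := 16. Notation xqb := 17. Notation xj := 18. Notation xr := 19.
Notation xsrc := 20. Notation xdst := 21. Notation xcnt := 22. Notation xoff := 23.
Notation xo := 24. Notation xcs := 25. Notation xct := 26. Notation xcj := 27.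
Notation xe := 28. Notation xw := 29.
Notation RAW := 0. Notation PTR := 1. Notation REM := 2. Notation USED := 3.
Notation SV := 4. Notation SA := 5. Notation TR := 6. Notation PV := 7.
Notation LEN := 8. Notation FST := 9. Notation LST := 10. Notation ST := 11.
Notation ML := 12. Notation PAR := 13. Notation REP := 14. Notation CLS := 15.

Definition Eqe e1 e2 := Cn 1 [-] ((e1 [-] e2) [+] (e2 [-] e1)).
Definition Xor e1 e2 := (e1 [-] e2) [+] (e2 [-] e1).
Definition skip := xr <~ Cn 0.

(** A record consists of edge, orientation, head, word length and word, whence the stride of 4 plus
    the length. [xq] is toggled once per arc to follow the parity of the degree. *)
Definition parse_arcs :=
  Whl ($xdeg) (
    xq <~ Cn 1 [-] $xq;;
    xcur <~ $xcur [+] Cn 4 [+] Ar RAW ($xcur [+] Cn 3);;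
    xdeg <~ $xdeg [-] Cn 1).

Definition read_input :=
  xn <~ Ar RAW (Cn 0);; xm <~ Ar RAW (Cn 1);;
  xa <~ Ar RAW (Cn 2);; xb <~ Ar RAW (Cn 3);;
  xcur <~ Cn 4;; xv <~ Cn 0;; xbad <~ Cn 0;;
  Whl ($xn [-] $xv) (
    xdeg <~ Ar RAW ($xcur);;
    xcur <~ $xcur [+] Cn 1;;
    Sto PTR ($xv) ($xcur);;
    Sto REM ($xv) ($xdeg);;
    xq <~ Xor (Eqe ($xa) ($xv)) (Eqe ($xb) ($xv));;
    parse_arcs;;
    xbad <~ $xbad [+] $xq;;
    xv <~ $xv [+] Cn 1).

(** Arcs are represented by the addresses of their records in the input. [TR] receives them from the
    last to the first, so arc [i] of the trail is found at index [m - 1 - i]. *)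
Definition hierholzer :=
  xsp <~ Cn 0;; Sto SV (Cn 0) ($xa);; xoc <~ Cn 0;; xgo <~ Cn 1;;
  Whl ($xgo) (
    xv <~ Ar SV ($xsp);;
    Ifc (Ar REM ($xv)) (
      xp <~ Ar PTR ($xv);;
      Sto REM ($xv) (Ar REM ($xv) [-] Cn 1);;
      Sto PTR ($xv) ($xp [+] Cn 4 [+] Ar RAW ($xp [+] Cn 3));;
      xe <~ Ar RAW ($xp);;
      Ifc (Ar USED ($xe)) skip (
        Sto USED ($xe) (Cn 1);;
        xsp <~ $xsp [+] Cn 1;;
        Sto SV ($xsp) (Ar RAW ($xp [+] Cn 2));;
        Sto SA ($xsp) ($xp)))
    (Ifc ($xsp) (
        Sto TR ($xoc) (Ar SA ($xsp));;
        xoc <~ $xoc [+] Cn 1;;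
        xsp <~ $xsp [-] Cn 1)
      (xgo <~ Cn 0))).

Definition copy :=
  Whl ($xcnt) (
    Cpy false ($xdst) ($xsrc);;
    xsrc <~ $xsrc [+] Cn 1;;
    xdst <~ $xdst [+] Cn 1;;
    xcnt <~ $xcnt [-] Cn 1).

Definition piece e1 e2 := xsrc <~ e1;; xcnt <~ e2;; copy.

(** The word of the trail is laid out directly behind the input, and [LEN] holds the lengths of its
    prefixes at the positions. Later visits overwrite earlier ones in [LST]. *)
Definition positions :=
  xwb <~ $xcur;; xi <~ Cn 0;; xlen <~ Cn 0;; xdst <~ $xwb;;
  Sto PV (Cn 0) ($xa);; Sto LEN (Cn 0) (Cn 0);; Sto LST ($xa) (Cn 0);;
  Whl ($xm [-] $xi) (
    xp <~ Ar TR ($xm [-] Cn 1 [-] $xi);;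
    piece ($xp [+] Cn 4) (Ar RAW ($xp [+] Cn 3));;
    xi <~ $xi [+] Cn 1;;
    xw <~ Ar RAW ($xp [+] Cn 2);;
    xlen <~ $xlen [+] Ar RAW ($xp [+] Cn 3);;
    Sto PV ($xi) ($xw);; Sto LEN ($xi) ($xlen);; Sto LST ($xw) ($xi)).

(* The trail is read backwards, so that the first visits overwrite later ones. *)
Definition first_visits :=
  xi <~ $xm [+] Cn 1;;
  Whl ($xi) (
    xi <~ $xi [-] Cn 1;;
    Sto FST (Ar PV ($xi)) ($xi)).

(** With the inverse of the whole word in memory, the inverse of each prefix is a suffix of it, so
    every query is assembled by copying contiguous pieces. *)
Definition inverse_word :=
  xl <~ $xlen;; xj <~ Cn 0;; xqb <~ $xwb [+] $xl [+] $xl;;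
  Whl ($xl [-] $xj) (
    Cpy true ($xwb [+] $xl [+] $xj) ($xwb [+] ($xl [-] Cn 1 [-] $xj));;
    xj <~ $xj [+] Cn 1).

Definition merge_blocks :=
  Whl (Ar ST ($xsp) [-] $xp) (
    Sto PAR (Ar ST ($xsp)) (Ar ST ($xsp [-] Cn 1));;
    Sto ML ($xsp [-] Cn 1) (Ar ML ($xsp [-] Cn 1) [+]
      (Ar ML ($xsp) [-] Ar ML ($xsp [-] Cn 1)));;
    xsp <~ $xsp [-] Cn 1).

Definition blocks :=
  xi <~ Cn 0;; xsp <~ Cn 0;;
  Whl ($xm [+] Cn 1 [-] $xi) (
    xv <~ Ar PV ($xi);; xp <~ Ar FST ($xv);;
    Ifc ($xi [-] $xp) merge_blocks (
      xsp <~ $xsp [+] Cn 1;;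
      Sto ST ($xsp) ($xi);; Sto ML ($xsp) (Ar LST ($xv));; Sto PAR ($xi) ($xi));;
    Ifc (Ar ML ($xsp) [-] $xi) skip (xsp <~ $xsp [-] Cn 1);;
    xi <~ $xi [+] Cn 1).

(** The letters of [Lam ct / Lam cs * (Lam j / Lam cj)]. Writing them twice squares the element;
    eight pieces of at most [l] letters account for the query length [8 l]. *)
Definition half_word :=
  piece ($xwb) ($xct);; piece ($xwb [+] $xl [+] ($xl [-] $xcs)) ($xcs);;
  piece ($xwb) ($xj);; piece ($xwb [+] $xl [+] ($xl [-] $xcj)) ($xcj).

Definition init_classes :=
  xj <~ Cn 0;;
  Whl ($xl [+] Cn 1 [-] $xj) (
    Sto CLS ($xoff [+] $xj) ($xj);;
    xj <~ $xj [+] Cn 1).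

Definition query_classes :=
  xj <~ Cn 0;;
  Whl ($xl [+] Cn 1 [-] $xj) (
    xcj <~ Ar CLS ($xo [+] $xj);;
    xdst <~ $xqb;;
    half_word;; half_word;;
    Qry xr ($xqb) ($xdst [-] $xqb);;
    Ifc ($xr) (xe <~ Cn 0) (xbad <~ Cn 1);;
    xj <~ $xj [+] Cn 1).

Definition join_classes :=
  xj <~ Cn 0;;
  Whl ($xl [+] Cn 1 [-] $xj) (
    Ifc (Eqe (Ar CLS ($xo [+] $xj)) ($xct))
      (Sto CLS ($xo [+] $xj) ($xcs)) (xr <~ Cn 0);;
    xj <~ $xj [+] Cn 1).

(** Each position owns a row of [l + 1] class entries, its offset being accumulated for lack of
    multiplication. For a first visit, [REP] is the offset of the row of its block, inherited
    through [PAR], which points to an earlier position if not to itself. *)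
Definition check_labels :=
  xi <~ Cn 0;; xoff <~ Cn 0;; xbad <~ Cn 0;;
  Whl ($xm [+] Cn 1 [-] $xi) (
    xp <~ Ar FST (Ar PV ($xi));;
    init_classes;;
    Ifc ($xi [-] $xp) (xr <~ Cn 0) (
      Ifc ($xi [-] Ar PAR ($xi)) (Sto REP ($xi) (Ar REP (Ar PAR ($xi))))
        (Sto REP ($xi) ($xoff)));;
    xo <~ Ar REP ($xp);;
    xcs <~ Ar CLS ($xo [+] Ar LEN ($xp));;
    xct <~ Ar CLS ($xo [+] Ar LEN ($xi));;
    query_classes;;
    join_classes;;
    xoff <~ $xoff [+] $xl [+] Cn 1;;
    xi <~ $xi [+] Cn 1).

Definition print_trail :=
  xi <~ Cn 0;;
  Whl ($xm [-] $xi) (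
    xp <~ Ar TR ($xm [-] Cn 1 [-] $xi);;
    Prt (Ar RAW ($xp));; Prt (Ar RAW ($xp [+] Cn 1));;
    xi <~ $xi [+] Cn 1).

Definition print_word :=
  xj <~ Cn 0;;
  Whl ($xlen [-] $xj) (
    PrtR ($xwb [+] $xj);;
    xj <~ $xj [+] Cn 1).

Definition print_words :=
  xv <~ Cn 0;;
  Whl ($xn [-] $xv) (
    xlen <~ Ar LEN (Ar FST ($xv));;
    Prt ($xlen);;
    print_word;;
    xv <~ $xv [+] Cn 1).

(** A violation of parity excludes Eulerian trails, so the answer is then affirmative and comes
    without a certificate. *)
Definition program :=
  read_input;;
  Ifc ($xbad) (Prt (Cn 1);; Prt (Cn 0)) (
    hierholzer;; positions;; first_visits;; inverse_word;; blocks;; check_labels;;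
    Ifc ($xbad) (Prt (Cn 0)) (
      Prt (Cn 1);; Prt (Cn 1);; print_trail;; print_words)).

Lemma program_ok : cmd_ok program.
Proof. by []. Qed.

Lemma ev_Eqe s e1 e2 : ev s (Eqe e1 e2) = (ev s e1 == ev s e2).
Proof. by rewrite /Eqe /=; move: (ev s e1) (ev s e2) => x y; case: (ltngtP x y) => h; rewrite /nat_of_bool; lia. Qed.

Lemma ev_Xor s e1 e2 (b1 b2 : bool) : ev s e1 = b1 -> ev s e2 = b2 ->
  ev s (Xor e1 e2) = b1 (+) b2.
Proof. by rewrite /Xor /= => -> ->; case: b1; case: b2. Qed.

(** * Lists in memory *)

Definition holds (r : nat -> int) (p : nat) (s : seq int) : Prop :=
  forall j, j < size s -> r (p + j) = nth 0%R s j.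

Lemma holds_cat r p s1 s2 : holds r p (s1 ++ s2) <->
  holds r p s1 /\ holds r (p + size s1) s2.
Proof.
split=> [h|[h1 h2] j]; last first.
  rewrite size_cat nth_cat => js; case: ltnP => h; first exact: h1.
  rewrite -h2; last by rewrite -(ltn_add2l (size s1)) subnKC.
  by rewrite -addnA subnKC.
split=> j js; first by rewrite h ?nth_cat ?js // size_cat (leq_trans js) ?leq_addr.
by rewrite -addnA h ?size_cat ?ltn_add2l // nth_cat ltnNge leq_addr /= addKn.
Qed.

Lemma holds_cons r p x s : holds r p (x :: s) <-> r p = x /\ holds r p.+1 s.
Proof.
rewrite -cat1s holds_cat addn1; split=> [] [h1 h2]; split=> //.
  by have := h1 0 isT; rewrite addn0.
by case=> // _; rewrite addn0.
Qed.

Lemma holds_ext r r' p s : (forall j, p <= j < p + size s -> r' j = r j) ->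
  holds r p s -> holds r' p s.
Proof. by move=> rr' h j js; rewrite rr' ?h // leq_addr ltn_add2l. Qed.

Lemma holds_map r p s : holds r p s -> [seq r (p + j) | j <- iota 0 (size s)] = s.
Proof.
move=> h; apply: (@eq_from_nth _ 0%R); rewrite size_map size_iota // => j js.
by rewrite (nth_map 0) ?size_iota // nth_iota // h.
Qed.

Ltac wp_step := first [apply: wp_seq | apply: wp_asg | apply: wp_sto | apply: wp_cpy
  | apply: wp_prt | apply: wp_prtr].

Ltac slia := repeat match goal with |- context [@size ?T ?s] => move: (@size T s) => ? end; lia.

(** These tactics apply frame equations; that a variable or array is not modified is checked by
    computation, through [isT]. *)
Ltac kv k := repeat (match type of k with
  | forall x, _ -> vr ?s x = _ => match goal with |- context [vr s ?x] => rewrite (k x isT) end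
  end).
Ltac ka k := repeat (match type of k with
  | forall x, _ -> ar ?s x = _ => match goal with |- context [ar s ?x] => rewrite (k x isT) end
  end).

Section Copy.
Variables (orc : seq int -> bool -> Prop) (phi : nat -> nat).
Local Notation wp := (wp orc phi).

Lemma wp_copy s w (Q : astate -> Prop) :
  holds (rw s) (vr s xsrc) w -> vr s xcnt = size w ->
  vr s xsrc + size w <= vr s xdst ->
  (forall s', holds (rw s') (vr s xdst) w ->
     (forall j, j < vr s xdst -> rw s' j = rw s j) ->
     vr s' xdst = vr s xdst + size w -> tm s' = tm s + (5 * size w).+1 ->
     keeps copy s s' -> Q s') ->
  wp copy Q s.
Proof.
move=> hw hn hd post.
suff : wp copy (fun s' => [/\ holds (rw s') (vr s xdst) w,
   forall j, j < vr s xdst -> rw s' j = rw s j,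
   vr s' xdst = vr s xdst + size w & tm s' = tm s + (5 * size w).+1]) s.
  by move=> /wp_keeps/wp_conseq; apply => s' [[h1 h2 h3 h4] h5]; apply: post.
pose I s' := exists k, [/\ k <= size w, vr s' xcnt = size w - k,
  vr s' xsrc = vr s xsrc + k, vr s' xdst = vr s xdst + k &
  [/\ forall j, j < vr s xdst -> rw s' j = rw s j,
      holds (rw s') (vr s xdst) (take k w) & tm s' = tm s + 5 * k]].
apply: (@wp_while _ _ (tm s + 5 * size w) I).
- by exists 0; rewrite subn0 !addn0 take0; split=> //; split=> //; rewrite ?muln0 ?addn0.
- by move=> s' [k [kw _ _ _ [_ _ ->]]]; clear -kw; lia.
- move=> s' [k [kw hc hs hdd [hr hh ht]]] /= c0.
  have {}kw : k < size w by clear -hc c0; lia.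
  do 7!wp_step; exists k.+1; rewrite /= hc hs hdd ht.
  split=> //; try by clear -kw; lia.
  split; last by clear; lia.
  + by move=> j jd; rewrite updr_neq ?hr //; clear -jd; lia.
  + rewrite (take_nth 0%R) // -cats1 holds_cat size_takel ?(ltnW kw) //; split.
      apply: holds_ext hh => j; rewrite size_takel ?(ltnW kw) // => jk.
      by rewrite updr_neq //; clear -jk; lia.
    rewrite holds_cons; split; last by [].
    by rewrite updr_eq hr ?hw //; clear -kw hd; lia.
- move=> s' [k [kw hc hs hdd [hr hh ht]]] /= c0.
  have E : k = size w by clear -hc c0 kw; lia.
  by rewrite E take_size in hh *; split=> //=; rewrite ?hdd ?ht E //; clear; lia.
Qed.

Lemma wp_piece s e1 e2 w (Q : astate -> Prop) :
  holds (rw s) (ev s e1) w -> ev (setv s xsrc (ev s e1)) e2 = size w ->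
  ev s e1 + size w <= vr s xdst ->
  (forall s', holds (rw s') (vr s xdst) w ->
     (forall j, j < vr s xdst -> rw s' j = rw s j) ->
     vr s' xdst = vr s xdst + size w -> tm s' = tm s + (5 * size w + 3) ->
     keeps (piece e1 e2) s s' -> Q s') ->
  wp (piece e1 e2) Q s.
Proof.
move=> hw hn hd post.
suff : wp (piece e1 e2) (fun s' => [/\ holds (rw s') (vr s xdst) w,
   forall j, j < vr s xdst -> rw s' j = rw s j,
   vr s' xdst = vr s xdst + size w & tm s' = tm s + (5 * size w + 3)]) s.
  by move=> /wp_keeps/wp_conseq; apply => s' [[h1 h2 h3 h4] h5]; apply: post.
do 4!wp_step; apply: (@wp_copy _ w) => //= s' h1 h2 h3 h4 _; split=> //.
by rewrite h4; clear; lia.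
Qed.

End Copy.

Lemma flatten_map_cons (T : Type) (f : T -> seq int) x s :
  flatten (map f (x :: s)) = f x ++ flatten (map f s).
Proof. by []. Qed.

(** * Reading the input *)

Section Parse.
Variables (orc : seq int -> bool -> Prop) (phi : nat -> nat).
Variables (k n m : nat) (en : 'I_m -> 'I_n * 'I_n) (lab : 'I_m -> word k).
Variables (adj : 'I_n -> seq (arc_of 'I_m)) (a b : 'I_n).
Hypothesis adjP : adjacency_list en adj.
Local Notation wp := (wp orc phi).
Implicit Types (x : 'I_m * bool) (s : astate).

Definition arc_word x := if x.2 then word_inv (lab x.1) else lab x.1.

Definition arc_record x : seq int :=
  arc_code x ++ Posz (arc_head en x) :: sized_word_code (arc_word x).

Definition vertex_record v : seq int :=
  Posz (size (adj v)) :: flatten [seq arc_record x | x <- adj v].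

Lemma size_arc_word x : size (arc_word x) = size (lab x.1).
Proof. by rewrite /arc_word; case: x.2; rewrite // /word_inv size_rev size_map. Qed.

Lemma size_arc_record x : size (arc_record x) = 4 + size (lab x.1).
Proof. by rewrite /arc_record /= /sized_word_code size_map size_arc_word. Qed.

Lemma holds_record r p x : holds r p (arc_record x) ->
  [/\ r p = Posz x.1, r (p + 1) = Posz x.2, r (p + 2) = Posz (arc_head en x),
      r (p + 3) = Posz (size (lab x.1)) & holds r (p + 4) (word_code (arc_word x))].
Proof.
rewrite /arc_record /arc_code /sized_word_code /= !holds_cons size_arc_word.
by case=> h0 [h1 [h2 [h3 h4]]]; rewrite !addnS !addn0.
Qed.

Lemma sum_degrees : \sum_(v < n) size (adj v) = m.*2.
Proof.
transitivity (\sum_(v < n) \sum_(x : 'I_m * bool) (arc_tail en x == v)).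
  apply: eq_bigr => v _; rewrite (perm_size (adjP v)) size_filter -sum1_count.
  by rewrite big_enum_cond /= big_mkcond; apply: eq_bigr => x _; case: eqP.
rewrite exchange_big /= (eq_bigr (fun=> 1)) => [|x _].
  by rewrite sum1_card card_prod card_ord card_bool muln2.
rewrite (bigD1 (arc_tail en x)) //= eqxx big1 // => v.
by rewrite eq_sym => /negPf->.
Qed.

Lemma wp_parse_arcs s xs (q : bool) (Q : astate -> Prop) :
  holds (rw s) (vr s xcur) (flatten (map arc_record xs)) ->
  vr s xdeg = size xs -> vr s xq = q ->
  (forall s', vr s' xcur = vr s xcur + size (flatten (map arc_record xs)) ->
     vr s' xq = q (+) odd (size xs) -> tm s' = tm s + (4 * size xs).+1 ->
     keeps parse_arcs s s' -> Q s') ->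
  wp parse_arcs Q s.
Proof.
move=> hh hdeg hq post.
suff : wp parse_arcs (fun s' =>
    [/\ vr s' xcur = vr s xcur + size (flatten (map arc_record xs)),
     vr s' xq = q (+) odd (size xs) & tm s' = tm s + (4 * size xs).+1]) s.
  by move=> /wp_keeps/wp_conseq; apply => s' [[h1 h2 h3] h5]; apply: post.
pose I s' := exists ys zs, [/\ xs = ys ++ zs, rw s' = rw s, vr s' xdeg = size zs,
  vr s' xcur = vr s xcur + size (flatten (map arc_record ys)) &
  vr s' xq = q (+) odd (size ys) /\ tm s' = tm s + 4 * size ys].
apply: (@wp_while _ _ (tm s + 4 * size xs) I).
- exists [::], xs; rewrite /I /= muln0 !addn0 addbF; split; [by []|by []|exact: hdeg|by []|].
  by split; [exact: hq|].
- move=> s' [ys [zs [xsE hr hd hc [hq' ht]]]].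
  by rewrite ht xsE size_cat leq_add2l leq_mul2l leq_addr.
- move=> s' [ys [[|x zs] [xsE hr hd hc [hq' ht]]]] /= d0; first by rewrite hd in d0.
  have := hh; rewrite xsE map_cat flatten_cat flatten_map_cons holds_cat => -[_].
  rewrite holds_cat => -[/holds_record[_ _ _ r3 _] _]; rewrite -hc -hr in r3.
  do 5!wp_step; exists (rcons ys x), zs; rewrite /= cat_rcons hd hc hq' ht subn1 size_rcons.
  split=> //; first by rewrite -hc r3 hc map_rcons flatten_rcons size_cat size_arc_record addnA; clear; lia.
  split; last by clear; lia.
  by rewrite /=; case: (odd _); case: (q).
- move=> s' [ys [zs [xsE hr hd hc [hq' ht]]]] /= d0.
  have zs0 : zs = [::] by apply: size0nil; rewrite -hd.
  by rewrite xsE zs0 cats0; split=> //=; rewrite ht; clear; lia.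
Qed.

Definition parsed s :=
  [/\ vr s xn = n, vr s xm = m, vr s xa = a, vr s xb = b
    & forall v : 'I_n, [/\ ar s REM v = size (adj v),
        holds (rw s) (ar s PTR v) (flatten (map arc_record (adj v)))
      & ar s PTR v + size (flatten (map arc_record (adj v))) <= vr s xcur]].

Definition even_at (v : 'I_n) := odd (size (adj v)) == (a == v) (+) (b == v).

Lemma wp_read_input s (Q : astate -> Prop) :
  holds (rw s) 0 (input_code en lab adj a b) ->
  (forall s', parsed s' -> (vr s' xbad = 0 <-> forall v, even_at v) ->
     tm s' <= tm s + (10 * n + 8 * m + 10) -> keeps read_input s s' -> Q s') ->
  wp read_input Q s.
Proof.
move=> hin post.
suff : wp read_input (fun s' => [/\ parsed s', (vr s' xbad = 0 <-> forall v, even_at v)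
     & tm s' <= tm s + (10 * n + 8 * m + 10)]) s.
  by move=> /wp_keeps/wp_conseq; apply => s' [[h1 h2 h3] h5]; apply: post.
move: hin; rewrite /input_code !holds_cons => -[r0 [r1 [r2 [r3]]]].
rewrite -/(vertex_record _) => hin.
have {}hin : holds (rw s) 4 (flatten [seq vertex_record v | v <- enum 'I_n]) by exact: hin.
(* The budget of the vertices still to be read; as the degrees sum to [2 m], the total is
   [10 n + 8 m]. *)
pose cost (vs : seq 'I_n) := \sum_(v <- vs) (10 + 4 * size (adj v)).
pose I s' := exists us vs, [/\ enum 'I_n = us ++ vs, rw s' = rw s,
  [/\ vr s' xn = n, vr s' xm = m, vr s' xa = a & vr s' xb = b],
  [/\ vr s' xv = size us,
      vr s' xcur = 4 + size (flatten [seq vertex_record v | v <- us]) &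
      vr s' xbad = 0 <-> forall v, v \in us -> even_at v] &
  (forall v, v \in us -> [/\ ar s' REM v = size (adj v),
        holds (rw s) (ar s' PTR v) (flatten (map arc_record (adj v)))
      & ar s' PTR v + size (flatten (map arc_record (adj v))) <= vr s' xcur])
   /\ tm s' + cost vs <= tm s + 7 + cost (enum 'I_n)].
have costE : cost (enum 'I_n) = 10 * n + 8 * m.
  rewrite /cost big_enum /= big_split /= -big_distrr /= sum_degrees.
  by rewrite sum_nat_const card_ord -mul2n; clear; lia.
have valE us v vs : enum 'I_n = us ++ v :: vs -> val v = size us.
  move=> E; have := congr1 (fun t => nth 0 (map val t) (size us)) E.
  rewrite val_enum_ord map_cat nth_cat size_map ltnn subnn /= nth_iota ?add0n //.
  suff: size us < size (enum 'I_n) by rewrite size_enum_ord.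
  by rewrite E size_cat /= addnS ltnS leq_addr.
do 14!wp_step; apply: (@wp_while _ _ (tm s + 7 + cost (enum 'I_n)) I).
- exists [::], (enum 'I_n); rewrite /= r0 r1 r2 r3; split=> //.
  by split=> //; clear; lia.
- by move=> s' [us [vs [_ _ _ _ [_ h]]]]; apply: leq_trans h; apply: leq_addr.
- move=> s' [us [[|v vs] [usE hr [hn hm ha hb] [hv hc hbad] [harr ht]]]] /= d0.
    have := congr1 size usE; rewrite size_enum_ord cats0 => nE.
    by move: d0; rewrite hn hv -nE subnn.
  have vv := valE _ _ _ usE.
  have := hin; rewrite usE map_cat flatten_cat flatten_map_cons holds_cat => -[_].
  rewrite holds_cat => -[+ _]; rewrite holds_cons => -[rdeg hv'].
  rewrite -hc in rdeg hv'.
  set P := flatten (map arc_record (adj v)) in hv' *.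
  do 11!wp_step; apply: (@wp_parse_arcs _ (adj v) ((a == v) (+) (b == v))).
  + by rewrite /= hr addn1.
  + by rewrite /= hr rdeg.
  + apply: ev_Xor; rewrite ev_Eqe /= ?ha ?hb hv -vv; congr nat_of_bool; exact: val_eqE.
  rewrite /= hr => s2 c2 q2 t2 [k1 k2 k3 k4].
  do 3!wp_step; exists (rcons us v), vs.
  rewrite /= cat_rcons q2 c2 (k3 isT) !k2 // !k1 //= -/P hr hn hm ha hb hv hc size_rcons.
  rewrite map_rcons flatten_rcons size_cat /= -/P addn1.
  split=> //.
  + split=> //.
    * by clear; lia.
    * have hq : (((a == v) (+) (b == v)) (+) odd (size (adj v))) = ~~ even_at v.
        by rewrite /even_at; move: (odd _) (a == v) (b == v) => [] [] [].
      rewrite hq; have [hb1 hb2] := hbad; split=> [/eqP|h].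
        rewrite addn_eq0 eqb0 negbK => /andP[/eqP h1 h2] u.
        by rewrite mem_rcons inE => /predU1P[->//|]; apply: hb1.
      rewrite (h v) ?mem_rcons ?mem_head // hb2 // => u uus.
      by apply: h; rewrite mem_rcons inE uus orbT.
  + split.
      move=> u; rewrite mem_rcons inE => /predU1P[->|uus].
        by rewrite vv eqxx -hc rdeg; split=> //; rewrite addn1.
      have uv : (val u == size us) = false.
        apply/eqP => E.
        have uE : u = v by apply: val_inj; rewrite /= E vv.
        have := enum_uniq 'I_n; rewrite usE cat_uniq /= => /and3P[_ /norP[+ _] _].
        by rewrite -uE uus.
      rewrite uv; have [h1 h2 h3] := harr u uus; split=> //.
      by apply: leq_trans h3 _; rewrite hc; clear; lia.
    move: ht; rewrite t2 /cost big_cons /= => ht.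
    by clear -ht; lia.
- move=> s' [us [vs [usE hr [hn hm ha hb] [hv hc hbad] [harr ht]]]] /= d0.
  have vs0 : vs = [::].
    apply: size0nil; have := congr1 size usE; rewrite size_enum_ord size_cat.
    by clear -d0 hn hv; lia.
  rewrite vs0 cats0 in usE; have inus v : v \in us by rewrite -usE mem_enum.
  split.
  + by split=> // v; rewrite /= hr; apply: harr.
  + by rewrite /= hbad; split=> h v; [apply: h | move=> _; apply: h].
  + by move: ht; rewrite costE /=; clear; lia.
Qed.

End Parse.

(** * Correctness of the trail search *)

Section FindTrail.
Variables (orc : seq int -> bool -> Prop) (phi : nat -> nat).
Variables (k : nat) (gT : groupType) (g : 'I_k -> gT) (n m : nat).
Variables (en : 'I_m -> 'I_n * 'I_n) (lab : 'I_m -> word k).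
Variables (adj : 'I_n -> seq (arc_of 'I_m)) (a b : 'I_n).
Hypothesis adjP : adjacency_list en adj.
Local Notation G := (word_graph g en lab).
Local Notation wp := (wp orc phi).
Implicit Types (s : astate).

(** The bound keeps the record below [B], so that it survives all writes from [B] on. *)
Definition points (r : nat -> int) (B p : nat) (x : arc_of 'I_m) : Prop :=
  holds r p (arc_record en lab x) /\ p + size (arc_record en lab x) <= B.

Definition trail_stored s (C : seq (garc G)) : Prop :=
  [/\ vr s xm = size C &
    forall x0 j, j < size C -> points (rw s) (vr s xcur) (ar s TR (size C - 1 - j)) (nth x0 C j)].

Lemma even_parity : (forall v, even_at adj a b v) <->
  forall w : vert G, odd (degree_avoiding [::] w) = (a == w) (+) (b == w).
Proof.
have E v : size (adj v) = @degree_avoiding _ G [::] v.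
  by rewrite degree_arcs (perm_size (adjP v)).
split=> h v; have := h v; rewrite /even_at E; first by move/eqP.
by move->.
Qed.

Lemma sum_set_rest (rest : vert G -> seq (garc G)) u x r : rest u = x :: r ->
  (\sum_(v < n) size (set_rest rest u r v)).+1 = \sum_(v < n) size (rest v).
Proof.
move=> rE; rewrite (bigD1 u) //= [RHS](bigD1 u) //= rE /set_rest eqxx /= addSn.
by congr (_ + _).+1; apply: eq_bigr => v /negPf->.
Qed.

Lemma wp_hierholzer s (Q : astate -> Prop) : connected_graph G ->
  parsed en lab adj a b s -> (forall e, ar s USED e = 0) ->
  (forall v, even_at adj a b v) ->
  (forall s' (C : seq (garc G)), eulerian_trail (G := G) a C b -> trail_stored s' C ->
     tm s' <= tm s + (64 * m + 21) -> keeps hierholzer s s' -> Q s') ->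
  wp hierholzer Q s.
Proof.
move=> cG [hn hm ha hb harr] hused /even_parity par post.
suff : wp hierholzer (fun s' => (exists2 C, eulerian_trail (G := G) a C b & trail_stored s' C)
     /\ tm s' <= tm s + (64 * m + 21)) s.
  by move=> /wp_keeps/wp_conseq; apply => s' [[[C h1 h2] h3] h5]; exact: (post s' C h1 h2 h3 h5).
pose B := vr s xcur.
(* Each pass has 16 ticks. Scanning an arc frees two units of the potential, one of which is
   retained on the stack if the arc is pushed and pays for its removal; [go] pays for the last pass.
   Initially the lists have [2 m] entries, whence [4 m + 1]. *)
pose I s' := exists (S O : seq (garc G)) (o : vert G) (rest : vert G -> seq (garc G)) (go : bool),
  [/\ hier (G := G) a b S O o rest,
   [/\ rw s' = rw s, vr s' xcur = B, vr s' xm = m & vr s' xgo = go],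
   [/\ vr s' xsp = size S,
       forall j, j <= size S -> ar s' SV j = val (walk_end (G := G) a (take j S)),
       forall x0 j, j < size S -> points (rw s) B (ar s' SA j.+1) (nth x0 S j),
       vr s' xoc = size O &
       forall x0 j, j < size O -> points (rw s) B (ar s' TR (size O - 1 - j)) (nth x0 O j)],
   [/\ forall e : 'I_m, ar s' USED e = (e \in edges_of (S ++ O)) &
       forall v : 'I_n, [/\ ar s' REM v = size (rest v),
         holds (rw s) (ar s' PTR v) (flatten (map (arc_record en lab) (rest v)))
       & ar s' PTR v + size (flatten (map (arc_record en lab) (rest v))) <= B]] &
   (go = false -> S = [::] /\ rest a = [::]) /\
   tm s' + 16 * (2 * (\sum_(v < n) size (rest v)) + size S + go) <= tm s + 4 + 16 * (4 * m + 1)].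
do 8!wp_step; apply: (@wp_while _ _ (tm s + 4 + 16 * (4 * m + 1)) I).
- exists [::], [::], b, adj, true; split.
  + apply: hier0 => // [x|w x].
      by rewrite (perm_mem (adjP _)) mem_filter mem_enum eqxx.
    by rewrite (perm_mem (adjP _)) mem_filter => /andP[/eqP].
  + by [].
  + by split=> //= -[].
  + by split=> //= v; apply: harr.
  + split=> //=; rewrite (sum_degrees adjP); clear; lia.
- by move=> s' [S [O [o [rest [go [_ _ _ _ [_ h]]]]]]]; apply: leq_trans h; apply: leq_addr.
- move=> s' [S [O [o [rest [go [hi [hr hc hm' hgo] [hsp hSV hSA hoc hTR] [hU hR] [hgo0 ht]]]]]]] /= g0.
  have {}hgo0 : go = true by case: (go) hgo g0 => // ->.
  rewrite {}hgo0 /= in hgo ht.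
  have hv : ar s' SV (vr s' xsp) = val (walk_end (G := G) a S) by rewrite hsp hSV // take_size.
  set top := walk_end (G := G) a S in hv.
  have [hrem hptr hbnd] := hR top.
  do 2!wp_step; apply: wp_if => /= rem0.
    rewrite hv in rem0.
    case rE : (rest top) rem0 => [|x r]; first by rewrite hrem rE.
    move=> _; rewrite rE /= in hrem; rewrite rE flatten_map_cons size_cat in hbnd.
    have := hptr; rewrite rE flatten_map_cons holds_cat => -[hrec hrest].
    have [r0 r1 r2 r3 _] := holds_record hrec.
    have szr := size_arc_record en lab x.
    have sumE := sum_set_rest rE.
    have newR : forall v : 'I_n, [/\
        (if val v == val top then (size r).+1 - 1 else ar s' REM v) = size (set_rest rest top r v),
        holds (rw s) (if val v == val top then ar s' PTR top + 4 + size (lab x.1) else ar s' PTR v)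
          (flatten (map (arc_record en lab) (set_rest rest top r v)))
      & (if val v == val top then ar s' PTR top + 4 + size (lab x.1) else ar s' PTR v) +
          size (flatten (map (arc_record en lab) (set_rest rest top r v))) <= B].
      move=> v; rewrite /set_rest val_eqE; case: eqP => [_|_]; last exact: hR.
      rewrite subn1 -addnA -szr; split=> //.
      by rewrite -addnA.
    do 8!wp_step; apply: wp_if => /=; rewrite hv hr r0 /= => used.
      rewrite hU in used; have xU : x.1 \in edges_of (S ++ O) by case: (_ \in _) used.
      wp_step; exists S, O, o, (set_rest rest top r), true; split=> //=.
      * exact: (@hier_skip _ G a b S O o rest hi x r rE xU).
      * by split=> // v; rewrite hrem r3; exact: (newR v).
      * by split=> //; move: ht; rewrite -sumE; move: (\sum_(v < n) size (set_rest rest top r v)) => Z; clear; slia.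
    rewrite hU in used; have xU : x.1 \notin edges_of (S ++ O) by case: (_ \in _) used.
    do 7!wp_step; exists (rcons S x), O, o, (set_rest rest top r), true; split.
    + exact: (@hier_push _ G a b S O o rest hi x r rE xU).
    + by rewrite /= hr.
    + rewrite /= size_rcons hsp addn1; split=> //.
      * move=> j; rewrite leq_eqVlt => /predU1P[->|js].
          by rewrite eqxx ?hr ?hv r2 take_oversize ?size_rcons // /walk_end map_rcons last_rcons.
        rewrite ltnS in js; rewrite ltn_eqF ?ltnS // hSV // -cats1 takel_cat //.
      * move=> x0 j; rewrite ltnS leq_eqVlt => /predU1P[->|js].
          by rewrite eqxx nth_rcons ltnn eqxx ?hv; split=> //; apply: leq_trans hbnd; rewrite addnA leq_addr.
        by rewrite eqSS ltn_eqF // nth_rcons js; apply: hSA.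
    + split=> /=.
        move=> e; rewrite ?hr ?hv ?r0 /= cat_rcons /edges_of map_cat /= mem_cat inE.
        case: eqP => [E|NE].
          by have -> : e = x.1 by [apply: val_inj]; rewrite eqxx orbT.
        have /negPf-> : e != x.1 by apply/eqP => E; apply: NE; rewrite E.
        by rewrite hU /edges_of map_cat mem_cat.
      by move=> v; rewrite hrem ?hr ?hv r3; exact: (newR v).
    + by split=> //=; move: ht; rewrite size_rcons -sumE; move: (\sum_(v < n) size (set_rest rest top r v)) => Z; clear; slia.
  have rE : rest top = [::] by apply: size0nil; rewrite -hrem -hv.
  apply: wp_if => /= sp0.
    have [S' [x SE]] : exists S' x, S = rcons S' x.
      by case/lastP: (S) hsp sp0 => [->|S' x _ _] //; exists S', x.
    have szS : size S = (size S').+1 by rewrite SE size_rcons.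
    do 5!wp_step; exists S', (x :: O), (walk_end (G := G) a S'), rest, true; split.
    + exact: (@hier_pop _ G a b S O o rest hi S' x SE rE).
    + by [].
    + rewrite /= hsp szS subn1 addn1 hoc; split=> //.
      * by move=> j js; rewrite hSV ?szS 1?ltnW // SE -cats1 takel_cat.
      * by move=> x0 j js; have := hSA x0 j; rewrite SE size_rcons nth_rcons js; apply; rewrite ltnS ltnW.
      * move=> x0 [|j] js; rewrite ?subn0 subn1 /=.
          by rewrite eqxx; have := hSA x0 (size S'); rewrite SE size_rcons nth_rcons ltnn eqxx; apply.
        rewrite ltn_eqF; last by clear -js; lia.
        have := hTR x0 j js; congr points.
        by congr (ar s' _ _); clear; lia.
    + have E : S' ++ x :: O = S ++ O by rewrite SE cat_rcons.
      by rewrite E; split.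
    + by split=> //=; move: ht; rewrite szS; move: (\sum_(v < n) size (rest v)) => Z; clear; slia.
  have S0 : S = [::] by apply: size0nil; rewrite -hsp.
  wp_step; exists S, O, o, rest, false; split=> //=.
  split; first by split=> //; move: rE; rewrite /top S0.
  by move: ht; move: (\sum_(v < n) size (rest v)) => Z; clear; slia.
- move=> s' [S [O [o [rest [go [hi [hr hc hm' hgo] [hsp hSV hSA hoc hTR] [hU hR] [hgo0 ht]]]]]]] /= g0.
  have go0 : go = false by case: (go) hgo g0 => // ->.
  have [S0 ra] := hgo0 go0; subst S.
  have eO := hier_end cG hi ra; have szO := size_eulerian eO.
  rewrite card_ord in szO; split; last by move: ht; move: (\sum_(v < n) size (rest v)) => Z; clear; slia.
  exists O => //; split; first by rewrite /= hm' szO.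
  by rewrite /= hr hc.
Qed.

End FindTrail.

(** * The word of the trail and the visits of its vertices *)

Section Positions.
Variables (orc : seq int -> bool -> Prop) (phi : nat -> nat).
Variables (k : nat) (gT : groupType) (g : 'I_k -> gT) (n m : nat).
Variables (en : 'I_m -> 'I_n * 'I_n) (lab : 'I_m -> word k) (a b : 'I_n).
Local Notation G := (word_graph g en lab).
Local Notation wp := (wp orc phi).
Implicit Types (s : astate) (C : seq (garc G)).

Definition trail_word (C : seq (arc_of 'I_m)) : word k :=
  flatten [seq arc_word lab x | x <- C].

Lemma word_val_cat (w w' : word k) : word_val g (w ++ w') = (word_val g w * word_val g w')%g.
Proof. by rewrite /word_val big_cat. Qed.

Lemma word_val_arc (x : garc G) : word_val g (arc_word lab x) = alab x.
Proof. by rewrite /arc_word /alab; case: x.2; rewrite // word_val_inv. Qed.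

Lemma word_val_trail C : word_val g (trail_word C) = tlab C.
Proof.
elim: C => [|x C IH]; first by rewrite /tlab /word_val !big_nil.
by rewrite /trail_word /= word_val_cat word_val_arc IH /tlab big_cons.
Qed.

Lemma trail_word_cat (C D : seq (arc_of 'I_m)) :
  trail_word (C ++ D) = trail_word C ++ trail_word D.
Proof. by rewrite /trail_word map_cat flatten_cat. Qed.

Lemma take_trail_word C i :
  take (size (trail_word (take i C))) (trail_word C) = trail_word (take i C).
Proof. by rewrite -{2}(cat_take_drop i C) trail_word_cat take_size_cat. Qed.

Lemma size_trail_word_take C i : size (trail_word (take i C)) <= size (trail_word C).
Proof. by rewrite -{2}(cat_take_drop i C) trail_word_cat size_cat leq_addr. Qed.

Lemma plab_word C i : plab C i = word_val g (take (size (trail_word (take i C))) (trail_word C)).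
Proof. by rewrite take_trail_word word_val_trail. Qed.

Lemma size_trail_word C : eulerian_trail (G := G) a C b ->
  size (trail_word C) = total_length lab.
Proof.
case/andP=> /andP[_ uC] /forallP aC.
rewrite /trail_word size_flatten /shape -map_comp sumnE big_map.
rewrite (eq_bigr (fun x => size (lab x.1))) => [|x _]; last by rewrite /= size_arc_word.
rewrite -(big_map fst xpredT (fun e => size (lab e))) big_uniq //=.
by apply: eq_bigl => e; rewrite aC.
Qed.

Lemma size_word_code (w : word k) : size (word_code w) = size w.
Proof. by rewrite size_map. Qed.

Section Store.
Variable C : seq (garc G).
Hypothesis eC : eulerian_trail (G := G) a C b.

Definition stored_PV s := forall i, i <= size C -> ar s PV i = val (pvert (G := G) a C i).
Definition stored_LEN s := forall i, i <= size C -> ar s LEN i = size (trail_word (take i C)).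
Definition stored_LST s := forall i, i <= size C ->
  [/\ i <= ar s LST (pvert (G := G) a C i), ar s LST (pvert (G := G) a C i) <= size C
    & pvert (G := G) a C (ar s LST (pvert (G := G) a C i)) = pvert (G := G) a C i].
Definition stored_FST s := forall i, i <= size C ->
  ar s FST (pvert (G := G) a C i) = first_visit (G := G) a C (pvert (G := G) a C i).

Lemma trail_word_rcons x0 i : i < size C ->
  trail_word (take i.+1 C) = trail_word (take i C) ++ arc_word lab (nth x0 C i).
Proof.
by move=> iC; rewrite (take_nth x0) // -cats1 trail_word_cat {2}/trail_word /= cats0.
Qed.

Lemma wp_positions s (Q : astate -> Prop) : trail_stored s C -> vr s xa = a ->
  (forall s', stored_PV s' -> stored_LEN s' -> stored_LST s' ->
     vr s' xwb = vr s xcur -> vr s' xlen = size (trail_word C) ->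
     holds (rw s') (vr s xcur) (word_code (trail_word C)) ->
     (forall j, j < vr s xcur -> rw s' j = rw s j) ->
     tm s' <= tm s + (11 * size C + 5 * size (trail_word C) + 8) ->
     keeps positions s s' -> Q s') ->
  wp positions Q s.
Proof.
move=> [hm hTR] ha post; set B := vr s xcur in hTR post *.
suff : wp positions (fun s' => [/\ stored_PV s', stored_LEN s', stored_LST s',
     vr s' xwb = B & [/\ vr s' xlen = size (trail_word C),
     holds (rw s') B (word_code (trail_word C)),
     (forall j, j < B -> rw s' j = rw s j) &
     tm s' <= tm s + (11 * size C + 5 * size (trail_word C) + 8)]]) s.
  move=> /wp_keeps/wp_conseq; apply => s' [[h1 h2 h3 h4 [h5 h6 h7 h8]] h9].
  exact: post.
pose I s' := exists i, [/\ i <= size C,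
  [/\ vr s' xm = size C, vr s' xi = i, vr s' xwb = B, ar s' TR = ar s TR
    & vr s' xlen = size (trail_word (take i C)) /\ vr s' xdst = B + vr s' xlen],
  forall j, j <= i -> [/\ ar s' PV j = val (pvert (G := G) a C j),
    ar s' LEN j = size (trail_word (take j C)) &
    [/\ j <= ar s' LST (pvert (G := G) a C j), ar s' LST (pvert (G := G) a C j) <= i
    & pvert (G := G) a C (ar s' LST (pvert (G := G) a C j)) = pvert (G := G) a C j]],
  holds (rw s') B (word_code (trail_word (take i C))) &
  (forall j, j < B -> rw s' j = rw s j) /\
  tm s' = tm s + 7 + 11 * i + 5 * size (trail_word (take i C))].
have szle i : size (trail_word (take i C)) <= size (trail_word C) := size_trail_word_take C i.
do 14!wp_step.
apply: (@wp_while _ _ (tm s + 7 + 11 * size C + 5 * size (trail_word C)) I).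
- exists 0; rewrite take0; split=> //=.
  + by split=> //; rewrite addn0.
  + by case=> // _; rewrite ha /pvert /= take0 eqxx.
  + by split=> //; clear; lia.
- move=> s' [i [iC _ _ _ [_ ->]]]; have := szle i; clear -iC; lia.
- move=> s' [i [iC [hm' hi hwb hTR' [hlen hdst]] harr hW [hlow ht]]] /= d0.
  have {}iC : i < size C by rewrite hm' hi subn_gt0 in d0.
  have [x0 _] : exists x0, x0 \in C by case: (C) iC => // x0 *; exists x0; rewrite mem_head.
  set x := nth x0 C i; have [hrec hbnd] := hTR x0 i iC; rewrite -/x in hrec hbnd.
  set p := ar s TR _ in hrec hbnd.
  have szr := size_arc_record en lab x.
  have {}hrec : holds (rw s') p (arc_record en lab x).
    by apply: holds_ext hrec => j hj; apply: hlow; clear -hj hbnd; lia.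
  have [r0 r1 r2 r3 r4] := holds_record hrec.
  do 3!wp_step; apply: (@wp_piece _ _ _ _ _ (word_code (arc_word lab x))).
  + by rewrite /= hTR' hm' hi -/p.
  + by rewrite /= hTR' hm' hi -/p r3 size_word_code size_arc_word.
  + by rewrite /= hTR' hm' hi -/p hdst size_word_code size_arc_word; clear -szr hbnd; lia.
  rewrite /= hTR' hm' hi -/p hdst size_word_code size_arc_word => s2 w2 low2 dst2 t2 [k1 k2 k3 k4].
  have r2' : rw s2 (p + 2) = Posz (arc_head en x) by rewrite low2 ?r2 //; clear -szr hbnd; lia.
  have r3' : rw s2 (p + 3) = Posz (size (lab x.1)) by rewrite low2 ?r3 //; clear -szr hbnd; lia.
  have kp : vr s2 xp = p by rewrite k1 //= hTR' hm' hi.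
  have twE := trail_word_rcons x0 iC; rewrite -/x in twE.
  have szE : size (trail_word (take i.+1 C)) = size (trail_word (take i C)) + size (lab x.1).
    by rewrite twE size_cat size_arc_word.
  do 11!wp_step; exists i.+1; rewrite /= kp r2' r3' dst2 !k2 // !k1 //= hm' hi hwb hTR' hlen addn1 /=.
  have hx : pvert (G := G) a C i.+1 = arc_head en x by rewrite (pvert_head (G := G) a x0 iC).
  split=> //.
  + by split=> //; rewrite szE; split=> //; rewrite addnA.
  + move=> j; rewrite leq_eqVlt => /predU1P[->|]; first by rewrite hx !eqxx szE.
    rewrite ltnS => ji; have [h1 h2 [h3 h4 h5]] := harr j ji.
    have -> : (j == i.+1) = false by apply: ltn_eqF; rewrite ltnS.
    split=> //.
    case: eqP => [E|_]; last by split=> //; apply: leqW.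
    by split=> //; [exact: leqW | rewrite hx; apply: val_inj; rewrite /= E].
  + rewrite twE /word_code map_cat holds_cat size_map; split; last by move: w2; rewrite hlen.
    apply: holds_ext hW => j; rewrite size_map => hj; apply: low2.
    by rewrite hlen; clear -hj; lia.
  + split; last by rewrite t2 /= ht szE; clear; slia.
    by move=> j jB; rewrite low2 ?hlow //; clear -jB; lia.
- move=> s' [i [iC [hm' hi hwb hTR' [hlen hdst]] harr hW [hlow ht]]] /= d0.
  have iE : i = size C by move: d0; rewrite hm' hi; clear -iC; lia.
  rewrite iE take_size in hlen hW ht; rewrite iE in harr; split=> //.
  + by move=> q qC; have [] := harr q qC.
  + by move=> q qC; have [] := harr q qC.
  + by move=> q qC; have [_ _ []] := harr q qC.
  + by split=> //=; rewrite ht; clear; slia.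
Qed.

Lemma wp_first_visits s (Q : astate -> Prop) : vr s xm = size C -> stored_PV s ->
  (forall s', stored_FST s' -> tm s' <= tm s + (3 * size C + 5) ->
     keeps first_visits s s' -> Q s') ->
  wp first_visits Q s.
Proof.
move=> hm hPV post.
suff : wp first_visits (fun s' => stored_FST s' /\ tm s' <= tm s + (3 * size C + 5)) s.
  by move=> /wp_keeps/wp_conseq; apply => s' [[h1 h2] h5]; apply: post.
pose I s' := exists i, [/\ i <= (size C).+1, vr s' xi = i, ar s' PV = ar s PV,
  forall q, i <= q <= size C -> [/\ i <= ar s' FST (pvert (G := G) a C q),
    ar s' FST (pvert (G := G) a C q) <= q &
    pvert (G := G) a C (ar s' FST (pvert (G := G) a C q)) = pvert (G := G) a C q] &
  tm s' + 3 * i = tm s + 1 + 3 * (size C).+1].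
do 2!wp_step; apply: (@wp_while _ _ (tm s + 1 + 3 * (size C).+1) I).
- exists (size C).+1; rewrite /= hm addn1; split=> //.
  by move=> q hq; exfalso; clear -hq; lia.
- by move=> s' [i [_ _ _ _ <-]]; apply: leq_addr.
- move=> s' [[|i] [iC hi hPV' hF ht]] /= d0; first by rewrite hi in d0.
  do 3!wp_step; exists i; rewrite /= hi hPV' subn1 /= hPV //.
  split=> //; [exact: ltnW | | by clear -ht; lia].
  move=> q; have [-> _|qi] := eqVneq q i.
    by rewrite eqxx; split.
  move=> hq; have hq' : i < q <= size C by clear -hq qi; lia.
  have [h1 h2 h3] := hF q hq'.
  case: eqP => [E|_]; last by split=> //; exact: ltnW.
  by split=> //; [clear -hq; lia | apply/esym/val_inj].
- move=> s' [i [iC hi hPV' hF ht]] /= d0; have i0 : i = 0 by rewrite -hi.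
  rewrite i0 in hF ht; split; last by rewrite /=; clear -ht; lia.
  move=> q qC /=; have [_ h1 h2] := hF q qC.
  have qM : q < #|edge G|.+1 by rewrite -(size_eulerian eC).
  have [f1 f2 f3] := first_visitP eC qM.
  apply/eqP; rewrite eqn_leq; apply/andP; split.
    have fC := leq_trans f1 qC.
    by have [_ + _] := hF _ fC; rewrite f3.
  rewrite -{1}h2; apply: index_nth.
  by rewrite /= size_map ltnS; apply: leq_trans h1 qC.
Qed.

(** [letter_code] turns inversion of a letter into a change of sign, so a backward copy with
    [Cpy true] produces the inverse word. *)
Lemma nth_word_inv (w : word k) j : j < size w ->
  nth 0%R (word_code (word_inv w)) j = (- nth 0%R (word_code w) (size w - 1 - j))%R.
Proof.
move=> jw; have [y0 _] : exists y0, y0 \in w by case: w jw => // y0 *; exists y0; rewrite mem_head.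
have jw' : size w - 1 - j < size w by clear -jw; lia.
rewrite /word_code /word_inv map_rev nth_rev ?size_map // -map_comp.
rewrite -add1n subnDA !(nth_map y0) //.
by rewrite /= /letter_code /=; case: (nth _ _ _) => i [] //=; rewrite GRing.opprK.
Qed.

Lemma wp_inverse_word s (w : word k) (Q : astate -> Prop) : vr s xlen = size w ->
  holds (rw s) (vr s xwb) (word_code w) ->
  (forall s', vr s' xl = size w -> vr s' xqb = vr s xwb + size w + size w ->
     holds (rw s') (vr s xwb + size w) (word_code (word_inv w)) ->
     (forall j, j < vr s xwb + size w -> rw s' j = rw s j) ->
     tm s' <= tm s + (3 * size w + 4) -> keeps inverse_word s s' -> Q s') ->
  wp inverse_word Q s.
Proof.
move=> hlen hw post; set B := vr s xwb in hw post *.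
suff : wp inverse_word (fun s' => [/\ vr s' xl = size w, vr s' xqb = B + size w + size w,
     holds (rw s') (B + size w) (word_code (word_inv w)),
     (forall j, j < B + size w -> rw s' j = rw s j) & tm s' <= tm s + (3 * size w + 4)]) s.
  by move=> /wp_keeps/wp_conseq; apply => s' [[h1 h2 h3 h4 h5] h6]; apply: post.
pose I s' := exists j, [/\ j <= size w,
  [/\ vr s' xl = size w, vr s' xqb = B + size w + size w, vr s' xwb = B & vr s' xj = j],
  forall i, i < j -> rw s' (B + size w + i) = nth 0%R (word_code (word_inv w)) i,
  forall i, i < B + size w -> rw s' i = rw s i & tm s' = tm s + 3 + 3 * j].
have szi : size (word_code (word_inv w)) = size w by rewrite size_map /word_inv size_rev size_map.
do 6!wp_step; apply: (@wp_while _ _ (tm s + 3 + 3 * size w) I).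
- exists 0; rewrite /= hlen; split=> //; clear; lia.
- by move=> s' [j [jw _ _ _ ->]]; clear -jw; lia.
- move=> s' [j [jw [h1 h2 h3 h4] hi hlow ht]] /= d0.
  have {}jw : j < size w by rewrite h1 h4 subn_gt0 in d0.
  do 3!wp_step; exists j.+1; rewrite /= h1 h2 h3 h4 addn1; split=> //.
  + move=> i; rewrite ltnS leq_eqVlt => /predU1P[->|ij].
      rewrite updr_eq nth_word_inv // hlow; last by clear -jw; lia.
      by rewrite hw // size_word_code; clear -jw; lia.
    by rewrite updr_neq ?hi //; clear -ij; lia.
  + by move=> i ib; rewrite updr_neq ?hlow //; clear -ib; lia.
  + by rewrite ht; clear; lia.
- move=> s' [j [jw [h1 h2 h3 h4] hi hlow ht]] /= d0.
  have jE : j = size w by move: d0; rewrite h1 h4; clear -jw; lia.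
  rewrite jE in hi; split=> //=; last by rewrite ht jE; clear; slia.
  by move=> i; rewrite szi; apply: hi.
Qed.

End Store.
End Positions.

(** * Correctness of the scan for blocks *)

Section Blocks.
Variables (orc : seq int -> bool -> Prop) (phi : nat -> nat).
Local Notation wp := (wp orc phi).
Implicit Types (s : astate).

Variables (V : eqType) (N : nat) (c : nat -> V) (F La : nat -> nat).
Local Notation M := N.+1.
Hypothesis F_le : forall q, q < M -> F q <= q.
Hypothesis F_vert : forall q, q < M -> c (F q) = c q.
Hypothesis F_eq : forall q q', q < M -> q' < M -> c q = c q' -> F q = F q'.
Hypothesis La_ge : forall q, q < M -> q <= La q.
Hypothesis La_lt : forall q, q < M -> La q < M.
Hypothesis La_vert : forall q, q < M -> c (La q) = c q.
Hypothesis La_eq : forall q q', q < M -> q' < M -> c q = c q' -> La q = La q'.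

Local Notation scanned_state bd i sp s kap :=
  (scanned M c F La bd i sp (ar s ST) (ar s ML) (ar s PAR) kap).

Lemma wp_merge_blocks s i sp kap (Q : astate -> Prop) : i < M -> F i < i ->
  scanned_state i i sp s kap -> 0 < sp -> vr s xsp = sp -> vr s xp = F i ->
  (forall s' sp' kap', scanned_state i i sp' s' kap' -> 0 < sp' ->
     ar s' ST sp' <= F i -> vr s' xsp = sp' -> tm s' + 6 * sp' <= tm s + 6 * sp + 1 ->
     keeps merge_blocks s s' -> Q s') ->
  wp merge_blocks Q s.
Proof.
move=> iM Fi I0 sp0 hsp hp post.
suff : wp merge_blocks (fun s' => exists sp' kap', [/\ scanned_state i i sp' s' kap', 0 < sp',
     ar s' ST sp' <= F i, vr s' xsp = sp' & tm s' + 6 * sp' <= tm s + 6 * sp + 1]) s.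
  by move=> /wp_keeps/wp_conseq; apply => s' [[sp' [kap' [h1 h2 h3 h4 h5]]] h6]; apply: (post s' sp' kap').
pose I s' := exists sp' kap', [/\ scanned_state i i sp' s' kap', 0 < sp', vr s' xsp = sp',
  vr s' xp = F i & tm s' + 6 * sp' <= tm s + 6 * sp].
apply: (@wp_while _ _ (tm s + 6 * sp) I).
- by exists sp, kap.
- by move=> s' [sp' [kap' [_ _ _ _ h]]]; apply: leq_trans h; apply: leq_addr.
- move=> s' [[|sp'] [kap' [I1 sp'p hsp' hp' ht]]] /= d0; first by [].
  rewrite hsp' hp' subn_gt0 in d0.
  have [sp'0 I2] : 0 < sp' /\ scanned M c F La i i sp' (ar s' ST)
      (set_at (ar s' ML) sp' (maxn (ar s' ML sp') (ar s' ML sp'.+1)))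
      (set_at (ar s' PAR) (ar s' ST sp'.+1) (ar s' ST sp'))
      (fun q => if kap' q == ar s' ST sp'.+1 then ar s' ST sp' else kap' q).
    by eapply scanned_merge; eassumption.
  do 5!wp_step; exists sp'; eexists; rewrite /= hsp' subn1 /= -maxnE.
  split; [exact: I2|by []|by []|by []|].
  by clear -ht; lia.
- move=> s' [sp' [kap' [I1 sp'0 hsp' hp' ht]]] /= d0.
  exists sp', kap'; split=> //=; last by clear -ht; lia.
  by move: d0; rewrite hsp' hp' => /eqP; rewrite subn_eq0.
Qed.

Lemma wp_blocks s (Q : astate -> Prop) : vr s xm = N ->
  (forall q, q < M -> ar s FST (ar s PV q) = F q) ->
  (forall q, q < M -> ar s LST (ar s PV q) = La q) ->
  (forall s' sp kap, scanned_state M M sp s' kap ->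
     tm s' <= tm s + (20 * M + 3) -> keeps blocks s s' -> Q s') ->
  wp blocks Q s.
Proof.
move=> hm hF hLa post.
suff : wp blocks (fun s' => exists sp kap, scanned_state M M sp s' kap /\
     tm s' <= tm s + (20 * M + 3)) s.
  by move=> /wp_keeps/wp_conseq; apply => s' [[sp' [kap' [h1 h2]]] h6]; apply: (post s' sp' kap').
(* Six times the stack height is a potential: a merge takes at most six ticks and lowers the stack
   by one, so it is paid for by an earlier push. *)
pose I s' := exists i sp kap, [/\ i <= M, scanned_state i i sp s' kap,
  [/\ vr s' xsp = sp, vr s' xi = i & vr s' xm = N],
  [/\ ar s' PV = ar s PV, ar s' FST = ar s FST & ar s' LST = ar s LST] &
  tm s' + 20 * (M - i) + 6 * sp <= tm s + 2 + 20 * M].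
do 4!wp_step; apply: (@wp_while _ _ (tm s + 2 + 20 * M) I).
- exists 0, 0, id; split=> //=; first exact: scanned0.
  by clear; lia.
- by move=> s' [i [sp [kap [_ _ _ _ h]]]]; clear -h; lia.
- move=> s' [i [sp [kap [iM I1 [hsp hi hm'] [hPV hFST hLST] ht]]]] /= d0.
  have {}iM : i < M by move: d0; rewrite hm' hi; clear; lia.
  (* The common end of both branches: the top block is closed if it ends at [i]. *)
  have fin s2 sp2 kap2 : scanned_state i i.+1 sp2 s2 kap2 -> 0 < sp2 -> kap2 i = ar s2 ST sp2 ->
      vr s2 xsp = sp2 -> vr s2 xi = i -> vr s2 xm = N ->
      ar s2 PV = ar s PV -> ar s2 FST = ar s FST -> ar s2 LST = ar s LST ->
      tm s2 + 20 * (M - i) + 6 * sp2 <= tm s + 2 + 20 * M + 15 ->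
      wp (Ifc (Ar ML ($xsp) [-] $xi) skip (xsp <~ $xsp [-] Cn 1);; xi <~ $xi [+] Cn 1) I s2.
    move=> I2 sp20 k2i hsp2 hi2 hm2 hPV2 hFST2 hLST2 ht2.
    apply: wp_seq; apply: wp_if; rewrite /= hsp2 hi2 => hML.
      do 2!wp_step; exists i.+1, sp2, kap2; rewrite /= hi2 addn1; split=> //.
        by rewrite subn_gt0 in hML; eapply scanned_keep; eassumption.
      by clear -ht2 iM; lia.
    do 2!wp_step; exists i.+1, sp2.-1, kap2; rewrite /= hsp2 hi2 addn1 subn1; split=> //.
      by move/eqP: hML; rewrite subn_eq0 => hML; eapply scanned_pop; eassumption.
    by clear -ht2 iM sp20; lia.
  have hp : ar s' FST (ar s' PV i) = F i by rewrite hPV hFST hF.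
  have hl : ar s' LST (ar s' PV i) = La i by rewrite hPV hLST hLa.
  do 5!wp_step; apply: wp_if; rewrite /= hi hp => dF.
    rewrite subn_gt0 in dF.
    have sp0 : 0 < sp.
      have [j + _] : exists2 j, 0 < j <= sp & kap (F i) = ar s' ST j by eapply join_live; eassumption.
      by case/andP=> /leq_trans; apply.
    apply: (@wp_merge_blocks _ i sp kap) => // s2 sp2 kap2 I2 sp20 le2 hsp2 ht2 [k1 k2 k3 k4].
    have e1 : vr s2 xi = i by rewrite k1.
    have e2 : vr s2 xm = N by rewrite k1.
    have e3 : ar s2 PV = ar s PV by rewrite k2.
    have e4 : ar s2 FST = ar s FST by rewrite k2.
    have e5 : ar s2 LST = ar s LST by rewrite k2.
    apply: (fin s2 sp2 (set_at kap2 i (ar s2 ST sp2))) => //.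
    + by eapply scanned_add; eassumption.
    + by rewrite /set_at eqxx.
    + by move: ht2 => /=; clear -ht; lia.
  have Fi : F i = i by apply/eqP; rewrite eqn_leq F_le //= -subn_eq0 dF.
  do 7!wp_step; apply: (fin _ sp.+1 (set_at kap i i)); rewrite //= ?hsp ?addn1 //.
  + by rewrite hl hi; eapply scanned_push; eassumption.
  + by rewrite /set_at !eqxx hi.
  + by clear -ht; lia.
- move=> s' [i [sp [kap [iM I1 [hsp hi hm'] _ ht]]]] /= d0.
  have iE : i = M by move: d0; rewrite hm' hi; clear -iM; lia.
  by rewrite iE in I1 ht; exists sp, kap; split=> //=; clear -ht; lia.
Qed.

End Blocks.

(** * Queries and updates of the class tables *)

Section CheckLabels.
Variables (k : nat) (gT : groupType) (g : 'I_k -> gT) (phi : nat -> nat).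
Hypothesis phi_homo : {homo phi : i j / i <= j}.
Local Notation wp := (wp (word_oracle g) phi).
Implicit Types (s : astate).
Local Open Scope group_scope.

Variables (W : word k) (B : nat) (R0 : nat -> int).
Local Notation l := (size W).
Local Notation QB := (B + l + l)%N.

Definition prefix_label j : gT := word_val g (take j W).
Local Notation Lam := prefix_label.

(** The word occupies [l] cells from [B], its inverse the next [l], and queries are assembled from
    [QB] on. Below [B] the memory stays as in [R0], since the input is read again when the trail is
    printed. *)
Definition word_memory s : Prop :=
  [/\ vr s xwb = B, vr s xl = l, vr s xqb = QB,
      holds (rw s) B (word_code W) & holds (rw s) (B + l) (word_code (word_inv W)) /\
        forall j, (j < B)%N -> rw s j = R0 j].

Lemma word_memory_keep s s' : word_memory s ->
  vr s' xwb = vr s xwb -> vr s' xl = vr s xl -> vr s' xqb = vr s xqb ->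
  (forall j, j < QB -> rw s' j = rw s j)%N -> word_memory s'.
Proof.
case=> h1 h2 h3 h4 [h5 h6] e1 e2 e3 low; split; rewrite ?e1 ?e2 ?e3 //; last split.
  apply: holds_ext h4 => j; rewrite size_word_code => hj; apply: low; clear -hj; lia.
  apply: holds_ext h5 => j; rewrite size_word_code /word_inv size_rev size_map => hj.
  by apply: low; clear -hj; lia.
by move=> j jB; rewrite low ?h6 // -addnA ltn_addr.
Qed.

Lemma holds_prefix s j : word_memory s -> (j <= l)%N ->
  holds (rw s) B (word_code (take j W)).
Proof.
case=> _ _ _ + _ _; rewrite -{1}(cat_take_drop j W) /word_code map_cat holds_cat.
by case.
Qed.

Lemma word_inv_cat (w w' : word k) : word_inv (w ++ w') = word_inv w' ++ word_inv w.
Proof. by rewrite /word_inv map_cat rev_cat. Qed.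

Lemma size_word_inv (w : word k) : size (word_inv w) = size w.
Proof. by rewrite /word_inv size_rev size_map. Qed.

Lemma holds_suffix s j : word_memory s -> (j <= l)%N ->
  holds (rw s) (B + l + (l - j)) (word_code (word_inv (take j W))).
Proof.
case=> _ _ _ _ [h _] jl.
have E : word_code (word_inv W) =
    word_code (word_inv (drop j W)) ++ word_code (word_inv (take j W)).
  by rewrite /word_code -map_cat -word_inv_cat cat_take_drop.
by move: h; rewrite E holds_cat size_word_code size_word_inv size_drop => -[].
Qed.

Lemma wp_append s e1 e2 buf (w : word k) (Q : astate -> Prop) :
  word_memory s -> holds (rw s) QB (word_code buf) -> vr s xdst = (QB + size buf)%N ->
  holds (rw s) (ev s e1) (word_code w) -> ev (setv s xsrc (ev s e1)) e2 = size w ->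
  (ev s e1 + size w <= QB)%N ->
  (forall s', word_memory s' -> holds (rw s') QB (word_code (buf ++ w)) ->
     vr s' xdst = (QB + size (buf ++ w))%N -> tm s' = (tm s + (5 * size w + 3))%N ->
     keeps (piece e1 e2) s s' -> Q s') ->
  wp (piece e1 e2) Q s.
Proof.
move=> mem hb hd hw he2 le post.
apply: (@wp_piece _ _ _ _ _ (word_code w)); rewrite ?size_word_code //.
  by rewrite hd; apply: leq_trans le (leq_addr _ _).
move=> s' h1 h2 h3 h4 h5; have [k1 k2 k3 k4] := h5.
have low j : (j < QB)%N -> rw s' j = rw s j by move=> jq; apply: h2; rewrite hd ltn_addr.
apply: post => //.
- by apply: word_memory_keep mem _ _ _ low; rewrite k1.
- rewrite /word_code map_cat holds_cat size_map -hd; split=> //.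
  apply: holds_ext hb => j; rewrite size_map -hd => /andP[_ jd]; exact: h2.
- by rewrite h3 hd size_cat addnA.
Qed.

Definition half (ct cs j cj : nat) : word k :=
  take ct W ++ word_inv (take cs W) ++ take j W ++ word_inv (take cj W).

Lemma half_val ct cs j cj :
  word_val g (half ct cs j cj) = Lam ct / Lam cs * (Lam j / Lam cj).
Proof. by rewrite /half !word_val_cat !word_val_inv !mulgA. Qed.

Lemma size_half ct cs j cj : (ct <= l -> cs <= l -> j <= l -> cj <= l ->
  size (half ct cs j cj) = ct + cs + j + cj)%N.
Proof. by move=> *; rewrite /half !size_cat !size_word_inv !size_takel // !addnA. Qed.

Lemma wp_half_word s buf ct cs j cj (Q : astate -> Prop) :
  word_memory s -> holds (rw s) QB (word_code buf) -> vr s xdst = (QB + size buf)%N ->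
  vr s xct = ct -> vr s xcs = cs -> vr s xj = j -> vr s xcj = cj ->
  (ct <= l)%N -> (cs <= l)%N -> (j <= l)%N -> (cj <= l)%N ->
  (forall s', word_memory s' -> holds (rw s') QB (word_code (buf ++ half ct cs j cj)) ->
     vr s' xdst = (QB + size (buf ++ half ct cs j cj))%N ->
     (tm s' <= tm s + (20 * l + 12))%N -> keeps half_word s s' -> Q s') ->
  wp half_word Q s.
Proof.
move=> mem hb hd hct hcs hj hcj lct lcs lj lcj post.
suff : wp half_word (fun s' => [/\ word_memory s',
     holds (rw s') QB (word_code (buf ++ half ct cs j cj)),
     vr s' xdst = (QB + size (buf ++ half ct cs j cj))%N &
     (tm s' <= tm s + (20 * l + 12))%N]) s.
  by move=> /wp_keeps/wp_conseq; apply => s' [[h1 h2 h3 h4] h5]; apply: post.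
have pre s' : word_memory s' -> ev s' ($xwb) = B by case.
have suf s' x : word_memory s' -> (vr s' x <= l)%N ->
    ev s' ($xwb [+] $xl [+] ($xl [-] $x)) = (B + l + (l - vr s' x))%N.
  by case=> /= -> -> _ _ _.
apply: wp_seq; apply: (@wp_append _ _ _ buf (take ct W)) => //.
- by rewrite pre //; apply: holds_prefix.
- by rewrite /= hct size_takel.
- by rewrite pre // size_takel //; clear -lct; lia.
move=> s1 m1 b1 d1 t1 [k1 _ _ _].
have a1 : vr s1 xcs = cs by rewrite k1.
apply: wp_seq; apply: (@wp_append _ _ _ (buf ++ take ct W) (word_inv (take cs W))) => //.
- by rewrite suf ?a1 //; apply: holds_suffix.
- by rewrite /= a1 size_word_inv size_takel.
- by rewrite suf ?a1 // size_word_inv size_takel //; clear -lcs; lia.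
move=> s2 m2 b2 d2 t2 [k2 _ _ _].
have a2 : vr s2 xj = j by rewrite k2 // k1.
apply: wp_seq; apply: (@wp_append _ _ _ ((buf ++ take ct W) ++ word_inv (take cs W)) (take j W)) => //.
- by rewrite pre //; apply: holds_prefix.
- by rewrite /= a2 size_takel.
- by rewrite pre // size_takel //; clear -lj; lia.
move=> s3 m3 b3 d3 t3 [k3 _ _ _].
have a3 : vr s3 xcj = cj by rewrite k3 // k2 // k1.
apply: (@wp_append _ _ _ (((buf ++ take ct W) ++ word_inv (take cs W)) ++ take j W) (word_inv (take cj W))) => //.
- by rewrite suf ?a3 //; apply: holds_suffix.
- by rewrite /= a3 size_word_inv size_takel.
- by rewrite suf ?a3 // size_word_inv size_takel //; clear -lcj; lia.
move=> s4 m4 b4 d4 t4 _.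
have E : buf ++ half ct cs j cj =
    (((buf ++ take ct W) ++ word_inv (take cs W)) ++ take j W) ++ word_inv (take cj W).
  by rewrite /half -!catA.
rewrite E; split=> //; rewrite t4 t3 t2 t1 !size_word_inv !size_takel //.
by clear -lct lcs lj lcj; lia.
Qed.

(** Two halves of at most [4 l] letters, copied at five ticks per letter, give [40 l]. *)
Definition query_time := (40 * l + 35 + phi (8 * l))%N.

Lemma wp_query_classes s u t o (Q : astate -> Prop) (cls := fun j => ar s CLS (o + j)) :
  word_memory s -> (u <= l)%N -> (t <= l)%N -> (forall j, j <= l -> cls j <= l)%N ->
  vr s xo = o -> vr s xcs = cls u -> vr s xct = cls t ->
  (forall s', word_memory s' ->
     (vr s' xbad = 0%N <-> vr s xbad = 0%N /\ forall j, (j <= l)%N -> query_ok Lam cls u t j) ->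
     (tm s' <= tm s + (l.+1 * query_time + 2))%N -> keeps query_classes s s' -> Q s') ->
  wp query_classes Q s.
Proof.
move=> mem ul tl cl ho hcs hct post.
suff : wp query_classes (fun s' => [/\ word_memory s',
     (vr s' xbad = 0%N <-> vr s xbad = 0%N /\ forall j, (j <= l)%N -> query_ok Lam cls u t j) &
     (tm s' <= tm s + (l.+1 * query_time + 2))%N]) s.
  by move=> /wp_keeps/wp_conseq; apply => s' [[h1 h2 h3] h5]; apply: post.
pose I s' := exists j, [/\ (j <= l.+1)%N, word_memory s',
  [/\ vr s' xo = o, vr s' xcs = cls u, vr s' xct = cls t, vr s' xj = j & ar s' CLS = ar s CLS],
  (vr s' xbad = 0%N <-> vr s xbad = 0%N /\ forall i, (i < j)%N -> query_ok Lam cls u t i) &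
  (tm s' + (l.+1 - j) * query_time <= tm s + 1 + l.+1 * query_time)%N].
do 2!wp_step; apply: (@wp_while _ _ (tm s + 1 + l.+1 * query_time)%N I).
- by exists 0%N; split=> //=; split=> [h|[]].
- by move=> s' [j [_ _ _ _ h]]; apply: leq_trans h; apply: leq_addr.
- move=> s' [j [_ mem' [ho' hcs' hct' hj hC] hbad ht]] /= d0.
  have jl : (j <= l)%N by case: mem' d0 => _ -> _ _ _; rewrite hj; clear; lia.
  have cjE : ar s' CLS (vr s' xo + vr s' xj) = cls j by rewrite ho' hj hC.
  have [m1 m2 m3 m4 m5] := mem'.
  do 5!wp_step.
  apply: (@wp_half_word _ [::] (cls t) (cls u) j (cls j)); rewrite //= ?m3 ?addn0 //; try exact: cl.
  move=> s2 mem2 b2 d2 t2 [k1 k2 _ _].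
  apply: wp_seq; apply: (@wp_half_word _ (half (cls t) (cls u) j (cls j)) (cls t) (cls u) j (cls j));
    rewrite //; try exact: cl; try by rewrite k1.
  move=> s3 mem3 b3 d3 t3 [k3 k4 _ _].
  set h := half _ _ _ _ in b2 d2 b3 d3.
  have szh : (size (h ++ h) <= 8 * l)%N.
    rewrite size_cat /h size_half //; try exact: cl.
    by have := cl u ul; have := cl t tl; have := cl j jl; clear -jl; lia.
  have [n1 n2 n3 n4 n5] := mem3.
  apply: wp_seq; apply: (wp_qry (r := word_val g (h ++ h) == 1)).
    rewrite /= n3 d3 addKn -(size_word_code (h ++ h)) holds_map //.
    by exists (h ++ h).
  rewrite /= d3 n3 addKn.
  have qE : (word_val g (h ++ h) == 1) = query_ok Lam cls u t j.
    by rewrite word_val_cat half_val.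
  have phl : (phi (size (h ++ h)) <= phi (8 * l))%N by apply: phi_homo.
  have qtE : query_time = (40 * l + 35 + phi (8 * l))%N by [].
  have tE : ((l.+1 - j) * query_time = (l.+1 - j.+1) * query_time + query_time)%N.
    by rewrite -mulSnr subnSK.
  apply: wp_seq; apply: wp_if => /= hq.
    have qok : query_ok Lam cls u t j by move: hq; rewrite qE; case: query_ok.
    do 2!wp_step; exists j.+1; split=> //=.
    + by kv k3; kv k1; ka k4; ka k2; rewrite /= hj addn1.
    + rewrite k3 // k1 //= hbad; split=> -[h1 h2]; split=> // i.
        by rewrite ltnS leq_eqVlt => /predU1P[->//|]; apply: h2.
      by move=> ij; apply: h2; apply: ltnW.
    + by move: ht t2 t3 phl qtE => /=; rewrite tE; move: query_time (phi _) (phi _) => qt p1 p2; clear; slia.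
  have qok : ~~ query_ok Lam cls u t j by move: hq; rewrite qE; case: query_ok.
  do 2!wp_step; exists j.+1; split=> //=.
  + by kv k3; kv k1; ka k4; ka k2; rewrite /= hj addn1.
  + by split=> // -[_ /(_ j (ltnSn j))]; rewrite (negPf qok).
  + by move: ht t2 t3 phl qtE => /=; rewrite tE; move: query_time (phi _) (phi _) => qt p1 p2; clear; slia.
- move=> s' [j [jl mem' [ho' hcs' hct' hj hC] hbad ht]] /= d0.
  have jE : j = l.+1 by case: mem' d0 => _ -> _ _ _; rewrite hj; clear -jl; lia.
  rewrite jE in hbad ht; split=> //=.
  by clear -ht; lia.
Qed.

Lemma wp_join_classes s o (Q : astate -> Prop) : vr s xl = l -> vr s xo = o ->
  (forall s', (forall j, (j <= l)%N -> ar s' CLS (o + j) =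
        join (fun j => ar s CLS (o + j)) (vr s xcs) (vr s xct) j) ->
     (forall i, ~~ (o <= i <= o + l)%N -> ar s' CLS i = ar s CLS i) ->
     (tm s' <= tm s + (4 * l.+1 + 2))%N -> keeps join_classes s s' -> Q s') ->
  wp join_classes Q s.
Proof.
move=> hl ho post.
suff : wp join_classes (fun s' => [/\ forall j, (j <= l)%N -> ar s' CLS (o + j) =
        join (fun j => ar s CLS (o + j)) (vr s xcs) (vr s xct) j,
     (forall i, ~~ (o <= i <= o + l)%N -> ar s' CLS i = ar s CLS i) &
     (tm s' <= tm s + (4 * l.+1 + 2))%N]) s.
  by move=> /wp_keeps/wp_conseq; apply => s' [[h1 h2 h3] h5]; apply: post.
pose I s' := exists j, [/\ (j <= l.+1)%N,
  [/\ vr s' xl = l, vr s' xo = o, vr s' xcs = vr s xcs, vr s' xct = vr s xct & vr s' xj = j],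
  forall i, (i < j)%N -> ar s' CLS (o + i) =
        join (fun j => ar s CLS (o + j)) (vr s xcs) (vr s xct) i,
  forall i, ~~ (o <= i < o + j)%N -> ar s' CLS i = ar s CLS i &
  (tm s' <= tm s + 1 + 4 * j)%N].
do 2!wp_step; apply: (@wp_while _ _ (tm s + 1 + 4 * l.+1)%N I).
- by exists 0%N; split=> //=; clear; lia.
- by move=> s' [j [jl _ _ _ h]]; clear -h jl; lia.
- move=> s' [j [_ [h1 h2 h3 h4 h5] hin hout ht]] /= d0.
  have jl : (j <= l)%N by move: d0; rewrite h1 h5; clear; lia.
  have old : ar s' CLS (o + j) = ar s CLS (o + j) by apply: hout; clear; lia.
  apply: wp_seq; apply: wp_if; rewrite ev_Eqe /= h2 h4 h5 old => hc.
    have {}hc : ar s CLS (o + j) = vr s xct by apply/eqP; case: eqP hc.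
    do 2!wp_step; exists j.+1; rewrite /= h2 h3 h5 addn1; split=> //.
    + move=> i; rewrite ltnS leq_eqVlt => /predU1P[->|ij]; first by rewrite eqxx /join hc eqxx.
      rewrite ifN ?hin //; clear -ij; lia.
    + by move=> i hi; rewrite ifN ?hout //; clear -hi; lia.
    + by clear -ht; lia.
  have {}hc : ar s CLS (o + j) <> vr s xct by move: hc; case: eqP.
  do 2!wp_step; exists j.+1; rewrite /= h5 addn1; split=> //.
  + move=> i; rewrite ltnS leq_eqVlt => /predU1P[->|ij]; last exact: hin.
    by rewrite old /join; case: eqP.
  + by move=> i hi; rewrite hout //; clear -hi; lia.
  + by clear -ht; lia.
- move=> s' [j [jl [h1 h2 h3 h4 h5] hin hout ht]] /= d0.
  have jE : j = l.+1 by move: d0; rewrite h1 h5; clear -jl; lia.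
  rewrite jE in hin hout ht; split=> //=; last by clear -ht; lia.
  by move=> i hi; apply: hout; clear -hi; lia.
Qed.

Lemma wp_init_classes s (Q : astate -> Prop) (o := vr s xoff) : vr s xl = l ->
  (forall s', (forall j, (j <= l)%N -> ar s' CLS (o + j) = j) ->
     (forall i, ~~ (o <= i <= o + l)%N -> ar s' CLS i = ar s CLS i) ->
     (tm s' <= tm s + (3 * l.+1 + 2))%N -> keeps init_classes s s' -> Q s') ->
  wp init_classes Q s.
Proof.
move=> hl post.
suff : wp init_classes (fun s' => [/\ forall j, (j <= l)%N -> ar s' CLS (o + j) = j,
     (forall i, ~~ (o <= i <= o + l)%N -> ar s' CLS i = ar s CLS i) &
     (tm s' <= tm s + (3 * l.+1 + 2))%N]) s.
  by move=> /wp_keeps/wp_conseq; apply => s' [[h1 h2 h3] h5]; apply: post.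
pose I s' := exists j, [/\ (j <= l.+1)%N,
  [/\ vr s' xl = l, vr s' xoff = o & vr s' xj = j],
  forall i, (i < j)%N -> ar s' CLS (o + i) = i,
  forall i, ~~ (o <= i < o + j)%N -> ar s' CLS i = ar s CLS i &
  (tm s' <= tm s + 1 + 3 * j)%N].
do 2!wp_step; apply: (@wp_while _ _ (tm s + 1 + 3 * l.+1)%N I).
- by exists 0%N; split=> //=; clear; lia.
- by move=> s' [j [jl _ _ _ h]]; clear -h jl; lia.
- move=> s' [j [_ [h1 h2 h5] hin hout ht]] /= d0.
  have jl : (j <= l)%N by move: d0; rewrite h1 h5; clear; lia.
  do 3!wp_step; exists j.+1; rewrite /= h2 h5 addn1; split=> //.
  + move=> i; rewrite ltnS leq_eqVlt => /predU1P[->|ij]; first by rewrite eqxx.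
    rewrite ifN ?hin //; clear -ij; lia.
  + by move=> i hi; rewrite ifN ?hout //; clear -hi; lia.
  + by clear -ht; lia.
- move=> s' [j [jl [h1 h2 h5] hin hout ht]] /= d0.
  have jE : j = l.+1 by move: d0; rewrite h1 h5; clear -jl; lia.
  rewrite jE in hin hout ht; split=> //=; last by clear -ht; lia.
  by move=> i hi; apply: hout; clear -hi; lia.
Qed.

End CheckLabels.

Section ClassesExt.
Variables (gT : groupType) (l : nat) (Lam : nat -> gT) (cls cls' : nat -> nat).
Hypothesis clsE : forall j, j <= l -> cls' j = cls j.

Lemma offset_ext j : j <= l -> offset Lam cls' j = offset Lam cls j.
Proof. by move=> jl; rewrite /offset clsE. Qed.

Lemma classes_ext D : classes l Lam cls D -> classes l Lam cls' D.
Proof.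
case=> h1 h2 h3; split=> j jl; first by rewrite clsE // h1.
  by rewrite clsE // clsE ?h2 // h1.
by rewrite offset_ext //; apply: h3.
Qed.

Lemma offsets_ext : elementary (offsets l Lam cls) -> elementary (offsets l Lam cls').
Proof.
by apply: sub_elementary => _ [j jl ->]; exists j => //; rewrite offset_ext.
Qed.

End ClassesExt.

(** * The test of all blocks *)

Section CheckLoop.
Variables (k : nat) (gT : groupType) (g : 'I_k -> gT) (phi : nat -> nat).
Hypothesis phi_homo : {homo phi : i j / i <= j}.
Local Notation wp := (wp (word_oracle g) phi).
Implicit Types (s : astate).
Variables (W : word k) (B : nat) (R0 : nat -> int).
Local Notation l := (size W).
Local Notation Lam := (prefix_label g W).

Variables (N : nat) (F kap len PARf : nat -> nat).
Local Notation M := N.+1.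
Hypothesis F_le : forall q, q < M -> F q <= q.
Hypothesis F_idem : forall q, q < M -> F (F q) = F q.
Hypothesis kap_F : forall q, q < M -> kap q = kap (F q).
Hypothesis kap_le : forall q, q < M -> kap q <= q.
Hypothesis kap_par : forall x, x < M -> F x = x ->
  [/\ PARf x <= x, F (PARf x) = PARf x, kap (PARf x) = kap x & PARf x = x -> kap x = x].
Hypothesis len_le : forall q, q < M -> len q <= l.

(** Only quotients against first visits are tested, one per position; [block_class_elementary] shows
    that this is enough. *)
Definition block_label i r (z : gT) : Prop :=
  exists q, [/\ q < i, kap q = r & z = (Lam (len q) / Lam (len (F q)))%g].

Definition row s r j := ar s CLS (r * l.+1 + j).

Lemma row_out r r' j : r < r' -> j <= l ->
  ~~ (r' * l.+1 <= r * l.+1 + j <= r' * l.+1 + l).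
Proof.
move=> rr' jl; have : r.+1 * l.+1 <= r' * l.+1 by rewrite leq_mul2r rr' orbT.
by rewrite mulSn; move: (r * _) (r' * _) => x y; clear -jl; lia.
Qed.

Lemma row_out' r r' j : r' < r -> j <= l ->
  ~~ (r' * l.+1 <= r * l.+1 + j <= r' * l.+1 + l).
Proof.
move=> rr' jl; have : r'.+1 * l.+1 <= r * l.+1 by rewrite leq_mul2r rr' orbT.
by rewrite mulSn; move: (r * _) (r' * _) => x y; clear -jl; lia.
Qed.

Definition position_time := l.+1 * (query_time phi W + 7) + 40.

Lemma wp_check_labels s (Q : astate -> Prop) :
  word_memory W B R0 s -> vr s xm = N ->
  (forall q, q < M -> ar s FST (ar s PV q) = F q) ->
  (forall q, q < M -> ar s LEN q = len q) -> ar s PAR = PARf ->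
  (forall s', word_memory W B R0 s' ->
     (vr s' xbad = 0 <-> forall r, elementary (block_label M r)) ->
     tm s' <= tm s + (4 + M * position_time) -> keeps check_labels s s' -> Q s') ->
  wp check_labels Q s.
Proof.
move=> mem hm hF hlen hPAR post.
suff : wp check_labels (fun s' => [/\ word_memory W B R0 s',
     (vr s' xbad = 0 <-> forall r, elementary (block_label M r)) &
     tm s' <= tm s + (4 + M * position_time)]) s.
  by move=> /wp_keeps/wp_conseq; apply => s' [[h1 h2 h3] h5]; apply: post.
(* A zero [xbad] certifies commuting involutions in all rows so far. A nonzero one refutes the
   condition for the complete trail, because later positions only add quotients to the blocks. *)
pose I s' := exists i, [/\ i <= M, word_memory W B R0 s',
  [/\ vr s' xi = i, vr s' xoff = i * l.+1 & vr s' xm = N] /\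
  [/\ ar s' PV = ar s PV, ar s' FST = ar s FST, ar s' LEN = ar s LEN & ar s' PAR = PARf],
  [/\ forall x, x < i -> F x = x -> ar s' REP x = kap x * l.+1,
      forall r, r < i -> classes l Lam (row s' r) (block_label i r) &
      forall q, q < i -> row s' (kap q) (len q) = row s' (kap q) (len (F q))] &
  [/\ vr s' xbad = 0 -> forall r, r < i -> elementary (offsets l Lam (row s' r)),
      vr s' xbad <> 0 -> ~ forall r, elementary (block_label M r) &
      tm s' + (M - i) * position_time <= tm s + 3 + M * position_time]].
do 6!wp_step; apply: (@wp_while _ _ (tm s + 3 + M * position_time) I).
- exists 0; split=> //=.
  by split=> //; rewrite ?subn0; clear; lia.
- by move=> s' [j [_ _ _ _ [_ _ h]]]; apply: leq_trans h; apply: leq_addr.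
- move=> s' [i [_ mem' [[hi hoff hm'] [hPV hFST hLEN hPAR']] [hREP hcls hrow] [hel hbad ht]]] /= d0.
  have iM : i < M by move: d0; rewrite hm' hi; clear; lia.
  have hp : ar s' FST (ar s' PV i) = F i by rewrite hPV hFST hF.
  have FiM : F i < M := leq_ltn_trans (F_le iM) iM.
  have [m1 m2 m3 m4 m5] := mem'.
  do 3!wp_step; apply: wp_init_classes; first exact: m2.
  rewrite /= hoff hi hp => s1 c1 o1 t1 [k1 k2 k3 k4].
  have mem1 : word_memory W B R0 s1.
    by apply: word_memory_keep mem' _ _ _ _; rewrite ?k1 // k3.
  have rowi j : j <= l -> row s1 i j = j by move=> jl; rewrite /row c1.
  have rowlt r j : r < i -> j <= l -> row s1 r j = row s' r j.
    by move=> ri jl; rewrite /row o1 //; apply: row_out.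
  set r0 := kap i; have r0i : r0 <= i := kap_le iM.
  pose D := block_label i.+1.
  have Dsub r z : block_label i r z -> D r z.
    by case=> q [qi kq ->]; exists q; split=> //; apply: ltnW.
  have cls1 r : r <= i -> classes l Lam (row s1 r) (D r).
    rewrite leq_eqVlt => /predU1P[->|ri].
      by apply: (classes_ext (cls := id)) => //; apply: classes_id.
    apply: (classes_ext (cls := row s' r)); first by move=> j; apply: rowlt.
    by apply: classes_sub (hcls r ri) => z; apply: Dsub.
  have row1 q : q < i -> row s1 (kap q) (len q) = row s1 (kap q) (len (F q)).
    move=> qi; have qM := ltn_trans qi iM; have kq := kap_le qM.
    have kqi := leq_ltn_trans kq qi.
    have fM := leq_ltn_trans (F_le qM) qM.
    by rewrite !rowlt ?len_le // hrow.
  have el1 : vr s' xbad = 0 -> forall r, r <= i -> elementary (offsets l Lam (row s1 r)).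
    move=> b0 r; rewrite leq_eqVlt => /predU1P[->|ri].
      apply: (offsets_ext (cls := id)) => // _ _ [j jl ->] [j' j'l ->].
      by rewrite /offset !mulgV; split; [rewrite mulg1 | exact: commute1].
    by apply: (offsets_ext (cls := row s' r)) (hel b0 r ri) => j; apply: rowlt.
  have Dst : D r0 (Lam (len i) / Lam (len (F i)))%g by exists i; split.
  have li := len_le iM; have lF := len_le FiM.
  have cl0 := cls1 r0 r0i.
  have rest s2 : word_memory W B R0 s2 -> vr s2 xi = i -> vr s2 xp = F i ->
      vr s2 xoff = i * l.+1 -> vr s2 xm = N -> vr s2 xbad = vr s' xbad ->
      ar s2 PV = ar s PV -> ar s2 FST = ar s FST -> ar s2 LEN = ar s LEN -> ar s2 PAR = PARf ->
      ar s2 CLS = ar s1 CLS ->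
      (forall x, x < i.+1 -> F x = x -> ar s2 REP x = kap x * l.+1) ->
      tm s2 <= tm s1 + 4 ->
      wp (xo <~ Ar REP ($xp);; xcs <~ Ar CLS ($xo [+] Ar LEN ($xp));;
          xct <~ Ar CLS ($xo [+] Ar LEN ($xi));; query_classes;; join_classes;;
          xoff <~ $xoff [+] $xl [+] Cn 1;; xi <~ $xi [+] Cn 1) I s2.
    move=> mem2 hi2 hp2 hoff2 hm2 hb2 hPV2 hFST2 hLEN2 hPAR2 hC2 hREP2 ht2.
    have hro : ar s2 REP (F i) = r0 * l.+1.
      by rewrite hREP2 ?F_idem // -?kap_F // ltnS F_le.
    have hl1 : ar s2 LEN (F i) = len (F i) by rewrite hLEN2 hlen.
    have hl2 : ar s2 LEN i = len i by rewrite hLEN2 hlen.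
    have clle j : j <= l -> row s1 r0 j <= l by apply: (cls_le cl0).
    have rE : (fun j => ar s2 CLS (r0 * l.+1 + j)) = row s1 r0 by rewrite hC2.
    do 7!wp_step.
    apply: (@wp_query_classes _ _ g phi phi_homo W B R0 _ (len (F i)) (len i) (r0 * l.+1)).
    + by apply: word_memory_keep mem2 _ _ _ _.
    + exact: lF.
    + exact: li.
    + by move=> j jl; rewrite /= hC2; apply: clle.
    + by rewrite /= hp2 hro.
    + by rewrite /= hp2 hro hl1.
    + by rewrite /= hp2 hro hi2 hl2.
    rewrite /= hp2 hro hi2 hl1 hl2 rE hb2 => s3 mem3 bad3 t3 [k31 k32 k33 k34].
    have [n1 n2 n3 n4 n5] := mem3.
    apply: wp_seq; apply: (@wp_join_classes _ _ g phi W _ (r0 * l.+1)) => //; first by rewrite k31.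
    rewrite !k31 // !k32 //= hC2 => s4 c4 o4 t4 [k41 k42 k43 k44].
    have mem4 : word_memory W B R0 s4.
      by apply: word_memory_keep mem3 _ _ _ _; rewrite ?k41 // k43.
    have row4 j : j <= l -> row s4 r0 j = join (row s1 r0) (row s1 r0 (len (F i))) (row s1 r0 (len i)) j.
      by move=> jl; rewrite /row c4.
    have row4N r j : r != r0 -> j <= l -> row s4 r j = row s1 r j.
      move=> rr0 jl; rewrite /row o4 //.
      by case: (ltngtP r r0) rr0 => // h _; [exact: row_out | exact: row_out'].
    have [q1 q2 q3 q4 q5] := mem4.
    have tE : (M - i) * position_time = (M - i.+1) * position_time + position_time.
      by rewrite -mulSnr subnSK.
    do 3!wp_step; exists i.+1; rewrite /= q2; kv k41; ka k42; kv k31; ka k32; rewrite /= hi2 hoff2 hm2 addn1.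
    split=> //.
    + by split; split=> //; rewrite ?mulSn; clear; lia.
    + split=> //.
      * move=> r; rewrite ltnS => ri; have [E|rr0] := eqVneq r r0.
          rewrite E; apply: (classes_ext (cls := join (row s1 r0) (row s1 r0 (len (F i))) (row s1 r0 (len i)))).
            by move=> j jl; apply: row4.
          exact: classes_join.
        apply: (classes_ext (cls := row s1 r)); last exact: cls1.
        by move=> j jl; apply: row4N.
      * move=> q; rewrite ltnS leq_eqVlt => /predU1P[->|qi].
          by rewrite -/r0 -[LHS]/(row s4 r0 _) -[RHS]/(row s4 r0 _) !row4 // join_eq.
        have qM := ltn_trans qi iM; have fM := leq_ltn_trans (F_le qM) qM.
        rewrite -[LHS]/(row s4 (kap q) _) -[RHS]/(row s4 (kap q) _).
        have [E|rr0] := eqVneq (kap q) r0; last by rewrite !row4N ?len_le // row1.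
        by rewrite E !row4 ?len_le //; apply: join_mono; rewrite -E row1.
    + split.
      * case/bad3 => b0 qs r; rewrite ltnS => ri; have [E|rr0] := eqVneq r r0.
          rewrite E; apply: (offsets_ext (cls := join (row s1 r0) (row s1 r0 (len (F i))) (row s1 r0 (len i)))).
            by move=> j jl; apply: row4.
          by apply: (elementary_join cl0) => //; apply: el1.
        apply: (offsets_ext (cls := row s1 r)); last exact: el1.
        by move=> j jl; apply: row4N.
      (* If all complete blocks were elementary, none of the queries could have failed, since they
         concern quotients of one block only. *)
      * move=> b3 el; apply: b3; apply/bad3.
        have b0 : vr s' xbad = 0 by apply/eqP; apply: contraT => /eqP/hbad; case.
        split=> // j jl; apply: (query_necessary cl0 lF li Dst (el r0)) => // z.
        by case=> q [qi kq ->]; exists q; split=> //; apply: leq_trans qi iM.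
      * have ptE : position_time = l.+1 * query_time phi W + l.+1 * 7 + 40.
          by rewrite /position_time mulnDr.
        move: ht t1 t3 t4 ht2 ptE => /=; rewrite tE.
        by move: position_time (query_time _ _) => pt qt; clear; slia.
  apply: wp_seq; apply: wp_if => /=.
    kv k1; rewrite /= hi subn_gt0 => Fi.
    wp_step; apply: rest; rewrite /=; kv k1; ka k2; rewrite //=; try by clear; lia.
    + move=> x; rewrite ltnS leq_eqVlt => /predU1P[->|xi]; first by move=> E; rewrite E ltnn in Fi.
      exact: hREP.
  kv k1; rewrite /= hi => /eqP; rewrite subn_eq0 => iF.
  have Fi : F i = i by apply/eqP; rewrite eqn_leq F_le.
  have [p1 p2 p3 p4] := kap_par iM Fi.
  have oldR x : x < i -> F x = x -> ar s1 REP x = kap x * l.+1.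
    by move=> xi Fx; rewrite k2 //=; apply: hREP.
  apply: wp_if => /=; kv k1; ka k2; rewrite /= hi hPAR' => pi.
    rewrite subn_gt0 in pi.
    wp_step; apply: rest; rewrite /=; kv k1; ka k2; rewrite //=; try by clear; lia.
    + move=> x; rewrite ltnS leq_eqVlt hi => /predU1P[->|xi] Fx.
        by rewrite eqxx hPAR' hREP // p3.
      by rewrite ltn_eqF //; exact: hREP.
  move/eqP: pi; rewrite subn_eq0 => pi.
  have PE : PARf i = i by apply/eqP; rewrite eqn_leq p1.
  wp_step; apply: rest; rewrite /=; kv k1; ka k2; rewrite //=; try by clear; lia.
  + move=> x; rewrite ltnS leq_eqVlt hi => /predU1P[->|xi] Fx; first by rewrite eqxx p4.
    by rewrite ltn_eqF //; exact: hREP.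
- move=> s' [i [iM mem' [[hi hoff hm'] _] [hREP hcls hrow] [hel hbad ht]]] /= d0.
  have iE : i = M by move: d0; rewrite hm' hi; clear -iM; lia.
  rewrite iE in hcls hrow hel ht; split=> //=; last by clear -ht; lia.
  split=> [b0 r|el]; last by apply/eqP; apply: contraT => /eqP/hbad; case.
  (* Block numbers are positions, so for [r >= M] there is no quotient to consider. *)
  have [rM|Mr] := ltnP r M.
    apply: sub_elementary (elementary_generated (hel b0 r rM)) => _ [q [qM kq ->]].
    have fM := leq_ltn_trans (F_le qM) qM.
    by apply: offsets_generated; rewrite ?len_le // -kq hrow.
  by move=> x y [q [qM kq _]]; have := kap_le qM; rewrite kq leqNgt (leq_trans qM Mr).
Qed.

End CheckLoop.

(** * Printing the certificate *)

Section Print.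
Variables (orc : seq int -> bool -> Prop) (phi : nat -> nat).
Variables (k : nat) (gT : groupType) (g : 'I_k -> gT) (n m : nat).
Variables (en : 'I_m -> 'I_n * 'I_n) (lab : 'I_m -> word k).
Local Notation G := (word_graph g en lab).
Local Notation wp := (wp orc phi).
Implicit Types (s : astate).

Lemma trail_stored_keep s s' (C : seq (garc G)) : trail_stored s C ->
  vr s' xm = vr s xm -> vr s' xcur = vr s xcur -> ar s' TR = ar s TR ->
  (forall j, j < vr s xcur -> rw s' j = rw s j) -> trail_stored s' C.
Proof.
case=> h1 h2 e1 e2 e3 low; split; first by rewrite e1.
move=> x0 j jC; rewrite e2 e3; have [h3 h4] := h2 x0 j jC; split=> //.
by apply: holds_ext h3 => i hi; apply: low; clear -hi h4; lia.
Qed.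

Lemma wp_print_trail s (C : seq (garc G)) (Q : astate -> Prop) : trail_stored s C ->
  (forall s', ou s' = ou s ++ flatten [seq arc_code x | x <- C] ->
     tm s' <= tm s + (5 * size C + 2) -> keeps print_trail s s' -> Q s') ->
  wp print_trail Q s.
Proof.
move=> [hm hTR] post.
suff : wp print_trail (fun s' => ou s' = ou s ++ flatten [seq arc_code x | x <- C] /\
     tm s' <= tm s + (5 * size C + 2)) s.
  by move=> /wp_keeps/wp_conseq; apply => s' [[h1 h2] h5]; apply: post.
pose I s' := exists i, [/\ i <= size C, vr s' xi = i,
  [/\ vr s' xm = size C, rw s' = rw s & ar s' TR = ar s TR],
  ou s' = ou s ++ flatten [seq arc_code x | x <- take i C] &
  tm s' <= tm s + 1 + 5 * i].
do 2!wp_step; apply: (@wp_while _ _ (tm s + 1 + 5 * size C) I).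
- by exists 0; rewrite take0 cats0; split=> //=; clear; lia.
- by move=> s' [i [iC _ _ _ h]]; clear -h iC; lia.
- move=> s' [i [_ hi [hm' hr hT] ho ht]] /= d0.
  have iC : i < size C by rewrite hm' hi subn_gt0 in d0.
  have [x0 _] : exists x0, x0 \in C by case: (C) iC => // x0 *; exists x0; rewrite mem_head.
  have [hrec _] := hTR x0 i iC; have [r0 r1 _ _ _] := holds_record hrec.
  do 7!wp_step; exists i.+1; rewrite /= hm' hi hT hr r0 r1 addn1; split=> //.
    rewrite ho (take_nth x0) // map_rcons flatten_rcons catA /arc_code.
    by rewrite -!cats1 -!catA.
  by clear -ht; lia.
- move=> s' [i [iC hi [hm' hr hT] ho ht]] /= d0.
  have iE : i = size C by move: d0; rewrite hm' hi; clear -iC; lia.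
  by rewrite iE take_size in ho ht; split=> //=; clear -ht; lia.
Qed.

Lemma wp_print_word s (w : word k) (Q : astate -> Prop) : vr s xlen = size w ->
  holds (rw s) (vr s xwb) (word_code w) ->
  (forall s', ou s' = ou s ++ word_code w ->
     tm s' <= tm s + (3 * size w + 2) -> keeps print_word s s' -> Q s') ->
  wp print_word Q s.
Proof.
move=> hl hw post.
suff : wp print_word (fun s' => ou s' = ou s ++ word_code w /\
     tm s' <= tm s + (3 * size w + 2)) s.
  by move=> /wp_keeps/wp_conseq; apply => s' [[h1 h2] h5]; apply: post.
pose I s' := exists i, [/\ i <= size w, vr s' xj = i,
  [/\ vr s' xlen = size w, vr s' xwb = vr s xwb & rw s' = rw s],
  ou s' = ou s ++ take i (word_code w) & tm s' <= tm s + 1 + 3 * i].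
have szw := size_word_code w.
do 2!wp_step; apply: (@wp_while _ _ (tm s + 1 + 3 * size w) I).
- by exists 0; rewrite take0 cats0; split=> //=; clear; lia.
- by move=> s' [i [iC _ _ _ h]]; clear -h iC; lia.
- move=> s' [i [_ hi [hm' hb hr] ho ht]] /= d0.
  have iC : i < size w by rewrite hm' hi subn_gt0 in d0.
  do 3!wp_step; exists i.+1; rewrite /= hi hr hb addn1; split=> //; last by clear -ht; lia.
  by rewrite ho (take_nth 0%R) ?szw // -!cats1 -catA hw ?szw.
- move=> s' [i [iC hi [hm' hb hr] ho ht]] /= d0.
  have iE : i = size w by move: d0; rewrite hm' hi; clear -iC; lia.
  by rewrite iE -szw take_size in ho; rewrite iE in ht; split=> //=; clear -ht; lia.
Qed.

Lemma wp_print_words s (alpha : 'I_n -> word k) (l : nat) (Q : astate -> Prop) : vr s xn = n ->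
  (forall v : 'I_n, [/\ ar s LEN (ar s FST v) = size (alpha v), size (alpha v) <= l
     & holds (rw s) (vr s xwb) (word_code (alpha v))]) ->
  (forall s', ou s' = ou s ++ flatten [seq sized_word_code (alpha v) | v <- enum 'I_n] ->
     tm s' <= tm s + (n * (6 + 3 * l) + 2) -> keeps print_words s s' -> Q s') ->
  wp print_words Q s.
Proof.
move=> hn hal post.
suff : wp print_words (fun s' =>
     ou s' = ou s ++ flatten [seq sized_word_code (alpha v) | v <- enum 'I_n] /\
     tm s' <= tm s + (n * (6 + 3 * l) + 2)) s.
  by move=> /wp_keeps/wp_conseq; apply => s' [[h1 h2] h5]; apply: post.
pose I s' := exists i, [/\ i <= n, vr s' xv = i,
  [/\ vr s' xn = n, vr s' xwb = vr s xwb, rw s' = rw s, ar s' LEN = ar s LEN & ar s' FST = ar s FST],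
  ou s' = ou s ++ flatten [seq sized_word_code (alpha v) | v <- take i (enum 'I_n)] &
  tm s' + (n - i) * (6 + 3 * l) <= tm s + 1 + n * (6 + 3 * l)].
do 2!wp_step; apply: (@wp_while _ _ (tm s + 1 + n * (6 + 3 * l)) I).
- by exists 0; rewrite take0 cats0 subn0; split.
- by move=> s' [i [iC _ _ _ h]]; apply: leq_trans h; apply: leq_addr.
- move=> s' [i [_ hi [hn' hb hr hL hF] ho ht]] /= d0.
  have iC : i < n by rewrite hn' hi subn_gt0 in d0.
  pose v := Ordinal iC; have [a1 a2 a3] := hal v.
  have lenE : ar s' LEN (ar s' FST (vr s' xv)) = size (alpha v) by rewrite hL hF hi.
  do 5!wp_step; apply: (@wp_print_word _ (alpha v)); rewrite /= ?lenE ?hr ?hb //.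
  move=> s2 o2 t2 [k1 k2 k3 k4].
  have tE : (n - i) * (6 + 3 * l) = (n - i.+1) * (6 + 3 * l) + (6 + 3 * l).
    by rewrite -mulSnr subnSK.
  wp_step; exists i.+1; rewrite /= o2; kv k1; ka k2; rewrite (k3 isT) /= ?lenE hi addn1; split=> //.
    have -> : take i.+1 (enum 'I_n) = rcons (take i (enum 'I_n)) v.
      rewrite (take_nth v) ?size_enum_ord //; congr rcons.
      by apply: val_inj; rewrite /= nth_enum_ord.
    by rewrite map_rcons flatten_rcons catA ho /sized_word_code -cats1 -!catA.
  move: ht t2 a2 => /=; rewrite tE.
  by move: (size (alpha v)) ((n - i.+1) * (6 + 3 * l)) (n * (6 + 3 * l)) => x y z; clear; lia.
- move=> s' [i [iC hi [hn' hb hr hL hF] ho ht]] /= d0.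
  have iE : i = n by move: d0; rewrite hn' hi; clear -iC; lia.
  rewrite iE take_oversize ?size_enum_ord // in ho; split=> //=.
  by clear -ht; lia.
Qed.

End Print.

(** * The partition of the vertices found by the scan *)

Section Scanned.
Variables (gT : groupType) (G : lgraph gT) (a b : vert G) (C : seq (garc G)).
Hypothesis eC : eulerian_trail a C b.
Local Notation M := (#|edge G|.+1).
Local Notation F := (fun q => first_visit a C (pvert a C q)).
Variables (La ST ML PAR kap : nat -> nat) (sp : nat).
Hypothesis I : scanned M (pvert a C) F La M M sp ST ML PAR kap.

Definition vertex_block u := kap (first_visit a C u).

Lemma vertex_blockE q : q < M -> vertex_block (pvert a C q) = kap q.
Proof. by move=> qM; rewrite /vertex_block -(kap_F I qM). Qed.

Lemma noncrossing_vertex_block : noncrossing M vertex_block (pvert a C).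
Proof.
move=> p q x y pM qM xM yM; rewrite !vertex_blockE // => kpq kxy kpx.
have ne i j : kap i <> kap j -> i <> j by move=> kij ij; rewrite ij in kij.
have px := ne _ _ kpx; have qx : q <> x by apply: ne; rewrite -kpq.
have py : p <> y by apply: ne; rewrite -kxy.
have qy : q <> y by apply: ne; rewrite -kxy -kpq.
apply/negP => cr.
have nc i j r u : i < j -> j < r -> r < u -> u < M -> kap i = kap r -> kap j = kap u ->
  kap i <> kap j -> False by move=> h1 h2 h3 h4 h5 h6; apply; exact: (nc4 I h1 h2 h3 h4 h5 h6).
(* Either chord may start first and each may run in either direction, which leaves eight linear
   orders, each excluded by [nc4]. *)
have orders : [|| [&& p < x, x < q & q < y], [&& p < y, y < q & q < x],
    [&& q < x, x < p & p < y], [&& q < y, y < p & p < x],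
    [&& x < p, p < y & y < q], [&& x < q, q < y & y < p],
    [&& y < p, p < x & x < q] | [&& y < q, q < x & x < p]].
  move: cr; rewrite /cross /=; clear -px qx py qy.
  case: (ltngtP p x) px => // h1; case: (ltngtP p y) py => // h2;
    case: (ltngtP q x) qx => // h3; case: (ltngtP q y) qy => // h4 *; lia.
by case/or4P: orders => [| | |/or4P[| | |/orP[|]]] /and3P[h1 h2 h3];
  apply: (nc _ _ _ _ h1 h2 h3); congruence.
Qed.

Lemma vertex_block_sound E : interlacement M (pvert a C) E -> forall p q, p < M -> q < M ->
  vertex_block (pvert a C p) = vertex_block (pvert a C q) -> E p q.
Proof.
move=> iE p q pM qM; rewrite !vertex_blockE // => kpq; have [_ sE tE _] := iE.
have kM := leq_ltn_trans (kap_le I qM) qM.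
have E1 := kap_sound I iE pM; have E2 := kap_sound I iE qM; rewrite kpq in E1.
by apply: (tE _ _ _ pM kM qM E1); apply: sE.
Qed.

End Scanned.

Definition decide_time (phi : nat -> nat) (n l N : nat) :=
  11 * N + 5 * l + 8 + (3 * N + 5) + (3 * l + 4) + (20 * N.+1 + 3)
  + (4 + N.+1 * (l.+1 * (40 * l + 42 + phi (8 * l)) + 40)) + 3
  + (5 * N + 2) + (n * (6 + 3 * l) + 2).

(** * The verdict *)

Section Decide.
Variables (k : nat) (gT : groupType) (g : 'I_k -> gT) (phi : nat -> nat).
Hypothesis phi_homo : {homo phi : i j / i <= j}.
Variables (n m : nat) (en : 'I_m -> 'I_n * 'I_n) (lab : 'I_m -> word k).
Variables (a b : 'I_n).
Local Notation G := (word_graph g en lab).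
Local Notation l := (total_length lab).
Local Notation wp := (wp (word_oracle g) phi).
Implicit Types (s : astate).
Hypothesis cG : connected_graph G.

Definition verdict (o : seq int) : Prop :=
  (~ @all_eulerian_same_label gT G a b /\ o = [:: 0%R])
  \/ (@all_eulerian_same_label gT G a b /\
      ((~ (exists C, @eulerian_trail gT G a C b) /\ o = [:: 1%R; 0%R])
       \/ (exists (C : seq (garc G)) (alpha : 'I_n -> word k),
           [/\ @eulerian_trail gT G a C b,
               o = [:: 1%R; 1%R] ++ certificate_code C alpha,
               difference alpha <= l
             & forall X : {set vert G}, core X ->
               exists r : nat,
               isomorphic_Z2_pow
                 (label_group (core_graph
                    (G := @shift gT G (fun v => word_val g (alpha v))) X C))
                 r]))).

Section Blocks.
Variable C : seq (garc G).
Hypothesis eC : eulerian_trail (G := G) a C b.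
Local Notation W := (trail_word lab C).
Local Notation v := (pvert (G := G) a C).
Local Notation F := (fun q => first_visit (G := G) a C (v q)).
Local Notation len := (fun q => size (trail_word lab (take q C))).
Local Notation M := (#|edge G|.+1).
Variables (La ST ML PAR kap : nat -> nat) (sp : nat).
Hypothesis I : scanned M v F La M M sp ST ML PAR kap.

(** A quotient of two positions of one vertex is a product of their quotients against the first
    visit, up to inversion, so both families generate the same group. *)
Lemma block_class_elementary :
  (forall r, elementary (block_label g W F kap len (size C).+1 r)) <->
  forall r, elementary (class_label M (vertex_block (G := G) a C kap) v (plab (G := G) C) r).
Proof.
have lamE q : prefix_label g W (len q) = plab (G := G) C q by rewrite plab_word.
have szC := size_eulerian eC.
split=> el r; last first.
  apply: sub_elementary (el r) => _ [q [qC kq ->]]; have qM : q < M by rewrite -szC.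
  have [h1 h2 h3] := first_visitP eC qM.
  by exists (F q), q; rewrite h3 (vertex_blockE I) // !lamE.
apply: sub_elementary (elementary_generated (el r)) => _ [p [q [pM qM vpq kp ->]]].
have gen x : x < M -> kap x = r ->
    generated (block_label g W F kap len (size C).+1 r)
      (plab (G := G) C x / plab (G := G) C (F x))%g.
  by move=> xM kx; apply: generated_mem; exists x; rewrite szC -!lamE.
rewrite (vertex_blockE I) // in kp.
have kq : kap q = r by rewrite -kp -(vertex_blockE I qM) -vpq (vertex_blockE I).
have := generated_mul (gen q qM kq) (generated_inv (gen p pM kp)).
by rewrite vpq invgM invgK !mulgA mulgVK.
Qed.

End Blocks.

Lemma wp_decide s (C : seq (garc G)) (Q : astate -> Prop) :
  eulerian_trail (G := G) a C b -> trail_stored s C -> vr s xa = a -> vr s xn = n ->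
  ou s = [::] ->
  (forall s', verdict (ou s') -> tm s' <= tm s + decide_time phi n l m -> Q s') ->
  wp (positions;; first_visits;; inverse_word;; blocks;; check_labels;;
    Ifc ($xbad) (Prt (Cn 0)) (
      Prt (Cn 1);; Prt (Cn 1);; print_trail;; print_words)) Q s.
Proof.
move=> eC ts ha hn ho post.
have szC := size_eulerian eC; have szW := size_trail_word eC.
have szm : size C = m by rewrite szC card_ord.
set W := trail_word lab C in szW; set B := vr s xcur.
pose v := pvert (G := G) a C; pose F q := first_visit (G := G) a C (v q).
pose len q := size (trail_word lab (take q C)).
apply: wp_seq; apply: (wp_positions _ _ ts ha) => s1 PV1 LEN1 LST1 wb1 len1 w1 low1 t1 [k11 k12 k13 k14].
have m1 : vr s1 xm = size C by kv k11; case: ts.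
apply: wp_seq; apply: (wp_first_visits _ _ eC m1 PV1) => s2 FST2 t2 [k21 k22 k23 k24].
have len2 : vr s2 xlen = size W by kv k21.
have wb2 : vr s2 xwb = B by kv k21.
have w2 : holds (rw s2) (vr s2 xwb) (word_code W) by rewrite (k23 isT) wb2.
apply: wp_seq; apply: (wp_inverse_word _ _ len2 w2); rewrite wb2.
move=> s3 l3 qb3 w3 low3 t3 [k31 k32 k33 k34].
pose La q := ar s1 LST (v q).
have fP p : p < (size C).+1 -> [/\ F p <= p, F p < (size C).+1 & v (F p) = v p].
  by rewrite szC => pM; exact: (first_visitP eC pM).
have lP p : p < (size C).+1 -> [/\ p <= La p, La p < (size C).+1 & v (La p) = v p].
  by move=> pM; have [] := LST1 p pM.
have PVF q : q < (size C).+1 -> ar s3 FST (ar s3 PV q) = F q.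
  move=> qC; ka k32; rewrite (k22 PV isT) PV1 // FST2 //.
apply: wp_seq; apply: (@wp_blocks _ _ _ (size C) v F La) => //.
- by move=> q /fP[].
- by move=> q /fP[].
- by move=> q q' _ _ vq; rewrite /F vq.
- by move=> q /lP[].
- by move=> q /lP[].
- by move=> q /lP[].
- by move=> q q' _ _ vq; rewrite /La vq.
- by kv k31; kv k21.
- by move=> q qC; ka k32; ka k22; rewrite PV1.
move=> s4 sp kap I4 t4 [k41 k42 k43 k44].
have low4 j : j < B -> rw s4 j = rw s j.
  by move=> jB; rewrite (k43 isT) low3 ?(k23 isT) ?low1 // ltn_addr.
have mem4 : word_memory W B (rw s) s4.
  split; [by kv k41; kv k31|by kv k41|by kv k41| | split=> //].
    rewrite wb2 in w2; rewrite (k43 isT); apply: holds_ext w2 => j.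
    by rewrite size_word_code => /andP[_]; apply: low3.
  by rewrite (k43 isT).
have I5 := I4; rewrite szC in I5.
apply: wp_seq; apply: (@wp_check_labels _ _ g phi phi_homo W B (rw s) (size C) F kap len (ar s4 PAR)) => //.
- by move=> q /fP[].
- by move=> q /fP[_ _ vq]; rewrite /F vq.
- by move=> q qM; rewrite (kap_F I4).
- by move=> q qM; rewrite (kap_le I4).
- by move=> x xM Fx; apply: (kap_par I4).
- by move=> q _; apply: size_trail_word_take.
- by kv k41; kv k31; kv k21.
- by move=> q qC; ka k42; apply: PVF.
- by move=> q qC; ka k42; ka k32; ka k22; apply: LEN1.
move=> s5 mem5 bad5 t5 [k51 k52 k53 k54].
have bcE := block_class_elementary eC I5.
have nc := noncrossing_vertex_block I5.
have tE : tm s5 + 3 + (5 * size C + 2) + (n * (6 + 3 * l) + 2) <= tm s + decide_time phi n l m.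
  move: t1 t2 t3 t4 t5; rewrite /decide_time /position_time /query_time -/W szW szm.
  have -> : 40 * l + 35 + phi (8 * l) + 7 = 40 * l + 42 + phi (8 * l) by clear; lia.
  by move: (m.+1 * _) (n * _) => X Y; clear; lia.
have ou5 : ou s5 = [::] by rewrite (k54 isT) (k44 isT) (k34 isT) (k24 isT) (k14 isT).
apply: wp_if => /= hb.
  wp_step; apply: post; last by apply: leq_trans tE; rewrite /=; clear; lia.
  left; rewrite /= ou5; split=> // same.
  have el := same_label_elementary eC (vertex_block_sound I5) same.
  by move/bcE/bad5: el => b0; rewrite b0 in hb.
have /bcE el := proj1 bad5 hb.
have same := elementary_same_label eC nc el.
(* A prefix of the word of [C], which has length [l], meets the bound on the difference. *)
pose alpha (u : 'I_n) : word k := take (len (first_visit (G := G) a C u)) W.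
have alphaE : (fun u => word_val g (alpha u)) = potential (G := G) a C.
  by apply: functional_extensionality => u; rewrite /potential plab_word.
have [n1 n2 n3 n4 [n5 n6]] := mem5.
do 4!wp_step.
have ts5 : trail_stored s5 C.
  apply: trail_stored_keep ts _ _ _ n6.
  - by kv k51; kv k41; kv k31; kv k21; kv k11.
  - by kv k51; kv k41; kv k31; kv k21; kv k11.
  - by ka k52; ka k42; ka k32; ka k22; ka k12.
apply: wp_seq; apply: (@wp_print_trail _ _ _ _ g _ _ en lab _ C).
  by apply: trail_stored_keep ts5 _ _ _ _.
rewrite /= ou5 => s6 ou6 t6 [k61 k62 k63 k64].
apply: (@wp_print_words _ _ _ _ _ alpha l).
- by kv k61; rewrite /=; kv k51; kv k41; kv k31; kv k21; kv k11.
- move=> u; have lu : len (first_visit (G := G) a C u) <= size W by apply: size_trail_word_take.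
  have [p pM vp] := vertex_position eC u cG; have pC : p <= size C by rewrite szC.
  have [f1 f2 f3] := fP p pC.
  split.
  + rewrite /alpha size_takel //; ka k62; rewrite /=; ka k52; ka k42; ka k32.
    rewrite -vp FST2 //; ka k22; rewrite LEN1 //.
  + by rewrite /alpha size_takel // -szW.
  + have -> : vr s6 xwb = B by kv k61.
    rewrite (k63 isT) /=; move: n4; rewrite -{1}(cat_take_drop (len (first_visit (G := G) a C u)) W).
    by rewrite /word_code map_cat holds_cat => -[].
move=> s7 ou7 t7 _; apply: post; last first.
  by apply: leq_trans tE; move: t6 t7 => /=; move: (n * _) => X; clear; lia.
right; split=> //; right; exists C, alpha; split=> //.
- by rewrite ou7 ou6 /certificate_code -!catA.
- apply/bigmax_leqP => u _; rewrite /alpha -szW size_take.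
  by case: ltnP => // /ltnW.
- by move=> X cX; rewrite alphaE; exact: (core_label_group eC cG nc el cX).
Qed.

End Decide.

(** For [l = 0] or [m = 0] the product vanishes although the algorithm still takes time, hence the
    maxima with 1. The lower bound on [phi] absorbs the copying of the queried words. *)
Lemma total_time_le (phi : nat -> nat) (n m l : nat) : {homo phi : i j / i <= j} ->
  (forall i, maxn 1 i <= phi i) -> n <= m.*2.+1 ->
  10 * n + 8 * m + 10 + (64 * m + 21) + decide_time phi n l m + 5 <=
  600 * (maxn 1 l * maxn 1 m) * phi (12 * l).
Proof.
move=> ph pge nm; have p1 := leq_trans (leq_maxl 1 _) (pge (12 * l)).
have p12 := leq_trans (leq_maxr 1 _) (pge (12 * l)).
have p8 : phi (8 * l) <= phi (12 * l) by apply: ph; rewrite leq_mul2r orbT.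
rewrite -mulnA; set A := maxn 1 l; set B := maxn 1 m; set P := phi (12 * l) in p1 p12 p8 *.
have A1 : 1 <= A := leq_maxl _ _; have B1 : 1 <= B := leq_maxl _ _.
have lA : l <= A := leq_maxr _ _; have mB : m <= B := leq_maxr _ _.
have AP1 : 1 <= A * P by rewrite muln_gt0 A1.
(* From [12 l <= P] follows [40 l <= 4 P]; with [42 <= 42 P] and [phi (8 l) <= P] this gives [47 P],
   doubled by [l.+1 <= 2 A], and the summand 40 raises 94 to 134. *)
have h1 : l.+1 * (40 * l + 42 + phi (8 * l)) + 40 <= 134 * (A * P).
  have : l.+1 * (40 * l + 42 + phi (8 * l)) <= (2 * A) * (47 * P).
    by apply: leq_mul; [clear -lA A1; lia | clear -p1 p12 p8; lia].
  by rewrite mulnACA; move: (l.+1 * _) (A * P) AP1 => X Y; clear; lia.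
have h2 : m.+1 * (l.+1 * (40 * l + 42 + phi (8 * l)) + 40) <= 268 * (A * B * P).
  have : m.+1 * (l.+1 * (40 * l + 42 + phi (8 * l)) + 40) <= (2 * B) * (134 * (A * P)).
    by apply: leq_mul => //; clear -mB B1; lia.
  by move=> /leq_trans; apply; rewrite mulnACA (mulnCA B A P) (mulnA A B P).
have h3 : n * (6 + 3 * l) <= 27 * (A * B * P).
  have : n * (6 + 3 * l) <= (3 * B) * (9 * A).
    by apply: leq_mul; [clear -nm mB B1; lia | clear -lA A1; lia].
  rewrite mulnACA (mulnC B) => /leq_trans; apply; rewrite /= leq_mul2l /=.
  by rewrite -[X in X <= _]muln1 leq_mul.
have h4 : A <= A * B * P by rewrite -mulnA leq_pmulr // muln_gt0 B1.
have h5 : B <= A * B * P by rewrite (mulnC A) -mulnA leq_pmulr // muln_gt0 A1.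
rewrite /decide_time; move: h2 h3 h4 h5.
by move: (m.+1 * _) (n * (6 + _)) (A * B * P) => X Y Z; clear -nm mB B1 lA A1; lia.
Qed.

(* Output format: 0 = "no"; 1, 0 = "yes, and there is no Eulerian trail from a
   to b"; 1, 1 followed by an Eulerian trail C and the words alpha_v = "yes". *)
Theorem theorem5p5 :
  exists (P : prog) (c : nat),
  forall (k : nat) (gT : groupType) (g : 'I_k -> gT) (phi : nat -> nat)
    (n m : nat) (en : 'I_m -> 'I_n * 'I_n) (lab : 'I_m -> word k)
    (adj : 'I_n -> seq (arc_of 'I_m)) (a b : 'I_n),
  generates g ->
  {homo phi : i j / i <= j} ->
  (forall i, maxn 1 i <= phi i) ->
  adjacency_list en adj ->
  let G := word_graph g en lab in
  let l := total_length lab in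
  connected_graph G ->
  exists (t : nat) (s : state),
  [/\ exec (word_oracle g) phi P (init_state (input_code en lab adj a b)) t s,
      t <= c * (maxn 1 l * maxn 1 m) * phi (12 * l)
    & (~ @all_eulerian_same_label gT G a b /\ out s = [:: 0%R])
      \/ (@all_eulerian_same_label gT G a b /\
          ((~ (exists C, @eulerian_trail gT G a C b) /\
            out s = [:: 1%R; 0%R])
           \/ (exists (C : seq (garc G)) (alpha : 'I_n -> word k),
               [/\ @eulerian_trail gT G a C b,
                   out s = [:: 1%R; 1%R] ++ certificate_code C alpha,
                   difference alpha <= l
                 & forall X : {set vert G}, core X ->
                   exists r : nat,
                   isomorphic_Z2_pow
                     (label_group (core_graph
                        (G := @shift gT G (fun v => word_val g (alpha v))) X C))
                     r])))].
Proof.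
(* 600 bounds the ticks of the while program, and the other factor is the cost of compilation. *)
exists (compile program), (compile_time program * 600).
move=> k gT g phi n m en lab adj a b _ ph pge adjP G l cG.
pose input := input_code en lab adj a b.
pose s0 := AState (fun=> 0) (fun _ _ => 0) (fun j => nth 0%R input j) [::] 0.
have R0 : represents s0 (init_state input).
  (* Array entries live at negative addresses, where the initial memory is 0. *)
  split=> // c j /andP[c0 _] /=.
  by have -> : 16 * j + c = (16 * j + c.-1).+1 by clear -c0; lia.
have nm : n <= m.*2.+1 by have := connected_card cG; rewrite !card_ord.
have tle := total_time_le l ph pge nm.
suff [s' [ae [ver ht]]] : wp (word_oracle g) phi program
    (fun s' => verdict g en lab a b (ou s') /\
       tm s' <= 600 * (maxn 1 l * maxn 1 m) * phi (12 * l)) s0.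
  have [t [s1 [ex [_ _ _ o1] ht1]]] := compile_exec ae program_ok R0.
  exists t, s1; split=> //; last by rewrite o1.
  rewrite /= muln0 addn0 in ht1; apply: leq_trans ht1 _.
  by rewrite -!mulnA leq_mul2l !mulnA in ht *; rewrite ht orbT.
apply: wp_seq; apply: (wp_read_input _ _ adjP); first by move=> j _; rewrite add0n.
move=> s1 par1 bad1 t1 [k11 k12 k13 k14].
have even_trail := @even_parity _ gT g n m en lab adj a b adjP.
apply: wp_if => /= hb.
  do 3!wp_step; split; last first.
    by apply: leq_trans tle; move: t1; rewrite /=; clear; lia.
  have noC : ~ exists C, @eulerian_trail gT G a C b.
    case=> C eC; have /bad1 b0 : forall v, even_at adj a b v.
      by apply/even_trail => w; apply: eulerian_parity eC.
    by rewrite b0 in hb.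
  right; split; first by move=> C D eC; case: noC; exists C.
  by left; split=> //; rewrite /= (k14 isT).
have even1 : forall v, even_at adj a b v by apply/bad1.
have [q1 q2 q3 q4 q5] := par1.
apply: wp_seq; apply: (@wp_hierholzer _ _ _ gT g _ _ en lab adj a b adjP _ _ cG) => //.
  by move=> e; rewrite /= (k12 USED isT).
move=> s2 C eC ts2 t2 [k21 k22 k23 k24].
apply: (wp_decide ph cG eC ts2) => //.
- by kv k21.
- by kv k21.
- by rewrite (k24 isT) /= (k14 isT).
move=> s' ver ht; split=> //; apply: leq_trans tle.
by move: t1 t2 ht => /=; move: (decide_time _ _ _ _) => D; clear; lia.
Qed.
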